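(* For every $\sigma\in\mathbb{R}$, the function $$\Xi_\sigma(t):=\frac{\xi(\sigma-\mathrm{i}t)}{\xi(\sigma)},\qquad t\in\mathbb{R},$$ is a characteristic function (of a probability distribution on $\mathbb{R}$). Moreover, the corresponding probability density function $P_\sigma(y)$ is given by $$P_\sigma(y)=\begin{cases}\dfrac{2}{\xi(\sigma)}\displaystyle\sum_{n=1}^\infty f(n e^{-y})\,e^{-\sigma y}, & y\le 0,\\[2ex] \dfrac{2}{\xi(\sigma)}\displaystyle\sum_{n=1}^\infty f(n e^{y})\,e^{(1-\sigma)y}, & y>0,\end{cases}$$ where $f(x):=2\pi(2\pi x^4-3x^2)e^{-\pi x^2}$.
   Context: $\zeta(s)$ is the Riemann zeta function, $\Gamma(s)$ is the Gamma function, and $\xi(s):=s(s-1)\pi^{-s/2}\Gamma(s/2)\zeta(s)$ is the complete Riemann zeta function (understood as an entire function, by analytic continuation). The characteristic function of a probability measure $\mu$ on $\mathbb{R}$ is $\widehat{\mu}(t)=\int_{\mathbb{R}}e^{\mathrm{i}ty}\,\mu(dy)$, $t\in\mathbb{R}$. *)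

(* Defs.v *)
From HB Require Import structures.
From mathcomp Require Import all_boot all_order all_algebra.
From mathcomp Require Import complex.
From mathcomp Require Import all_classical all_reals all_analysis.

Set Implicit Arguments.
Unset Strict Implicit.
Unset Printing Implicit Defensive.

Import Order.TTheory GRing.Theory Num.Theory.
Import numFieldNormedType.Exports.

Local Open Scope classical_set_scope.
Local Open Scope complex_scope.
Local Open Scope ring_scope.

Definition cexp (R : realType) (z : R[i]) : R[i] :=
  (expR (complex.Re z))%:C * (cos (complex.Im z) +i* sin (complex.Im z)).

(* a ^ s for a real base a > 0, with the principal (real) logarithm of a *)
Definition cpowR (R : realType) (a : R) (s : R[i]) : R[i] :=
  cexp (s * (ln a)%:C).

Definition cintegral (d : measure_display) (T : measurableType d)
    (R : realType) (mu : {measure set T -> \bar R}) (D : set T)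
    (g : T -> R[i]) : R[i] :=
  Rintegral mu D (fun x => complex.Re (g x)) +i*
  Rintegral mu D (fun x => complex.Im (g x)).

(* Euler's integral: the Gamma function on the half-plane 0 < Re s only *)
Definition Gamma_half_plane (R : realType) (s : R[i]) : R[i] :=
  cintegral (@lebesgue_measure R) `]0, +oo[
    (fun x => cpowR x (s - 1) * (expR (- x))%:C).

(* Dirichlet series: the zeta function on the half-plane 1 < Re s only *)
Definition zeta_half_plane (R : realType) (s : R[i]) : R[i] :=
  limn (series (fun n => cpowR n.+1%:R (- s)) : (R[i]^o)^nat).

(* The increment in [derivable] ranges over the scalar field, here R[i], so
   this is complex differentiability at every point. *)
Definition entire (R : realType) (g : R[i] -> R[i]) : Prop :=
  forall z : R[i], derivable (g : R[i]^o -> R[i]^o) z 1.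

(* By the identity theorem at most one function g satisfies this predicate:
   the values on 1 < Re s, where Gamma (s / 2) and zeta s are given by an
   absolutely convergent integral and series, determine g on the whole plane,
   including at the removable singularities of the product. *)
Definition is_complete_zeta (R : realType) (g : R[i] -> R[i]) : Prop :=
  entire g /\
  forall s : R[i], 1 < complex.Re s ->
    g s = s * (s - 1) * cpowR pi (- (s / 2)) *
          Gamma_half_plane (s / 2) * zeta_half_plane s.

(* [xget] returns an element of the set when there is one; the default value,
   the null function, does not satisfy [is_complete_zeta]. *)
Definition xi (R : realType) : R[i] -> R[i] :=
  xget (fun=> 0) [set g | is_complete_zeta g].

Definition Xi (R : realType) (sigma t : R) : R[i] :=
  xi (sigma -i* t) / xi sigma%:C.

Definition char_fun (R : realType) (mu : probability (measurableTypeR R) R)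
    (t : R) : R[i] :=
  cintegral mu setT (fun y : R => cexp (0 +i* (t * y))).

Definition is_density (R : realType) (mu : probability (measurableTypeR R) R)
    (p : R -> R) : Prop :=
  [/\ measurable_fun setT p, (forall y, 0 <= p y) &
      forall A : set (measurableTypeR R), measurable A ->
        mu A = (\int[@lebesgue_measure R]_(y in A) (p y)%:E)%E].

Definition f (R : realType) (x : R) : R :=
  2 * pi * (2 * pi * x ^+ 4 - 3 * x ^+ 2) * expR (- (pi * x ^+ 2)).

(* [series] starts at index 0, the displayed sum at 1; hence the shift n.+1. *)
Definition P_term (R : realType) (sigma y : R) (n : nat) : R :=
  if y <= 0 then f (n.+1%:R * expR (- y)) * expR (- (sigma * y))
  else f (n.+1%:R * expR y) * expR ((1 - sigma) * y).

(* Complex-valued because xi is; that the values are real is part of the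
   theorem. *)
Definition P_density (R : realType) (sigma y : R) : R[i] :=
  2 / xi sigma%:C * (limn (series (P_term sigma y)))%:C.

(* Main.v *)
From HB Require Import structures.
Require Import Defs.
From mathcomp Require Import all_boot all_order all_algebra.
From mathcomp Require Import complex.
From mathcomp Require Import all_classical all_reals all_analysis.
From mathcomp Require Import measurable_realfun ring lra.

Import Order.TTheory GRing.Theory Num.Theory.
Import numFieldNormedType.Exports.
Import Normc.

Set Implicit Arguments.
Unset Strict Implicit.
Unset Printing Implicit Defensive.

Local Open Scope classical_set_scope.
Local Open Scope complex_scope.
Local Open Scope ring_scope.

(* With x = e^(-y) and X_n = pi n^2 x^2 one has f(n x) = (4 X_n^2 - 6 X_n) e^(-X_n).
   The Mellin transform of e^(-X_n) is n^(-s) pi^(-s/2) Gamma(s/2) / 2, and two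
   integrations by parts turn it into that of f(n x), multiplied by s(s-1).
   Hence xi(s) = 2 \int F(e^(-y)) e^(-s y) dy for Re s > 1, F(x) = \sum_n f(n x).
   Differentiating Jacobi's identity theta(1/x) = x theta(x) twice gives
   F(1/x) = x F(x), so that F(e^(-y)) decays faster than every exponential at
   both ends: the integral is entire, and F(e^(-y)) is the two-branched sum
   defining P_sigma, positive because f > 0 on [1, +oo[.  The theorem is this
   integral formula at s = sigma - i t.

   Jacobi's identity is obtained by Polya's method: average (2 cos a)^(2m) over
   the N-th roots of unity, with N of the order of the square root of m, and let
   m tend to infinity.  That xi is the only entire function with the prescribed
   values follows from Goursat's theorem: an entire function vanishing on a
   half-plane gives, as the product of its four rotations about a point, an
   entire function with compact support, whose integrals against polynomial
   kernels on a diameter vanish. *)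

(** * Dominated series *)

(** The definition of [xi] prescribes values on 1 < Re s only and selects a function by [xget], so
    existence and uniqueness must both be proved before any value of [xi] is known, in particular at
    the sigma outside that half-plane. Complex differentiability is given pointwise, with no
    continuity of the derivative to start from; this is why uniqueness rests on Goursat's bisection
    and not on Green's formula. Polya's method exhibits theta(1/x) / (x theta(x)), up to the factor
    sqrt(pi), as the limit of a sequence in which x does not occur. The value at x = 1 then settles
    the constant, and neither Stirling's nor Wallis' formula enters. The variable y = - ln x turns
    Mellin transforms into two-sided Laplace transforms on the line, where every domination takes
    the single form C e^(-a|y|). *)

Section series_tools.
Variable R : realType.
Implicit Types (a b : nat -> R).

Lemma is_cvg_series_le a b : (forall k, `|a k| <= b k) ->
  cvgn (series b) -> cvgn (series a).
Proof.
move=> ab cb; apply: normed_cvg; apply: (@series_le_cvg _ _ b _ _ _ cb) => n //=.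
exact: le_trans (normr_ge0 _) (ab n).
Qed.

Lemma series_tail_le a b K : (forall k, `|a k| <= b k) -> cvgn (series b) ->
  `|limn (series a) - series a K| <= limn (series b) - series b K.
Proof.
move=> ab cb; have ca := is_cvg_series_le ab cb.
have h1 : (fun n => `|series a n - series a K|) @ \oo -->
    `|limn (series a) - series a K|.
  by apply: cvg_norm; apply: cvgB => //; exact: cvg_cst.
have h2 : (fun n => series b n - series b K) @ \oo -->
    limn (series b) - series b K.
  by apply: cvgB => //; exact: cvg_cst.
apply: (ler_cvg_to h1 h2); near=> n.
have Kn : (K <= n)%N by near: n; exists K.
rewrite !sub_series_geq//; apply: le_trans (ler_norm_sum _ _ _) _.
exact: ler_sum.
Unshelve. all: end_near. Qed.

Lemma series_le_limn a n : (forall k, 0 <= a k) -> cvgn (series a) ->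
  series a n <= limn (series a).
Proof.
move=> a0 ca; apply: nondecreasing_cvgn_le => //.
by apply: nondecreasing_series => k _ _.
Qed.

(** Tannery's theorem. The filter is arbitrary because the lemma serves twice: along [\oo] for
    Polya's sums and along [0^'] for difference quotients. *)
Lemma cvg_series_dominated (T : Type) (F : set_system T) {FF : ProperFilter F}
    (u : T -> nat -> R) (v b : nat -> R) :
  (\forall t \near F, forall k, `|u t k| <= b k) -> cvgn (series b) ->
  (forall k, u t k @[t --> F] --> v k) ->
  cvgn (series v) /\ limn (series (u t)) @[t --> F] --> limn (series v).
Proof.
move=> ub cb uv.
have vb k : `|v k| <= b k.
  have h : `|u t k| @[t --> F] --> `|v k| by apply: cvg_norm; exact: uv.
  rewrite -(cvg_lim _ h)//; apply: limr_le; first exact: cvgP h.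
  by apply: filterS ub => t /(_ k).
have cv := is_cvg_series_le vb cb.
split=> //; apply/cvgrPdist_le => e e0.
have e3 : 0 < e / 3 by lra.
have /cvgrPdist_le/(_ _ e3)[K _ bK] := cb.
have {}bK : limn (series b) - series b K <= e / 3.
  by apply: le_trans (ler_norm _) (bK K _); rewrite /=.
have suv : series (u t) K @[t --> F] --> series v K.
  rewrite /series/=; apply: cvg_big => [|k _]; last exact: uv.
    exact: add_continuous.
move/cvgrPdist_le : suv => /(_ _ e3) suv.
near=> t.
have utb : forall k, `|u t k| <= b k by near: t.
have h1 := series_tail_le K vb cb.
have h2 := series_tail_le K utb cb.
have h3 : `|series v K - series (u t) K| <= e / 3 by near: t.
rewrite (_ : limn (series v) - limn (series (u t)) =
  (limn (series v) - series v K) + (series v K - series (u t) K)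
  - (limn (series (u t)) - series (u t) K)); last by ring.
apply: le_trans (ler_normB _ _) _.
have := ler_normD (limn (series v) - series v K) (series v K - series (u t) K).
by lra.
Unshelve. all: end_near. Qed.

(** The mean value theorem bounds each difference quotient by [b n] once |h| < d; Tannery's theorem
    then exchanges limit and sum. *)
Lemma is_derive_series (f g : nat -> R -> R) (b : nat -> R) (x d : R) :
  0 < d ->
  (forall n y, `|y - x| < d -> is_derive y 1 (f n) (g n y)) ->
  (forall n y, `|y - x| < d -> `|g n y| <= b n) -> cvgn (series b) ->
  (forall y, cvgn (series (f ^~ y))) ->
  is_derive x 1 (fun y => limn (series (f ^~ y))) (limn (series (g ^~ x))).
Proof.
move=> d0 fg gb cb cf.
pose q (h : R) n := h^-1 * (f n (h + x) - f n x).
have hq : \forall h \near (0:R)^', forall k, `|q h k| <= b k.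
  near=> h => k.
  have h0 : h != 0 by near: h; exact: nbhs_dnbhs_neq.
  have hd : `|h| < d.
    near: h; apply: nbhs_dnbhs; exists d => // z /=.
    by rewrite sub0r normrN.
  (* [Num.min] and [Num.max] cover both signs of the increment h at once. *)
  have [|||c] := @MVT_segment R (f k) (g k) (Num.min x (h + x)) (Num.max x (h + x)).
  - by rewrite ge_min le_max lexx.
  - move=> y; rewrite in_itv/= => /andP[y1 y2]; apply: fg.
    move: hd y1 y2; rewrite !ltr_norml; case: (leP x (h+x)) => ?; lra.
  - apply: derivable_within_continuous => y; rewrite in_itv/= => /andP[y1 y2].
    apply: (@ex_derive _ _ _ _ _ _ (g k y)); apply: fg.
    move: hd y1 y2; rewrite !ltr_norml; case: (leP x (h+x)) => ?; lra.
  move=> + E; rewrite in_itv/= => /andP[c1 c2].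
  have cd : `|c - x| < d.
    move: c1 c2 hd; rewrite !ltr_norml; case: (leP x (h+x)) => ?; lra.
  have -> : q h k = g k c.
    rewrite /q; have : f k (h + x) - f k x = g k c * h.
      by case: (leP x (h+x)) E => ? E; lra.
    by move=> ->; rewrite mulrC mulfK.
  exact: gb.
have gx : `|x - x| < d by rewrite subrr normr0.
have qg k : q h k @[h --> (0:R)^'] --> g k x.
  have [dfx dE] := fg k x gx.
  move: dfx => /cvg_ex[l hl]; move: (hl) => /cvg_lim E.
  rewrite -dE /derive E//.
  by move: hl; under eq_fun do rewrite [(_ *: 1 : R)]mulr1.
have [cg lg] := cvg_series_dominated hq cb qg.
have key : (fun h : R => h^-1 *: (limn (series (f ^~ (h *: 1 + x))) -
    limn (series (f ^~ x)))) @ (0:R)^' --> limn (series (g ^~ x)).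
  rewrite [X in X @ _ --> _](_ : _ = fun h => limn (series (q h)))//.
  apply/funext => h; rewrite [(_ *: 1 : R)]mulr1.
  rewrite -lim_seriesB// -[LHS]lim_seriesZ//; exact: is_cvg_seriesB.
apply: DeriveDef; last exact/cvg_lim.
by apply/cvg_ex; exists (limn (series (g ^~ x))).
Unshelve. all: end_near. Qed.
End series_tools.

(** * Jacobi's theta identity by Polya's method *)

Section polya_identity.
Variable R : realType.

Lemma cosD_cosB (a b : R) : 2 * cos a * cos b = cos (b + a) + cos (b - a).
Proof. by rewrite cosD cosB; ring. Qed.

(** The binomial expansion of (e^(ia) + e^(-ia))^p, kept real: Pascal's rule combined with 2 cos a
    cos b = cos(b + a) + cos(b - a). *)
Lemma pow_2cos (a : R) p :
  (2 * cos a) ^+ p = \sum_(i < p.+1) 'C(p, i)%:R * cos ((p%:R - 2 * i%:R) * a).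
Proof.
elim: p => [|p IH].
  by rewrite big_ord1 expr0 bin0 mulr0 subr0 mul0r cos0 mulr1.
rewrite exprS IH mulr_sumr.
under eq_bigr => i _ do rewrite mulrCA cosD_cosB mulrDr.
rewrite big_split/= [RHS]big_ord_recl/= bin0.
under [X in _ = _ + X]eq_bigr => i _ do rewrite /bump/= add1n binS natrD mulrDl.
rewrite big_split/= addrA; congr (_ + _).
  rewrite [LHS]big_ord_recl/= bin0; congr (_ + _).
    by congr (_ * cos _); rewrite -natr1; ring.
  rewrite [RHS]big_ord_recr/= bin_small// mul0r addr0.
  apply: eq_bigr => i _; congr (_ * cos _).
  by rewrite /bump/= add1n -!natr1; ring.
apply: eq_bigr => i _; congr (_ * cos _).
by rewrite -!natr1; ring.
Qed.

(** The terms i and 2m - i of [pow_2cos] coincide, so the sum folds onto r = |m - i|; doubling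
    counts the central term twice, hence the subtraction. *)
Lemma pow_2cos_even (a : R) m :
  (2 * cos a) ^+ (2 * m) =
  2 * (\sum_(r < m.+1) 'C(2 * m, m + r)%:R * cos (2 * r%:R * a)) - 'C(2 * m, m)%:R.
Proof.
rewrite pow_2cos -(big_mkord xpredT (fun i =>
  'C(2 * m, i)%:R * cos (((2 * m)%:R - 2 * i%:R) * a))).
rewrite (big_cat_nat (n := m.+1))//=; last by rewrite ltnS leq_pmull.
rewrite [X in X + _]big_nat_rev/= add0n big_mkord.
under [X in X + _]eq_bigr => i _.
  rewrite subSS.
  have im : (i <= m)%N by rewrite -ltnS ltn_ord.
  rewrite (_ : 'C(2 * m, m - i) = 'C(2 * m, m + i)); last first.
    rewrite -bin_sub; last by rewrite mul2n -addnn (leq_trans (leq_subr _ _))// leq_addr.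
    by congr 'C(_, _); rewrite mul2n -addnn subnBA// -addnBAC ?leq_addr// addnK addnC.
  rewrite (_ : _ - _ = 2 * i%:R); last first.
    by rewrite natrB// natrM; ring.
  over.
rewrite [X in _ + X](_ : _ = \sum_(0 <= i < m) 'C(2 * m, i + m.+1)%:R *
    cos (((2 * m)%:R - 2 * (i + m.+1)%:R) * a)); last first.
  rewrite -{1}(add0n m.+1) big_addn (_ : ((2 * m).+1 - m.+1)%N = m)//.
  by rewrite mul2n -addnn -addnS addnK.
rewrite big_mkord mulrDl !mul1r -addrA; congr (_ + _).
rewrite big_ord_recl/= addn0 mulr0 mul0r cos0 mulr1 addrAC subrr add0r.
apply: eq_bigr => i _; rewrite /bump/= add1n addnS addnS addnC; congr (_ * _).
by rewrite -cosN; congr cos; rewrite -!natr1 natrD natrM; ring.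
Qed.

Lemma mulrn_2pi n : pi *+ 2 *+ n = 2 * pi * n%:R :> R.
Proof. by rewrite -[LHS]mulr_natr -[pi *+ 2]mulr_natr (mulrC pi). Qed.

Lemma cosD2pin (a : R) n : cos (a + pi *+ 2 *+ n) = cos a.
Proof. exact: (periodicn (@cosD2pi R)). Qed.

Lemma sinD2pin (a : R) n : sin (a + pi *+ 2 *+ n) = sin a.
Proof. exact: (periodicn (@sinD2pi R)). Qed.

(** Orthogonality of the N-th roots of unity in real form: multiplied by 2 sin(pi r / N), the sum
    telescopes. *)
Lemma sum_cos_period (N r : nat) : (0 < N)%N ->
  \sum_(k < N) cos (2 * r%:R * (pi * k%:R / N%:R)) =
  if (N %| r)%N then N%:R else 0 :> R.
Proof.
move=> N0; have NR : N%:R != 0 :> R by rewrite pnatr_eq0 -lt0n.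
case: ifPn => [/dvdnP[q ->]|Nr].
  under eq_bigr => i _.
    rewrite (_ : _ * _ = 0 + pi *+ 2 *+ (q * i)); last first.
      by rewrite add0r mulrn_2pi !natrM; field.
    rewrite cosD2pin cos0; over.
  by rewrite sumr_const card_ord.
pose a : R := pi * r%:R / N%:R.
(* Up to sign only the residue of r modulo N matters, and it lies strictly between 0 and N. *)
have sa : sin a != 0.
  have Er : a = pi * (r %% N)%:R / N%:R + pi *+ (r %/ N).
    rewrite /a {1}(divn_eq r N) natrD natrM -mulr_natr; by field.
  rewrite Er (alternatingn (@sinDpi R)) mulf_neq0//; first by rewrite signr_eq0.
  rewrite gt_eqF// sin_gt0_pi//.
  have N0' : 0 < N%:R :> R by rewrite ltr0n.
  rewrite divr_gt0 ?mulr_gt0 ?pi_gt0 ?ltr0n//=; last by rewrite lt0n.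
  by rewrite ltr_pdivrMr// ltr_pM2l ?pi_gt0// ltr_nat ltn_pmod.
have sa2 : 2 * sin a != 0 by rewrite mulf_neq0// pnatr_eq0.
apply: (mulfI sa2).
rewrite mulr0 mulr_sumr.
(* Consecutive differences are 2 sin a times the summands, and s N = s 0 because 2 N a = 2 pi r. *)
pose s k : R := sin ((2 * k%:R - 1) * a).
rewrite (eq_bigr (fun k : 'I_N => s k.+1 - s k)); last first.
  move=> i _; rewrite /s (_ : 2 * r%:R * _ = 2 * i%:R * a); last first.
    by rewrite /a; field.
  rewrite (_ : (2 * i.+1%:R - 1) * a = 2 * i%:R * a + a); last by rewrite -natr1; ring.
  rewrite (_ : (2 * i%:R - 1) * a = 2 * i%:R * a - a); last by ring.
  by rewrite sinD sinB; ring.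
rewrite -(big_mkord xpredT (fun k => s k.+1 - s k)) telescope_sumr//.
rewrite /s mulr0 sub0r mulN1r.
rewrite (_ : _ * a = - a + pi *+ 2 *+ r); last first.
  by rewrite /a mulrn_2pi; field.
by rewrite sinD2pin subrr.
Qed.

Lemma sum_dvdn (N m : nat) (F : nat -> R) : (0 < N)%N ->
  \sum_(0 <= r < m * N) (if (N %| r)%N then F r else 0) = \sum_(0 <= j < m) F (j * N)%N.
Proof.
move=> N0; rewrite big_nat_mul; apply: eq_bigr => j _.
rewrite big_ltn ?ltn_pmul2r// dvdn_mull//.
rewrite big_nat big1/= ?addr0// => i /andP[ji ij].
rewrite -(subnKC (ltnW ji)) dvdn_addr ?dvdn_mull// gtnNdvd// ?subn_gt0//.
by rewrite ltn_subLR ?(ltnW ji)// addnC -mulSn.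
Qed.

(** As N is odd, k -> N - k pairs the nonzero residues; it changes the sign of the cosine, which the
    even exponent absorbs. Only k = 0 is unpaired, whence the -1. On the other side the average
    retains the multiples of N. *)
Lemma polya_identity (m M : nat) : let N := M.*2.+1 in
  2 * (\sum_(0 <= k < M.+1) cos (pi * k%:R / N%:R) ^+ (2 * m)) - 1 =
  N%:R * (2 * (\sum_(0 <= j < m.+1) 'C(2 * m, m + j * N)%:R) - 'C(2 * m, m)%:R) / 2 ^+ (2 * m) :> R.
Proof.
move=> N.
have N0 : (0 < N)%N by [].
have NR : N%:R != 0 :> R by rewrite pnatr_eq0.
have p0 : 2 ^+ (2 * m) != 0 :> R by rewrite expf_neq0// pnatr_eq0.
have E1 : \sum_(k < N) cos (pi * k%:R / N%:R) ^+ (2 * m) =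
    2 * (\sum_(0 <= k < M.+1) cos (pi * k%:R / N%:R) ^+ (2 * m)) - 1 :> R.
  rewrite -(big_mkord xpredT (fun k => cos (pi * k%:R / N%:R) ^+ (2 * m))).
  rewrite (big_cat_nat (n := M.+1))//=; last by rewrite /N ltnS -addnn leq_addr.
  rewrite [X in _ + X](_ : _ =
      \sum_(0 <= k < M.+1) cos (pi * k%:R / N%:R) ^+ (2 * m) - 1); first by ring.
  rewrite [X in _ = X - 1]big_ltn// mulr0 mul0r cos0 expr1n addrAC subrr add0r.
  rewrite big_nat_rev/= -{1}(add0n M.+1) big_addn.
  rewrite [in RHS]big_add1/= (_ : (N - M.+1)%N = M); last first.
    by rewrite /N -addnn -addnS addnK.
  apply: eq_big_nat => i /= iM; rewrite !exprM; congr (_ ^+ m).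
  rewrite (_ : (M.+1 + N - (i + M.+1).+1)%N = (N - i.+1)%N); last first.
    by rewrite -[(i + M.+1).+1]addSn (addnC M.+1) subnDr.
  rewrite natrB; last by rewrite /N ltnS -addnn (leq_trans (ltnW iM))// leq_addr.
  rewrite -cosN (_ : - _ = pi * i.+1%:R / N%:R - pi); last by field.
  by rewrite cosB cospi sinpi; ring.
rewrite -E1.
have E2 : \sum_(k < N) (2 * cos (pi * k%:R / N%:R)) ^+ (2 * m) =
    N%:R * (2 * (\sum_(0 <= j < m.+1) 'C(2 * m, m + j * N)%:R) - 'C(2 * m, m)%:R) :> R.
  under eq_bigr => k _ do rewrite pow_2cos_even.
  rewrite sumrB sumr_const card_ord -mulr_sumr exchange_big/=.
  under eq_bigr => r _ do rewrite -mulr_sumr sum_cos_period// (fun_if (fun x => _ * x)) mulr0.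
  rewrite -(big_mkord xpredT (fun r => if (N %| r)%N then 'C(2 * m, m + r)%:R * N%:R else 0)).
  rewrite [X in 2 * X - _ *+ _](_ : _ = N%:R * \sum_(0 <= j < m.+1) 'C(2 * m, m + j * N)%:R).
    by rewrite -[_ *+ N]mulr_natl; ring.
  (* Extending the range of r to (m + 1) N adds only vanishing binomials and makes it a whole number
     of periods. *)
  rewrite mulr_sumr -(sum_dvdn m.+1 (fun r => N%:R * 'C(2 * m, m + r)%:R))//.
  rewrite [RHS](big_cat_nat (n := m.+1))//= ?leq_pmulr// [X in _ + X]big_nat_cond.
  rewrite [X in _ + X]big1 ?addr0; last first.
    move=> r; rewrite andbT => /andP[mr _]; rewrite bin_small ?mulr0 ?if_same//.
    by rewrite mul2n -addnn ltn_add2l.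
  by apply: eq_bigr => r _; rewrite mulrC.
rewrite -E2; under [in RHS]eq_bigr do rewrite exprMn.
by rewrite -mulr_sumr mulrC mulKf.
Qed.

End polya_identity.

(** * Gaussian bounds for powers of the cosine and for binomial coefficients *)

Section polya_limit.
Variable R : realType.

Lemma sin_le (z : R) : 0 <= z -> sin z <= z.
Proof.
rewrite le_eqVlt => /predU1P[<-|z0]; first by rewrite sin0.
have [|c c0z] := @MVT _ (@sin R) (@cos R) 0 z z0.
  by apply: continuous_subspaceT; exact: continuous_sin.
by rewrite sin0 !subr0 => ->; rewrite ler_piMl ?cos_le1// ltW.
Qed.

Lemma mulr_cos_le_sin (z : R) : 0 <= z <= pi -> z * cos z <= sin z.
Proof.
rewrite le_eqVlt => /andP[/predU1P[<-|z0] zpi]; first by rewrite sin0 mul0r.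
have [|c c0z] := @MVT _ (@sin R) (@cos R) 0 z z0.
  by apply: continuous_subspaceT; exact: continuous_sin.
rewrite sin0 !subr0 => ->; rewrite mulrC ler_pM2r//.
move: c0z; rewrite in_itv/= => /andP[c0 cz].
by apply/ltW; rewrite ltr_cos ?in_itv/= ?(ltW z0) ?(ltW c0) ?zpi// (le_trans (ltW cz)).
Qed.

(** A weak Jordan inequality: sin z = 2 sin(z/2) cos(z/2) >= z cos(z/2)^2, and cos(z/2)^2 >= 1/2
    because cos z >= 0. *)
Lemma half_le_sin (z : R) : 0 <= z <= pi / 2 -> z / 2 <= sin z.
Proof.
move=> /andP[z0 zpi]; have p0 := pi_gt0 R.
have c0 : 0 <= cos z by apply: cos_ge0_pihalf; rewrite zpi andbT (le_trans _ z0)// lerNl oppr0; lra.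
have h : z / 2 * cos (z / 2) <= sin (z / 2).
  by apply: mulr_cos_le_sin; apply/andP; split; lra.
have ch : 0 <= cos (z / 2).
  by apply: cos_ge0_pihalf; apply/andP; split; lra.
have Ez : z = (z / 2) *+ 2 by lra.
have -> : sin z = 2 * (cos (z / 2) * sin (z / 2)) by rewrite {1}Ez sin_mulr2n; lra.
have E2 : cos z = 2 * cos (z / 2) ^+ 2 - 1 by rewrite {1}Ez cos_mulr2n; lra.
have : cos (z / 2) * (z / 2 * cos (z / 2)) <= cos (z / 2) * sin (z / 2) by rewrite ler_wpM2l.
have : 0 <= z * cos z by rewrite mulr_ge0.
rewrite E2; nra.
Qed.

(** The companion of 1 - v <= e^(-v), obtained by inverting 1 + v/(1 - v) <= e^(v/(1 - v)). At v =
    (sin z)^2 the two enclose (cos z)^2. *)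
Lemma expRN_le_1B (v : R) : v < 1 -> expR (- (v / (1 - v))) <= 1 - v.
Proof.
move=> v1; have h : 0 < 1 - v by lra.
rewrite expRN -[leRHS]invrK lef_pV2 ?posrE ?expR_gt0 ?invr_gt0//.
apply: le_trans (expR_ge1Dx _).
rewrite le_eqVlt; apply/orP; left; apply/eqP.
by field; rewrite subr_eq0 gt_eqF//; lra.
Qed.

Lemma pow_cos_le (z : R) m : cos z ^+ (2 * m) <= expR (- (m%:R * sin z ^+ 2)).
Proof.
rewrite exprM cos2sin2 [X in expR X](_ : _ = (- sin z ^+ 2) * m%:R); last by ring.
rewrite expRM_natr -cos2sin2.
apply: lerXn2r; rewrite ?nnegrE ?expR_ge0 ?sqr_ge0// cos2sin2.
exact: expR_ge1Dx.
Qed.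

Lemma pow_cos_ge (z : R) m : cos z != 0 ->
  expR (- (m%:R * (sin z ^+ 2 / cos z ^+ 2))) <= cos z ^+ (2 * m).
Proof.
move=> c0; rewrite exprM [X in expR X](_ : _ = (- (sin z ^+ 2 / cos z ^+ 2)) * m%:R); last by ring.
rewrite expRM_natr.
apply: lerXn2r; rewrite ?nnegrE ?expR_ge0// ?sqr_ge0//.
have := @expRN_le_1B (sin z ^+ 2).
rewrite -cos2sin2; apply.
have : 0 < cos z ^+ 2 by rewrite exprn_even_gt0.
rewrite cos2sin2; lra.
Qed.

(** Division by the central coefficient leaves a pure Gaussian, about e^(-r^2/m), with no
    asymptotics of factorials. *)
Definition binom_ratio m r : R := 'C(2 * m, m + r)%:R / 'C(2 * m, m)%:R.

Lemma central_binom_gt0 m : 0 < 'C(2 * m, m)%:R :> R.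
Proof. by rewrite ltr0n bin_gt0 leq_pmull. Qed.

Lemma binom_ratio0 m r : (m < r)%N -> binom_ratio m r = 0.
Proof. by move=> mr; rewrite /binom_ratio bin_small ?mul0r// mul2n -addnn ltn_add2l. Qed.

Lemma binom_ratioS m r : (r <= m)%N ->
  binom_ratio m r.+1 = binom_ratio m r * ((m%:R - r%:R) / (m + r.+1)%:R).
Proof.
move=> rm; have := mul_bin_left (2 * m) (m + r); rewrite -addnS => /(congr1 (fun n => n%:R : R)).
rewrite !natrM (_ : (2 * m - (m + r))%N = (m - r)%N); last by rewrite mul2n -addnn subnDl.
rewrite natrB// => h.
have h0 : (m + r.+1)%:R != 0 :> R by rewrite addnS pnatr_eq0.
have h1 := lt0r_neq0 (central_binom_gt0 m).
rewrite /binom_ratio (_ : 'C(2 * m, m + r.+1)%:R = (m%:R - r%:R) * 'C(2 * m, m + r)%:R / (m + r.+1)%:R); last first.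
  by apply: (mulfI h0); rewrite h [RHS]mulrC divfK.
move: h0 h1; move: (m + r.+1)%:R 'C(2 * m, m)%:R => D E hD hE; field.
by rewrite hD.
Qed.

(** For i < r the successive quotients are 1 - (2i + 1)/(m + i + 1) <= e^(-(2i + 1)/(m + r)), and
    the numbers 2i + 1 add up to r^2. The induction is on i, with r frozen in the denominator. *)
Lemma binom_ratio_le m r : (r <= m)%N ->
  binom_ratio m r <= expR (- (r%:R ^+ 2 / (m%:R + r%:R))).
Proof.
move=> rm.
have [m0|m0] := posnP m.
  move: rm; rewrite m0 leqn0 => /eqP ->; rewrite expr0n/= mul0r oppr0 expR0 /binom_ratio.
  by rewrite addn0 divff// lt0r_neq0// central_binom_gt0.
have m0R : 0 < m%:R :> R by rewrite ltr0n.
suff: forall i, (i <= r)%N -> binom_ratio m i <= expR (- (i%:R ^+ 2 / (m%:R + r%:R))).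
  exact.
elim=> [_|i IH ir].
  by rewrite expr0n/= mul0r oppr0 expR0 /binom_ratio addn0 divff// lt0r_neq0// central_binom_gt0.
have im : (i <= m)%N by rewrite (leq_trans (ltnW ir)).
rewrite binom_ratioS//.
have -> : - (i.+1%:R ^+ 2 / (m%:R + r%:R)) =
    - (i%:R ^+ 2 / (m%:R + r%:R)) - (2 * i%:R + 1) / (m%:R + r%:R) :> R.
  by rewrite -natr1; ring.
rewrite expRD ler_pM//.
- by rewrite divr_ge0.
- by rewrite divr_ge0// subr_ge0 ler_nat.
- by apply: IH; exact: ltnW.
- apply: le_trans (expR_ge1Dx _).
  rewrite natrD -natr1 -lerBlDl.
  have h : i%:R + 1 <= r%:R :> R by rewrite natr1 ler_nat.
  have i0 : 0 <= i%:R :> R by [].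
  have -> : (m%:R - i%:R) / (m%:R + (i%:R + 1)) - 1 = - ((2 * i%:R + 1) / (m%:R + (i%:R + 1))) :> R.
    by field; rewrite gt_eqF//; lra.
  rewrite lerN2 ler_pM2l; last lra.
  by rewrite lef_pV2 ?posrE; lra.
Qed.

Lemma binom_ratio_ge m r : (r < m)%N ->
  expR (- (r%:R ^+ 2 / (m%:R - r%:R))) <= binom_ratio m r.
Proof.
move=> rm.
have rmR : r%:R + 1 <= m%:R :> R by rewrite natr1 ler_nat.
suff: forall i, (i <= r)%N -> expR (- (i%:R ^+ 2 / (m%:R - r%:R))) <= binom_ratio m i.
  exact.
elim=> [_|i IH ir].
  by rewrite expr0n/= mul0r oppr0 expR0 /binom_ratio addn0 divff// lt0r_neq0// central_binom_gt0.
have im : (i <= m)%N by rewrite (leq_trans (ltnW ir))// ltnW.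
rewrite binom_ratioS//.
have -> : - (i.+1%:R ^+ 2 / (m%:R - r%:R)) =
    - (i%:R ^+ 2 / (m%:R - r%:R)) - (2 * i%:R + 1) / (m%:R - r%:R) :> R.
  by rewrite -natr1; ring.
rewrite expRD ler_pM ?expR_ge0//; first by apply: IH; exact: ltnW.
rewrite expRN -[leRHS]invrK lef_pV2 ?posrE ?expR_gt0 ?invr_gt0//.
- rewrite invf_div; apply: le_trans (expR_ge1Dx _).
  have h : i%:R + 1 <= r%:R :> R by rewrite natr1 ler_nat.
  have i0 : 0 <= i%:R :> R by [].
  rewrite natrD -natr1 -lerBlDl.
  have -> : (m%:R + (i%:R + 1)) / (m%:R - i%:R) - 1 = ((2 * i%:R + 1) / (m%:R - i%:R)) :> R.
    by field; rewrite gt_eqF//; lra.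
  rewrite ler_pM2l; last lra.
  by rewrite lef_pV2 ?posrE; lra.
- have h : i%:R + 1 <= r%:R :> R by rewrite natr1 ler_nat.
  by rewrite divr_gt0 ?ltr0n ?addnS//; lra.
Qed.

End polya_limit.

(** * Passage to the limit and the functional equation of theta *)

Section theta_equation.
Variable R : realType.

Lemma cvg_expRN (F : nat -> R) (l : R) :
  F n @[n --> \oo] --> l -> expR (- F n) @[n --> \oo] --> expR (- l).
Proof.
move=> Fl; apply: continuous_cvg; first exact: continuous_expR.
exact: cvgN.
Qed.

Section fixed_scale.
Variable s : R.
Hypothesis s0 : 0 < s.

(** Polya's scaling: N is an odd number within 1 of s(n + 1) and m = (n + 1)^2. Then [rho] tends to
    s and both kinds of exponent stabilize: m (pi k / N)^2 tends to (pi k / s)^2, and (k N)^2 / m to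
    (k s)^2. *)
Let M n := Num.truncn (s * n.+1%:R / 2).
Let N n := (M n).*2.+1.
Let m n := (n.+1 ^ 2)%N.
Let rho n : R := (N n)%:R / n.+1%:R.

Let p_gt0 n : 0 < n.+1%:R :> R. Proof. by rewrite ltr0n. Qed.

Let NE n : (N n)%:R = 2 * (M n)%:R + 1 :> R.
Proof. by rewrite /N -natr1 -mul2n natrM. Qed.

Let N_itv n : s * n.+1%:R - 1 < (N n)%:R <= s * n.+1%:R + 1.
Proof.
have h : 0 <= s * n.+1%:R / 2 by rewrite divr_ge0// mulr_ge0 ?(ltW s0).
by have := truncn_itv h; rewrite -/(M n) NE -natr1; lra.
Qed.

Let N_gt0 n : 0 < (N n)%:R :> R. Proof. by rewrite ltr0n. Qed.

Let NrhoE n : (N n)%:R = rho n * n.+1%:R.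
Proof. by rewrite /rho divfK// gt_eqF. Qed.

Let rho_gt0 n : 0 < rho n. Proof. by rewrite divr_gt0. Qed.

Let cvg_delta : (n.+1%:R^-1 : R) @[n --> \oo] --> (0 : R).
Proof. exact: (@cvg_harmonic R). Qed.

Let cvg_rho : rho n @[n --> \oo] --> s.
Proof.
have hl : (s - n.+1%:R^-1 : R) @[n --> \oo] --> s.
  by rewrite -[X in _ --> X]subr0; apply: cvgB => //; exact: cvg_cst.
have hr : (s + n.+1%:R^-1 : R) @[n --> \oo] --> s.
  by rewrite -[X in _ --> X]addr0; apply: cvgD => //; exact: cvg_cst.
apply: (squeeze_cvgr _ hl hr); apply: nearW => n.
have := N_itv n; rewrite NrhoE => /andP[h1 h2].
have E : n.+1%:R^-1 * n.+1%:R = 1 :> R by rewrite mulVf// gt_eqF.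
apply/andP; split; rewrite -(ler_pM2r (p_gt0 n)) ?mulrBl ?mulrDl E; lra.
Qed.

Let near_large (A : R) : \forall n \near \oo, A <= s * n.+1%:R.
Proof.
near=> n; rewrite mulrC -ler_pdivrMr// (@le_trans _ _ n%:R) ?ler_nat//.
by near: n; exact: nbhs_infty_ger.
Unshelve. all: end_near. Qed.

Let rho_le : \forall n \near \oo, rho n <= 2 * s.
Proof.
near=> n; rewrite -(ler_pM2r (p_gt0 n)) -NrhoE.
have h : 1 <= s * n.+1%:R by near: n; exact: near_large.
by have := N_itv n; lra.
Unshelve. all: end_near. Qed.

Let rho_ge : \forall n \near \oo, s / 2 <= rho n.
Proof.
near=> n; rewrite -(ler_pM2r (p_gt0 n)) -NrhoE.
have h : 2 <= s * n.+1%:R by near: n; exact: near_large.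
by have := N_itv n; lra.
Unshelve. all: end_near. Qed.

Let z n (k : nat) : R := pi * k%:R / (N n)%:R.

Let zE n k : z n k = pi * k%:R / rho n * n.+1%:R^-1.
Proof. by rewrite /z NrhoE invfM mulrA. Qed.

Let mz2 n k : (m n)%:R * z n k ^+ 2 = (pi * k%:R / rho n) ^+ 2.
Proof. by rewrite zE exprMn natrX exprVn mulrCA mulfV ?mulr1// expf_neq0// gt_eqF. Qed.

Let z_itv n k : (k <= M n)%N -> 0 <= z n k <= pi / 2.
Proof.
move=> kM; rewrite /z; apply/andP; split; first by rewrite divr_ge0// mulr_ge0// pi_ge0.
rewrite -mulrA ler_pM2l ?pi_gt0// ler_pdivrMr// NE.
have : k%:R <= (M n)%:R :> R by rewrite ler_nat.
by lra.
Qed.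

(** The cut-off at M turns the finite cosine sum of [polya_identity] into a series, as
    [cvg_series_dominated] requires. *)
Let u n k : R := if (k <= M n)%N then cos (z n k) ^+ (2 * m n) else 0.

Let near_kM k : \forall n \near \oo, (k <= M n)%N.
Proof.
near=> n.
have h : 2 * k%:R + 1 <= s * n.+1%:R by near: n; exact: near_large.
have := N_itv n; rewrite NE => /andP[h1 _].
by rewrite -ltnS -(ltr_nat R) -natr1; lra.
Unshelve. all: end_near. Qed.

(** A squeeze: z cos z <= sin z <= z is inserted into [pow_cos_le] and [pow_cos_ge], with m z^2 =
    (pi k / rho)^2 and cos z tending to 1. *)
Let cvg_u k : u n k @[n --> \oo] --> expR (- (pi * k%:R / s) ^+ 2).
Proof.
have cw : pi * k%:R / rho n @[n --> \oo] --> pi * k%:R / s.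
  by apply: cvgM; [exact: cvg_cst|apply: cvgV; rewrite ?gt_eqF].
have cz : z n k @[n --> \oo] --> (0:R).
  under eq_fun do rewrite zE.
  by rewrite -(mulr0 (pi * k%:R / s)); exact: cvgM.
have cc : cos (z n k) @[n --> \oo] --> (1:R).
  by rewrite -cos0; apply: continuous_cvg => //; exact: continuous_cos.
have cl : expR (- ((pi * k%:R / rho n) ^+ 2 / cos (z n k) ^+ 2)) @[n --> \oo] -->
    expR (- (pi * k%:R / s) ^+ 2).
  apply: cvg_expRN; rewrite -[X in _ --> X]divr1; apply: cvgM; first by apply: cvgM.
  by apply: cvgV => //; rewrite -[X in _ --> X](mulr1 1); exact: cvgM.
have cr : expR (- ((pi * k%:R / rho n) ^+ 2 * cos (z n k) ^+ 2)) @[n --> \oo] -->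
    expR (- (pi * k%:R / s) ^+ 2).
  apply: cvg_expRN; rewrite -[X in _ --> X]mulr1; apply: cvgM; first by apply: cvgM.
  by rewrite -[X in _ --> X](mulr1 1); exact: cvgM.
apply: (squeeze_cvgr _ cl cr); near=> n.
have kM : (k <= M n)%N by near: n; exact: near_kM.
have c0 : 0 < cos (z n k).
  by near: n; move/cvgrPdist_lt : cc => /(_ _ ltr01); apply: filterS => n;
    rewrite ltr_norml; lra.
have /andP[z0 zpi] := z_itv kM; have p0 := pi_gt0 R.
rewrite /u kM -mz2; apply/andP; split.
  apply: le_trans (pow_cos_ge _ _); last by rewrite gt_eqF.
  rewrite ler_expR lerN2 -mulrA ler_pM2l ?ltr0n// ler_pM2r ?invr_gt0 ?exprn_gt0//.
  by rewrite lerXn2r ?nnegrE ?sin_le// sin_ge0_pi//; lra.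
apply: le_trans (pow_cos_le _ _) _.
rewrite ler_expR lerN2 -mulrA ler_pM2l ?ltr0n// -exprMn.
rewrite lerXn2r ?nnegrE ?mulr_cos_le_sin ?sin_ge0_pi ?mulr_ge0 ?(ltW c0)//; lra.
Unshelve. all: end_near. Qed.

(** From sin z >= z/2 and rho <= 2 s the exponent is at least (pi k / (4 s))^2; k^2 >= k makes the
    bound geometric. *)
Let u_le : \forall n \near \oo, forall k,
  `|u n k| <= expR (- (pi / (4 * s)) ^+ 2) ^+ k.
Proof.
near=> n => k; rewrite /u; case: ifPn => [kM|_]; last by rewrite normr0 exprn_ge0 ?expR_ge0.
have rs : rho n <= 2 * s by near: n; exact: rho_le.
rewrite ger0_norm; last by rewrite exprM exprn_ge0 ?sqr_ge0.
apply: le_trans (pow_cos_le _ _) _.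
rewrite -expRM_natr ler_expR mulNr lerN2.
have /andP[z0 zpi] := z_itv kM.
have h : z n k ^+ 2 / 4 <= sin (z n k) ^+ 2.
  rewrite (_ : z n k ^+ 2 / 4 = (z n k / 2) ^+ 2); last by field.
  have hs : z n k / 2 <= sin (z n k) by apply: half_le_sin; exact: z_itv.
  have hz : 0 <= z n k / 2 by rewrite divr_ge0.
  by rewrite lerXn2r ?nnegrE// (le_trans hz hs).
apply: le_trans (ler_wpM2l _ h) => //.
rewrite mulrA mz2.
rewrite (_ : (pi * k%:R / rho n) ^+ 2 / 4 = (pi / (2 * rho n)) ^+ 2 * k%:R ^+ 2); last first.
  by field; rewrite gt_eqF.
apply: ler_pM => //; first exact: sqr_ge0.
  rewrite lerXn2r ?nnegrE ?divr_ge0 ?pi_ge0 ?mulr_ge0 ?(ltW s0) ?(ltW (rho_gt0 n))//.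
  rewrite ler_pM2l ?pi_gt0// lef_pV2 ?posrE ?mulr_gt0//; lra.
by rewrite -natrX ler_nat -mulnn; case: (posnP k) => [->//|k0]; exact: leq_pmulr.
Unshelve. all: end_near. Qed.

Let w n k : R := binom_ratio R (m n) (k * N n).

Let mE n : (m n)%:R = n.+1%:R ^+ 2 :> R. Proof. by rewrite /m natrX. Qed.

Let near_jN k : \forall n \near \oo, (k * N n < m n)%N.
Proof.
near=> n.
have rs : rho n <= 2 * s by near: n; exact: rho_le.
have h : s * (k%:R * (2 * s) + 1) <= s * n.+1%:R by near: n; exact: near_large.
rewrite -(ltr_nat R) natrM mE NrhoE mulrA expr2 ltr_pM2r//.
move: h; rewrite ler_pM2l// => h; apply: lt_le_trans h.
have : k%:R * rho n <= k%:R * (2 * s) by rewrite ler_wpM2l.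
by lra.
Unshelve. all: end_near. Qed.

(** At r = k N the exponents r^2 / (m - r) and r^2 / (m + r) become (k rho)^2 divided by 1 - k rho /
    (n + 1) and 1 + k rho / (n + 1). *)
Let cvg_w k : w n k @[n --> \oo] --> expR (- (k%:R * s) ^+ 2).
Proof.
have cv : k%:R * rho n @[n --> \oo] --> k%:R * s by apply: cvgM; [exact: cvg_cst|].
have c0 : k%:R * rho n * n.+1%:R^-1 @[n --> \oo] --> (0:R).
  by rewrite -(mulr0 (k%:R * s)); exact: cvgM.
have cl : expR (- ((k%:R * rho n) ^+ 2 / (1 - k%:R * rho n * n.+1%:R^-1))) @[n --> \oo] -->
    expR (- (k%:R * s) ^+ 2).
  apply: cvg_expRN; rewrite -[X in _ --> X]divr1; apply: cvgM; first by apply: cvgM.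
  apply: cvgV => //; rewrite -[X in _ --> X]subr0; apply: cvgB => //; exact: cvg_cst.
have cr : expR (- ((k%:R * rho n) ^+ 2 / (1 + k%:R * rho n * n.+1%:R^-1))) @[n --> \oo] -->
    expR (- (k%:R * s) ^+ 2).
  apply: cvg_expRN; rewrite -[X in _ --> X]divr1; apply: cvgM; first by apply: cvgM.
  apply: cvgV => //; rewrite -[X in _ --> X]addr0; apply: cvgD => //; exact: cvg_cst.
apply: (squeeze_cvgr _ cl cr); near=> n.
have jm : (k * N n < m n)%N by near: n; exact: near_jN.
have jmR : (k * N n)%:R < n.+1%:R ^+ 2 :> R by rewrite -mE ltr_nat.
have q0 : 0 < n.+1%:R :> R by [].
have r0 : 0 <= k%:R * rho n by rewrite mulr_ge0// ltW.
move: jmR; rewrite natrM NrhoE mulrA expr2 ltr_pM2r// => jmR.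
apply/andP; split.
  apply: le_trans (binom_ratio_ge _ jm).
  rewrite natrM mE NrhoE (mulrA k%:R (rho n)) ler_expR lerN2 le_eqVlt; apply/orP; left; apply/eqP.
  move: jmR q0; move: (n.+1%:R : R) (k%:R * rho n) => q v jmR q0.
  have qv : 0 < q ^+ 2 - v * q by rewrite expr2 -mulrBl mulr_gt0// subr_gt0.
  by field; rewrite ?(gt_eqF q0) ?(gt_eqF qv) ?subr_eq0 ?(gt_eqF jmR).
apply: le_trans (binom_ratio_le _ (ltnW jm)) _.
rewrite natrM mE NrhoE (mulrA k%:R (rho n)) ler_expR lerN2 le_eqVlt; apply/orP; left; apply/eqP.
move: r0 q0; move: (n.+1%:R : R) (k%:R * rho n) => q v v0 q0.
have qv : 0 < q ^+ 2 + v * q by rewrite ltr_wpDr ?exprn_gt0// mulr_ge0// ltW.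
have qv' : 0 < q + v by lra.
by field; rewrite ?(gt_eqF q0) ?(gt_eqF qv) ?(gt_eqF qv').
Unshelve. all: end_near. Qed.

(** For r = k N <= m one has m + r <= 2 m, and rho >= s/2: the 8 is 2 times 2^2. Beyond m the ratio
    vanishes. *)
Let w_le : \forall n \near \oo, forall k, `|w n k| <= expR (- (s ^+ 2 / 8)) ^+ k.
Proof.
near=> n => k; rewrite ger0_norm; last by rewrite /w /binom_ratio divr_ge0.
have [km|mk] := leqP (k * N n) (m n); last first.
  by rewrite /w binom_ratio0// exprn_ge0 ?expR_ge0.
apply: le_trans (binom_ratio_le _ km) _.
have rs : s / 2 <= rho n by near: n; exact: rho_ge.
rewrite -expRM_natr ler_expR mulNr lerN2.
have q0 : 0 < n.+1%:R :> R by [].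
have kmR : (k * N n)%:R <= n.+1%:R ^+ 2 :> R by rewrite -mE ler_nat.
have h0 : 0 <= (k * N n)%:R :> R by [].
have q2 : 0 < n.+1%:R ^+ 2 :> R by rewrite exprn_gt0.
rewrite mE ler_pdivlMr; last by lra.
apply: (@le_trans _ _ (s ^+ 2 / 8 * k%:R * (2 * n.+1%:R ^+ 2))).
  by apply: ler_wpM2l; [rewrite mulr_ge0// divr_ge0// sqr_ge0|lra].
rewrite natrM NrhoE [(k%:R * _) ^+ 2]exprMn [(rho n * _) ^+ 2]exprMn.
rewrite (_ : s ^+ 2 / 8 * k%:R * (2 * n.+1%:R ^+ 2) =
  k%:R * ((s / 2) ^+ 2 * n.+1%:R ^+ 2)); last by field.
apply: ler_pM => //; first by rewrite mulr_ge0 ?sqr_ge0.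
  by rewrite -natrX ler_nat -mulnn; case: (posnP k) => [->//|k0]; exact: leq_pmulr.
apply: ler_wpM2r; first exact: ltW.
by rewrite lerXn2r ?nnegrE ?divr_ge0 ?(ltW s0) ?(ltW (rho_gt0 n)).
Unshelve. all: end_near. Qed.

Let expRN_lt1 (c : R) : 0 < c -> `|expR (- c)| < 1.
Proof. by move=> c0; rewrite ger0_norm ?expR_ge0// expR_lt1 oppr_lt0. Qed.

Let cvg_geo (c : R) : 0 < c -> cvgn (series (fun k => expR (- c) ^+ k)).
Proof.
move=> c0; have := @is_cvg_geometric_series R 1 _ (expRN_lt1 c0).
by rewrite /geometric/=; under eq_fun do rewrite mul1r.
Qed.

Let U : R := limn (series (fun k => expR (- (pi * k%:R / s) ^+ 2))).
Let W : R := limn (series (fun k => expR (- (k%:R * s) ^+ 2))).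

Let cvg_U : limn (series (u n)) @[n --> \oo] --> U.
Proof.
have c0 : 0 < (pi / (4 * s)) ^+ 2 by rewrite exprn_gt0// divr_gt0 ?pi_gt0// mulr_gt0.
exact: (cvg_series_dominated u_le (cvg_geo c0) cvg_u).2.
Qed.

Let cvg_W : cvgn (series (fun k => expR (- (k%:R * s) ^+ 2))) /\
  limn (series (w n)) @[n --> \oo] --> W.
Proof.
have c0 : 0 < s ^+ 2 / 8 by rewrite divr_gt0// exprn_gt0.
exact: (cvg_series_dominated w_le (cvg_geo c0) cvg_w).
Qed.

Let limn_series_finite (a : nat -> R) K : (forall k, (K <= k)%N -> a k = 0) ->
  limn (series a) = \sum_(0 <= k < K) a k.
Proof.
move=> a0; apply: cvg_lim => //; apply: cvg_near_cst; exists K => // n /= Kn.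
apply/esym; rewrite /series/= [RHS](big_cat_nat (n := K))//= [X in _ + X]big_nat_cond.
by rewrite [X in _ + X]big1 ?addr0// => k /andP[/andP[/a0]].
Qed.

Let W_ge1 : 1 <= W.
Proof.
have := series_le_limn 1 (fun k => expR_ge0 (- (k%:R * s) ^+ 2)) cvg_W.1.
by rewrite /series/= big_nat1 mul0r expr0n/= oppr0 expR0.
Qed.

(** This is [polya_identity] solved for the central coefficient. The sequence does not involve s, so
    neither does the limit: this is the source of the functional equation. *)
Lemma cvg_central_binom :
  n.+1%:R * 'C(2 * n.+1 ^ 2, n.+1 ^ 2)%:R / 2 ^+ (2 * n.+1 ^ 2) @[n --> \oo] -->
  (2 * U - 1) / (s * (2 * W - 1)).
Proof.
have h n : n.+1%:R * 'C(2 * n.+1 ^ 2, n.+1 ^ 2)%:R / 2 ^+ (2 * n.+1 ^ 2) =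
    (2 * limn (series (u n)) - 1) / (rho n * (2 * limn (series (w n)) - 1)).
  have Eu : limn (series (u n)) =
      \sum_(0 <= k < (M n).+1) cos (pi * k%:R / (N n)%:R) ^+ (2 * m n).
    rewrite (@limn_series_finite _ (M n).+1) => [|k Mk].
      by apply: eq_big_nat => k /= kM; rewrite /u -ltnS kM.
    by rewrite /u leqNgt Mk.
  have Ew : limn (series (w n)) = (\sum_(0 <= j < (m n).+1)
      'C(2 * m n, m n + j * N n)%:R) / 'C(2 * m n, m n)%:R.
    rewrite (@limn_series_finite _ (m n).+1) => [|k mk].
      by rewrite mulr_suml.
    by rewrite /w binom_ratio0// (leq_trans mk)// leq_pmulr.
  have c0 := central_binom_gt0 R (m n).
  have p0 : 2 ^+ (2 * m n) != 0 :> R by rewrite expf_neq0// pnatr_eq0.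
  have w0 : 0 < 2 * limn (series (w n)) - 1.
    rewrite Ew big_ltn// mul0n addn0 [X in 2 * X]mulrDl divff ?gt_eqF//.
    have : 0 <= (\sum_(1 <= i < (m n).+1) 'C(2 * m n, m n + i * N n)%:R) / 'C(2 * m n, m n)%:R :> R.
      by rewrite divr_ge0// sumr_ge0.
    by lra.
  apply: (mulIf (mulf_neq0 (lt0r_neq0 (rho_gt0 n)) (lt0r_neq0 w0))).
  rewrite divfK ?mulf_neq0 ?gt_eqF//.
  rewrite Eu polya_identity -/(N n) -/(m n) Ew NrhoE; field.
  by rewrite p0 gt_eqF.
under eq_fun do rewrite h.
apply: cvgM; last apply: cvgV.
- by apply: cvgB; [apply: cvgM => //; exact: cvg_cst|exact: cvg_cst].
- by rewrite mulf_neq0 ?gt_eqF//; have := W_ge1; lra.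
- apply: cvgM => //.
  by apply: cvgB; [apply: cvgM => //; [exact: cvg_cst|exact: cvg_W.2]|exact: cvg_cst].
Qed.

Lemma two_theta_gt0 : 0 < 2 * limn (series (fun k => expR (- (k%:R * s) ^+ 2))) - 1.
Proof. by have := W_ge1; rewrite -/W; lra. Qed.

End fixed_scale.

(** The sum of e^(-pi k^2 x^2) over all integers k. Jacobi's usual variable is t = x^2, so the
    factor sqrt(t) of his identity is x here. *)
Definition theta (x : R) : R :=
  2 * limn (series (fun k => expR (- (pi * (k%:R * x) ^+ 2)))) - 1.

Lemma theta_inv (x : R) : 0 < x -> theta x^-1 = x * theta x.
Proof.
(* At s = sqrt(pi) y the exponents (pi k / s)^2 and (k s)^2 become pi (k / y)^2 and pi (k y)^2. *)
pose r : R := Num.sqrt pi.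
have r0 : 0 < r by rewrite sqrtr_gt0 pi_gt0.
have r2 : r ^+ 2 = pi by rewrite sqr_sqrtr// pi_ge0.
have key y : 0 < y -> n.+1%:R * 'C(2 * n.+1 ^ 2, n.+1 ^ 2)%:R / 2 ^+ (2 * n.+1 ^ 2) @[n --> \oo] -->
    theta y^-1 / (r * y * theta y) /\ 0 < theta y.
  move=> y0; have ry : 0 < r * y by rewrite mulr_gt0.
  have E1 : theta y = 2 * limn (series (fun k => expR (- (k%:R * (r * y)) ^+ 2))) - 1.
    rewrite /theta; under eq_fun do rewrite -r2 -exprMn mulrCA.
    by [].
  have E2 : theta y^-1 = 2 * limn (series (fun k => expR (- (pi * k%:R / (r * y)) ^+ 2))) - 1.
    rewrite /theta (_ : (fun k => expR (- (pi * (k%:R * y^-1) ^+ 2))) =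
      (fun k => expR (- (pi * k%:R / (r * y)) ^+ 2)))//.
    apply/funext => k; congr (expR (- _)); rewrite -r2; field.
    by rewrite !gt_eqF.
  split; last by rewrite E1; exact: two_theta_gt0.
  by rewrite E1 E2; exact: cvg_central_binom.
move=> x0; have [cx tx] := key x x0; have [c1 t1] := key 1 ltr01.
(* Both sides are limits of one sequence, and the right-hand side is 1 / r. *)
have E : theta x^-1 / (r * x * theta x) = theta 1^-1 / (r * 1 * theta 1).
  by apply: cvg_unique cx c1; exact: Rhausdorff.
move: E; rewrite invr1 mulr1 => /(congr1 (fun v => v * (r * x * theta x))).
rewrite divfK ?mulf_neq0 ?gt_eqF// => ->.
by field; rewrite !gt_eqF.
Qed.

End theta_equation.

(** * The series of f(n x) *)

Section f_series.
Variable R : realType.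

Lemma exprn_le_expR (x : R) n : 0 <= x -> x ^+ n <= n`!%:R * expR x.
Proof.
move=> x0; have f0 : 0 < n`!%:R :> R by rewrite ltr0n fact_gt0.
rewrite -ler_pdivrMl//.
have c : cvgn (series (exp_coeff x)) by exact: is_cvg_series_exp_coeff.
have h k : 0 <= exp_coeff x k by exact: exp_coeff_ge0.
have := series_le_limn n.+1 h c; rewrite /series/= big_nat_recr//=.
rewrite -/(expR x); apply: le_trans.
rewrite mulrC lerDr; exact: sumr_ge0.
Qed.

Lemma exprn_expRN_le (x : R) n : 0 <= x -> x ^+ n * expR (- x) <= n`!%:R.
Proof. by move=> x0; rewrite expRN ler_pdivrMr ?expR_gt0//; exact: exprn_le_expR. Qed.

Lemma sum_inv_sqr_le (x : R) n : 0 < x ->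
  \sum_(0 <= k < n) ((1 + k.+1%:R * x) ^+ 2)^-1 <= x^-1.
Proof.
move=> x0.
(* The strengthened bound telescopes: 1/(1 + (k+1)x)^2 <= 1/((1 + kx)(1 + (k+1)x)), a difference of
   consecutive values of 1/(x(1 + kx)). *)
suff: \sum_(0 <= k < n) ((1 + k.+1%:R * x) ^+ 2)^-1 <= x^-1 - (x * (1 + n%:R * x))^-1.
  move=> h; apply: (le_trans h); rewrite gerBl invr_ge0 mulr_ge0 ?(ltW x0)//.
  by rewrite addr_ge0// mulr_ge0// ltW.
elim: n => [|n IH]; first by rewrite big_geq// mul0r addr0 mulr1 subrr.
rewrite big_nat_recr//=.
have h0 : 0 < 1 + n%:R * x by rewrite ltr_wpDr// mulr_ge0// ltW.
have h1 : 0 < 1 + n.+1%:R * x by rewrite ltr_wpDr// mulr_ge0// ltW.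
apply: (@le_trans _ _ (x^-1 - (x * (1 + n%:R * x))^-1 + ((1 + n%:R * x) * (1 + n.+1%:R * x))^-1)).
  apply: lerD => //; rewrite lef_pV2 ?posrE ?mulr_gt0 ?exprn_gt0// expr2 ler_pM2r//.
  by rewrite lerD2l ler_pM2r// ler_nat.
rewrite le_eqVlt; apply/orP; left; apply/eqP; rewrite -natr1; rewrite -natr1 in h1; field.
by rewrite !gt_eqF.
Qed.

Lemma pi_ge1 : 1 <= pi :> R.
Proof. by have := @pi_ge2 R; lra. Qed.

Lemma f_bound K : exists2 C : R, 0 <= C &
  forall x : R, 0 < x -> `|f x| <= C / x ^+ K / (1 + x) ^+ 2.
Proof.
(* With X = pi x^2, the quantity 2 + X dominates x and 1 + x, and 6 (2 + X)^2 the polynomial factor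
   of f. In all (2 + X)^(K+4) e^(-(2+X)) <= (K+4)!, and e^2 undoes the shift by 2. *)
exists (6 * expR 2 * (K + 4)`!%:R); first by rewrite mulr_ge0// mulr_ge0 ?expR_ge0.
move=> x x0; have x1 : 0 < 1 + x by rewrite addr_gt0.
rewrite ler_pdivlMr ?exprn_gt0// ler_pdivlMr ?exprn_gt0//.
set X := pi * x ^+ 2.
have xX : x ^+ 2 <= X by rewrite ler_peMl ?sqr_ge0// pi_ge1.
have X0 : 0 <= X by rewrite mulr_ge0 ?sqr_ge0 ?pi_ge0.
have xX2 : x <= 2 + X by nra.
have xX3 : (1 + x) ^+ 2 <= (2 + X) ^+ 2 by rewrite lerXn2r ?nnegrE; nra.
have -> : f x = (4 * X ^+ 2 - 6 * X) * expR (- X) by rewrite /f /X; ring.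
rewrite normrM (ger0_norm (expR_ge0 _)).
have h1 : `|4 * X ^+ 2 - 6 * X| <= 6 * (2 + X) ^+ 2 by rewrite ler_norml; nra.
have -> : expR (- X) = expR 2 * expR (- (2 + X)) by rewrite -expRD; congr expR; ring.
have E : 0 <= 2 + X by lra.
have h2 := exprn_expRN_le (K + 4) E.
apply: (@le_trans _ _ (6 * (2 + X) ^+ 2 * (expR 2 * expR (- (2 + X))) * (2 + X) ^+ 2 * (2 + X) ^+ K)).
  have h3 : x ^+ K <= (2 + X) ^+ K by rewrite lerXn2r ?nnegrE// ltW.
  apply: ler_pM => //; rewrite ?mulr_ge0 ?exprn_ge0 ?expR_ge0 ?(ltW x0) ?(ltW x1)//.
  apply: ler_pM => //; rewrite ?mulr_ge0 ?exprn_ge0 ?expR_ge0 ?(ltW x0) ?(ltW x1)//.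
  by apply: ler_wpM2r => //; rewrite mulr_ge0 ?expR_ge0.
rewrite (_ : _ * _ * _ * _ = 6 * expR 2 * ((2 + X) ^+ (K + 4) * expR (- (2 + X)))); last first.
  by rewrite exprD; ring.
by apply: ler_wpM2l h2; rewrite mulr_ge0 ?expR_ge0.
Qed.

(** The factor (1 + x)^(-2) of [f_bound] is the one summed over n; it contributes 1/x, whence the
    power K + 1. K = 0 serves near x = 0 and large K at infinity. *)
Lemma sum_norm_f_le K : exists2 C : R, 0 <= C &
  forall x n, 0 < x -> \sum_(0 <= k < n) `|f (k.+1%:R * x)| <= C / x ^+ K.+1.
Proof.
have [C C0 fC] := f_bound K; exists C => // x n x0.
apply: (@le_trans _ _ (\sum_(0 <= k < n) C / x ^+ K * ((1 + k.+1%:R * x) ^+ 2)^-1)).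
  apply: ler_sum => k _; apply: le_trans (fC _ _) _; first by rewrite mulr_gt0.
  apply: ler_wpM2r; first by rewrite invr_ge0 exprn_ge0// addr_ge0// mulr_ge0// ltW.
  apply: ler_wpM2l => //; rewrite lef_pV2 ?posrE ?exprn_gt0 ?mulr_gt0//.
  by rewrite lerXn2r ?nnegrE ?mulr_ge0 ?(ltW x0)// ler_peMl ?(ltW x0)// ler1n.
rewrite -mulr_sumr exprS invfM mulrCA (mulrC x^-1) ler_wpM2l ?sum_inv_sqr_le//.
by rewrite divr_ge0// exprn_ge0// ltW.
Qed.

Lemma is_cvg_series_norm_f (x : R) : 0 < x -> cvgn (series (fun k => `|f (k.+1%:R * x)|)).
Proof.
move=> x0; have [C C0 fC] := sum_norm_f_le 0.
apply: nondecreasing_is_cvgn; first exact: nondecreasing_series.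
by exists (C / x ^+ 1) => _ [n _ <-]; exact: fC.
Qed.

Lemma is_cvg_series_f (x : R) : 0 < x -> cvgn (series (fun k => f (k.+1%:R * x))).
Proof. by move=> x0; exact: normed_cvg (is_cvg_series_norm_f x0). Qed.

Lemma is_cvg_series_inv_sqr : cvgn (series (fun k => (k.+1%:R ^+ 2)^-1 : R)).
Proof.
apply: (@series_le_cvg _ _ (fun k => 4 * ((1 + k.+1%:R * 1) ^+ 2)^-1 : R)) => [k|k|k|].
- by rewrite invr_ge0 exprn_ge0.
- by rewrite mulr_ge0// invr_ge0 exprn_ge0.
- rewrite mulr1 -[4]invrK -invfM lef_pV2 ?posrE ?mulr_gt0 ?exprn_gt0//.
  rewrite (_ : _ * _ = ((1 + k.+1%:R) / 2) ^+ 2); last by field.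
  have k1 : 1 <= k.+1%:R :> R by rewrite ler1n.
  by rewrite lerXn2r ?nnegrE; lra.
apply: (@is_cvg_seriesZ _ (fun k => ((1 + k.+1%:R * 1) ^+ 2)^-1 : R) 4).
apply: nondecreasing_is_cvgn.
  by apply: nondecreasing_series => k _ _; rewrite invr_ge0 exprn_ge0.
by exists (1^-1 : R) => _ [n _ <-]; apply: sum_inv_sqr_le.
Qed.

(** The equation g' = -2 g is that of c e^(-2y); the lemma applies both to the exponents [X n] below
    and to [scale_exp] in the Mellin transforms. *)
Lemma is_derive_pow_expRN (g : R -> R) j (y : R) : is_derive y 1 g (- 2 * g y) ->
  is_derive y 1 (fun z => g z ^+ j * expR (- g z))
    (- (2 * j%:R) * (g y ^+ j * expR (- g y)) + 2 * (g y ^+ j.+1 * expR (- g y))).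
Proof.
move=> dg.
have h : is_derive y 1 (expR \o (- g)) (expR (- g y) * (- (- 2 * g y))).
  exact: is_derive1_comp.
have -> : (fun z => g z ^+ j * expR (- g z)) = g ^+ j * (expR \o (- g)).
  by apply/funext => z; rewrite !fctE.
apply: is_derive_eq; rewrite !fctE /GRing.scale/=.
case: j => [|j]; first by rewrite !expr0 /=; ring.
by rewrite /= !exprS; ring.
Qed.

(** The third hypothesis is Jacobi's identity in the variable y, with 1 + 2 S0(y) = theta(e^(-y)),
    and 4 S2 - 6 S1 stands for F(e^(-y)). [E1] and [E2] are the first and second derivatives of the
    identity; in half their sum the terms 1 + 2 S0 cancel. *)
Lemma second_order_reflection (S0 S1 S2 : R -> R) :
  (forall z : R, is_derive z 1 S0 (2 * S1 z)) ->
  (forall z : R, is_derive z 1 S1 (- 2 * S1 z + 2 * S2 z)) ->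
  (forall z, 1 + 2 * S0 (- z) = expR (- z) * (1 + 2 * S0 z)) ->
  forall y, 4 * S2 (- y) - 6 * S1 (- y) = expR (- y) * (4 * S2 y - 6 * S1 y).
Proof.
move=> dS0 dS1 E0 y.
have dE (z : R) : is_derive z 1 (expR \o -%R) (expR (- z) * - 1) by apply: is_derive1_comp.
have dN0 (z : R) : is_derive z 1 (S0 \o -%R) (2 * S1 (- z) * - 1).
  by apply: is_derive1_comp.
have dN1 (z : R) : is_derive z 1 (S1 \o -%R) ((- 2 * S1 (- z) + 2 * S2 (- z)) * - 1).
  by apply: is_derive1_comp.
have E1 (z : R) : - 4 * S1 (- z) = - expR (- z) * (1 + 2 * S0 z) + 4 * expR (- z) * S1 z.
  have d1 := is_deriveD (is_derive_cst (1 : R) z 1) (is_deriveZ 2 (dN0 z)).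
  have d2 := is_deriveM (dE z) (is_deriveD (is_derive_cst (1 : R) z 1) (is_deriveZ 2 (dS0 z))).
  have E : cst 1 + 2 \*: (S0 \o -%R) = (expR \o -%R) * (cst 1 + 2 \*: S0).
    by apply/funext => w; exact: E0.
  have := @derive_val _ _ _ _ _ _ _ d1; rewrite E (@derive_val _ _ _ _ _ _ _ d2) !fctE /GRing.scale/= /GRing.scale/=; lra.
have E2 : 8 * S2 (- y) - 8 * S1 (- y) = expR (- y) * (1 + 2 * S0 y - 16 * S1 y + 8 * S2 y).
  have d1 := is_deriveZ (-4) (dN1 y).
  have d2 := is_deriveM (dE y) (is_deriveB (is_deriveZ 4 (dS1 y))
    (is_deriveD (is_derive_cst (1 : R) y 1) (is_deriveZ 2 (dS0 y)))).
  have E : -4 \*: (S1 \o -%R) = (expR \o -%R) * (4 \*: S1 - (cst 1 + 2 \*: S0)).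
    apply/funext => w; have := E1 w.
    by rewrite !fctE /GRing.scale/= /GRing.scale/= => ->; ring.
  have := @derive_val _ _ _ _ _ _ _ d1; rewrite E (@derive_val _ _ _ _ _ _ _ d2) !fctE /GRing.scale/= /GRing.scale/=; lra.
have := E1 y; lra.
Qed.

Let X n (y : R) : R := pi * (n.+1%:R * expR (- y)) ^+ 2.
Let T j n y : R := X n y ^+ j * expR (- X n y).
Let S j y : R := limn (series (fun n => T j n y)).

Let X_gt0 n y : 0 < X n y.
Proof. by rewrite mulr_gt0 ?pi_gt0// exprn_gt0// mulr_gt0 ?expR_gt0. Qed.

Let T_ge0 j n y : 0 <= T j n y.
Proof. by rewrite mulr_ge0 ?expR_ge0// exprn_ge0// ltW. Qed.

(** X^(j+1) e^(-X) <= (j+1)! is divided by X, where X >= n^2 e^(-2v) with n counted from 1. The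
    majorant is summable and uniform over y <= v, as termwise differentiation demands. *)
Let T_le j n y v : y <= v ->
  T j n y <= (j.+1)`!%:R * expR v ^+ 2 * (n.+1%:R ^+ 2)^-1.
Proof.
move=> yv; apply: (@le_trans _ _ ((j.+1)`!%:R / X n y)).
  rewrite ler_pdivlMr// mulrAC -exprSr exprn_expRN_le//; exact: ltW.
rewrite -mulrA ler_wpM2l// -[expR v ^+ 2]invrK -invfM -exprVn -expRN -exprMn.
rewrite lef_pV2 ?posrE// ?exprn_gt0 ?mulr_gt0 ?expR_gt0// /X.
apply: (@le_trans _ _ (1 * (n.+1%:R * expR (- y)) ^+ 2)).
  rewrite mul1r lerXn2r ?nnegrE ?mulr_ge0 ?expR_ge0// mulrC ler_pM2l//.
  by rewrite ler_expR lerN2.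
by rewrite ler_wpM2r ?exprn_ge0 ?mulr_ge0 ?expR_ge0// pi_ge1.
Qed.

Let cvg_bound c : cvgn (series (fun n => c * (n.+1%:R ^+ 2)^-1 : R)).
Proof. by apply: (@is_cvg_seriesZ _ (fun n => (n.+1%:R ^+ 2)^-1 : R)); exact: is_cvg_series_inv_sqr. Qed.

Let cvg_T j y : cvgn (series (fun n => T j n y)).
Proof.
apply: is_cvg_series_le (@cvg_bound ((j.+1)`!%:R * expR y ^+ 2)) => n.
by rewrite ger0_norm//; exact: T_le.
Qed.

Let is_derive_X n (y : R) : is_derive y 1 (X n) (- 2 * X n y).
Proof.
have h : is_derive y 1 (expR \o -%R) (expR (- y) * - 1).
  by apply: is_derive1_comp.
have -> : X n = (fun y => pi * n.+1%:R ^+ 2 *: ((expR \o -%R) ^+ 2) y).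
  by apply/funext => z; rewrite /X /= exprMn mulrA.
apply: is_derive_eq; rewrite !fctE /= expr1 /GRing.scale/=. ring.
Qed.

Let is_derive_T j n (y : R) :
  is_derive y 1 (T j n) (- (2 * j%:R) * T j n y + 2 * T j.+1 n y).
Proof. exact: is_derive_pow_expRN (is_derive_X n y). Qed.

Let is_derive_S j (y : R) : is_derive y 1 (S j) (- (2 * j%:R) * S j y + 2 * S j.+1 y).
Proof.
pose g n y := - (2 * j%:R) * T j n y + 2 * T j.+1 n y.
(* The derivatives are dominated on |z - y| < 1, where z <= y + 1. *)
pose c : R := 2 * j%:R * ((j.+1)`!%:R * expR (y + 1) ^+ 2) +
  2 * ((j.+2)`!%:R * expR (y + 1) ^+ 2).
have -> : - (2 * j%:R) * S j y + 2 * S j.+1 y = limn (series (g ^~ y)).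
  rewrite (_ : g ^~ y = (- (2 * j%:R)) *: (fun n => T j n y) + 2 *: (fun n => T j.+1 n y))//.
  rewrite lim_seriesD; [|apply: is_cvg_seriesZ; exact: cvg_T..].
  by rewrite !lim_seriesZ; [|exact: cvg_T..].
apply: (is_derive_series ltr01 _ _ (@cvg_bound c)) => [n z zy|n z zy|z].
- exact: is_derive_T.
- have zv : z <= y + 1 by move: zy; rewrite ltr_norml; lra.
  apply: le_trans (ler_normD _ _) _.
  rewrite [`|_ * T j n z|]normrM [`|_ * T j.+1 n z|]normrM normrN.
  rewrite !(ger0_norm (T_ge0 _ _ _)) !ger0_norm ?mulr_ge0// /c [leRHS]mulrDl.
  by apply: lerD; rewrite -[leRHS]mulrA; apply: ler_wpM2l; rewrite ?mulr_ge0// T_le.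
- exact: cvg_T.
Qed.

(** [theta] sums from k = 0 and [S 0] from k = 1, so the right-hand side is 2 (1 + S 0 y) - 1. *)
Let S0_theta y : theta (expR (- y)) = 1 + 2 * S 0 y.
Proof.
pose a k : R := expR (- (pi * (k%:R * expR (- y)) ^+ 2)).
have aT : (fun k => a k.+1) = (fun k => T 0 k y).
  by apply/funext => k; rewrite /T expr0 mul1r.
have h : series a n.+1 @[n --> \oo] --> 1 + S 0 y.
  have -> : (fun n => series a n.+1) = (fun n => 1 + series (fun k => T 0 k y) n).
    apply/funext => n; rewrite -aT /series/= big_nat_recl//=; congr (_ + _).
    by rewrite /a mul0r expr0n/= mulr0 oppr0 expR0.
  by apply: cvgD; [exact: cvg_cst|exact: cvg_T].
rewrite /theta -/a (_ : limn (series a) = 1 + S 0 y); first by ring.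
by apply: cvg_lim => //; rewrite -cvg_shiftS.
Qed.

Let fT k y : f (k.+1%:R * expR (- y)) = 4 * T 2 k y - 6 * T 1 k y.
Proof. by rewrite /f /T /X expr1; ring. Qed.

Definition fsum (x : R) : R := limn (series (fun k => f (k.+1%:R * x))).

Let fsumE y : fsum (expR (- y)) = 4 * S 2 y - 6 * S 1 y.
Proof.
rewrite /fsum (_ : (fun k => _) = 4 *: (fun k => T 2 k y) - 6 *: (fun k => T 1 k y)).
  rewrite lim_seriesB; [|apply: is_cvg_seriesZ; exact: cvg_T..].
  by rewrite !lim_seriesZ; [|exact: cvg_T..].
by apply/funext => k; rewrite fT.
Qed.

Lemma fsum_inv y : fsum (expR y) = expR (- y) * fsum (expR (- y)).
Proof.
have E0 z : 1 + 2 * S 0 (- z) = expR (- z) * (1 + 2 * S 0 z).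
  have := theta_inv (expR_gt0 (- z)); rewrite -expRN.
  by rewrite (S0_theta z) (S0_theta (- z)).
have d0 (z : R) : is_derive z 1 (S 0) (2 * S 1 z).
  by have := is_derive_S 0 z; rewrite mulr0 oppr0 mul0r add0r.
have d1 (z : R) : is_derive z 1 (S 1) (- 2 * S 1 z + 2 * S 2 z).
  by have := is_derive_S 1 z; rewrite mulr1.
have := fsumE (- y); rewrite opprK => ->; rewrite (fsumE y).
exact: (second_order_reflection d0 d1 E0).
Qed.

End f_series.

(** * Goursat's theorem *)

Section goursat.
Variable R : realType.
Let mu := @lebesgue_measure R.

Definition seg_int (g : R -> R) (a b : R) : R := \int[mu]_(t in `[a, b]) g t.

Lemma integrable_segment (g : R -> R) a b : continuous g ->
  mu.-integrable `[a, b] (EFin \o g).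
Proof.
move=> cg; apply: continuous_compact_integrable; first exact: segment_compact.
exact: continuous_subspaceT.
Qed.

Lemma seg_int_split (g : R -> R) a b c : continuous g -> a <= b -> b <= c ->
  seg_int g a c = seg_int g a b + seg_int g b c.
Proof.
move=> cg ab bc; have ig := integrable_segment a c cg.
apply/eqP; rewrite -subr_eq0 opprD addrA subr_eq0; apply/eqP.
rewrite /seg_int Rintegral_itvB//; apply: Rintegral_itv_obnd_cbnd.
apply: integrableS ig => //; exact: subset_itv.
Qed.

Lemma seg_intD (g h : R -> R) a b : continuous g -> continuous h ->
  seg_int (fun t => g t + h t) a b = seg_int g a b + seg_int h a b.
Proof. by move=> cg ch; apply: RintegralD => //; exact: integrable_segment. Qed.

Lemma seg_int_cst k a b : a <= b -> seg_int (fun=> k) a b = k * (b - a).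
Proof.
move=> ab; rewrite /seg_int Rintegral_cst//= lebesgue_measure_itv/= lte_fin.
case: ltP => [//|ba]; have -> : a = b by apply/eqP; rewrite eq_le ab.
by rewrite subrr /=; lra.
Qed.

Lemma seg_int_ge (g : R -> R) k a b : continuous g -> a <= b ->
  (forall t, a <= t <= b -> k <= g t) -> k * (b - a) <= seg_int g a b.
Proof.
move=> cg ab kg; rewrite -seg_int_cst//; apply: le_Rintegral => //.
- by apply: integrable_segment => t; exact: cvg_cst.
- exact: integrable_segment.
Qed.

Lemma seg_int_le (g : R -> R) k a b : continuous g -> a <= b ->
  (forall t, a <= t <= b -> g t <= k) -> seg_int g a b <= k * (b - a).
Proof.
move=> cg ab kg; rewrite -seg_int_cst//; apply: le_Rintegral => //.
- exact: integrable_segment.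
- by apply: integrable_segment => t; exact: cvg_cst.
Qed.

(** Total differentiability at one point with partial derivatives a and b: exactly what complex
    differentiability at that point yields for real and imaginary parts. The closed condition on
    distances suits the closed squares of the bisection. *)
Definition diff2_at (P : R -> R -> R) (x0 y0 a b : R) :=
  forall e, 0 < e -> exists2 d, 0 < d & forall x y, `|x - x0| <= d -> `|y - y0| <= d ->
    `|P x y - P x0 y0 - a * (x - x0) - b * (y - y0)| <= e * (`|x - x0| + `|y - y0|).

Lemma diff2_at_continuous1 P x0 y0 a b : diff2_at P x0 y0 a b ->
  {for x0, continuous (P ^~ y0)}.
Proof.
move=> dP; apply/cvgrPdist_le => e e0.
have [d d0 Pd] := dP 1 ltr01.
pose k := 1 + `|a|; have k0 : 0 < k by rewrite ltr_wpDr.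
near=> x.
have xd : `|x - x0| <= d.
  by rewrite distrC; near: x; exists d => //= t; exact: ltW.
have xe : `|x - x0| <= e / k.
  rewrite distrC; near: x; exists (e / k); first by rewrite /= divr_gt0.
  by move=> t /=; exact: ltW.
have := Pd x y0 xd; rewrite subrr normr0 => /(_ (ltW d0)).
rewrite mulr0 subr0 addr0 mul1r => h.
rewrite distrC (_ : P x y0 - P x0 y0 = (P x y0 - P x0 y0 - a * (x - x0)) + a * (x - x0)); last by ring.
apply: le_trans (ler_normD _ _) _; rewrite normrM.
apply: (@le_trans _ _ (k * `|x - x0|)); first by rewrite /k; lra.
by rewrite mulrC -ler_pdivlMr.
Unshelve. all: end_near. Qed.

Lemma diff2_at_swap P x0 y0 a b : diff2_at P x0 y0 a b ->
  diff2_at (fun x y => P y x) y0 x0 b a.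
Proof.
move=> dP e e0; have [d d0 Pd] := dP e e0; exists d => // x y xd yd.
have := Pd y x yd xd; rewrite (addrC `|y - x0|).
by rewrite (addrAC _ (- (a * _))).
Qed.

Lemma diff2_at_continuous2 P x0 y0 a b : diff2_at P x0 y0 a b ->
  {for y0, continuous (P x0)}.
Proof. by move=> /diff2_at_swap/diff2_at_continuous1. Qed.

Section closed_form.
Variables P Q : R -> R -> R.
Hypothesis PQ : forall x y, exists a b c,
  diff2_at P x y a b /\ diff2_at Q x y b c.

Let cP1 y : continuous (P ^~ y).
Proof. by move=> x; have [a [b [c [+ _]]]] := PQ x y; exact: diff2_at_continuous1. Qed.

Let cQ2 x : continuous (Q x).
Proof. by move=> y; have [a [b [c [_ +]]]] := PQ x y; exact: diff2_at_continuous2. Qed.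

(* Circulation of [P dx + Q dy] around the square with lower left corner
   [(x, y)] and side [l]. *)
Let circ x y l := seg_int (fun t => P t y - P t (y + l)) x (x + l) +
  seg_int (fun t => Q (x + l) t - Q x t) y (y + l).

Let cPB y y' : continuous (fun t => P t y - P t y').
Proof. by move=> t; apply: cvgB; exact: cP1. Qed.

Let cQB x x' : continuous (fun t => Q x t - Q x' t).
Proof. by move=> t; apply: cvgB; exact: cQ2. Qed.

(** The inner edges are traversed twice in opposite directions and cancel. *)
Let circ_split x y l : 0 <= l ->
  circ x y (l + l) = circ x y l + circ (x + l) y l + circ x (y + l) l + circ (x + l) (y + l) l.
Proof.
move=> l0; rewrite /circ !addrA.
have h (z : R) : z <= z + l by rewrite lerDl.
rewrite (@seg_int_split _ x (x + l) (x + l + l)) ?h// (@seg_int_split _ y (y + l) (y + l + l)) ?h//.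
have EP a b : seg_int (fun t => P t y - P t (y + l + l)) a b =
    seg_int (fun t => P t y - P t (y + l)) a b +
    seg_int (fun t => P t (y + l) - P t (y + l + l)) a b.
  by rewrite -seg_intD//; congr seg_int; apply/funext => t; ring.
have EQ a b : seg_int (fun t => Q (x + l + l) t - Q x t) a b =
    seg_int (fun t => Q (x + l + l) t - Q (x + l) t) a b +
    seg_int (fun t => Q (x + l) t - Q x t) a b.
  by rewrite -seg_intD//; congr seg_int; apply/funext => t; ring.
by rewrite !EP !EQ; ring.
Qed.

Let seg_int_near (g : R -> R) k e a l : continuous g -> 0 <= l ->
  (forall t, a <= t <= a + l -> `|g t - k| <= e) ->
  `|seg_int g a (a + l) - k * l| <= e * l.
Proof.
move=> cg l0 gk.
have al : a <= a + l by rewrite lerDl.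
have := @seg_int_ge g (k - e) _ _ cg al; have := @seg_int_le g (k + e) _ _ cg al.
rewrite addrAC subrr add0r => h1 h2.
rewrite ler_norml; apply/andP; split.
  suff : (k - e) * l <= seg_int g a (a + l) by lra.
  by apply: h2 => t /gk; rewrite ler_norml; lra.
suff : seg_int g a (a + l) <= (k + e) * l by lra.
by apply: h1 => t /gk; rewrite ler_norml; lra.
Qed.

(** The affine parts of P and Q contribute (- b + b) l^2 = 0, because the coefficient b is common to
    both; only the remainders count. *)
Let circ_le x0 y0 e : 0 < e -> exists2 d, 0 < d & forall x y l,
  0 <= l -> l <= d -> x <= x0 <= x + l -> y <= y0 <= y + l ->
  `|circ x y l| <= e * l ^+ 2.
Proof.
move=> e0; have [a [b [c [dP dQ]]]] := PQ x0 y0.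
(* The distances add up to at most 2 l, so each of the four edges contributes at most (e/4) l^2. *)
have e8 : 0 < e / 8 by rewrite divr_gt0.
have [d1 d10 Pd] := dP _ e8; have [d2 d20 Qd] := dQ _ e8.
exists (Num.min d1 d2); first by rewrite lt_min d10.
move=> x y l l0; rewrite le_min => /andP[ld1 ld2] xx yy.
have near1 t z : x <= t <= x + l -> y <= z <= y + l ->
    `|P t z - P x0 y0 - a * (t - x0) - b * (z - y0)| <= e / 8 * (l + l).
  move=> tx zy.
  have h1 : `|t - x0| <= l by rewrite ler_norml; lra.
  have h2 : `|z - y0| <= l by rewrite ler_norml; lra.
  apply: le_trans (Pd _ _ (le_trans h1 ld1) (le_trans h2 ld1)) _.
  by apply: ler_wpM2l; [exact: ltW|exact: lerD].
have near2 t z : x <= t <= x + l -> y <= z <= y + l ->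
    `|Q t z - Q x0 y0 - b * (t - x0) - c * (z - y0)| <= e / 8 * (l + l).
  move=> tx zy.
  have h1 : `|t - x0| <= l by rewrite ler_norml; lra.
  have h2 : `|z - y0| <= l by rewrite ler_norml; lra.
  apply: le_trans (Qd _ _ (le_trans h1 ld2) (le_trans h2 ld2)) _.
  by apply: ler_wpM2l; [exact: ltW|exact: lerD].
have hx : x <= x <= x + l by lra.
have hxl : x <= x + l <= x + l by lra.
have hy : y <= y <= y + l by lra.
have hyl : y <= y + l <= y + l by lra.
have h1 : `|seg_int (fun t => P t y - P t (y + l)) x (x + l) - (- b * l) * l| <= (e / 2 * l) * l.
  apply: seg_int_near => // t tx.
  have := near1 t y tx hy; have := near1 t (y + l) tx hyl.
  by rewrite !ler_norml; lra.
have h2 : `|seg_int (fun t => Q (x + l) t - Q x t) y (y + l) - (b * l) * l| <= (e / 2 * l) * l.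
  apply: seg_int_near => // t ty.
  have := near2 x t hx ty; have := near2 (x + l) t hxl ty.
  by rewrite !ler_norml; lra.
rewrite /circ; set u := seg_int _ x _ in h1 *; set v := seg_int _ y _ in h2 *.
rewrite (_ : u + v = (u - (- b * l) * l) + (v - b * l * l)); last by ring.
apply: le_trans (ler_normD _ _) _.
rewrite expr2; lra.
Qed.

Let circ_quarter x y l : 0 <= l -> exists p : R * R,
  [/\ p.1 = x \/ p.1 = x + l / 2, p.2 = y \/ p.2 = y + l / 2 &
   `|circ x y l| / 4 <= `|circ p.1 p.2 (l / 2)|].
Proof.
move=> l0; have l2 : 0 <= l / 2 by rewrite divr_ge0.
have := circ_split x y l2; rewrite (_ : l / 2 + l / 2 = l); last by field.
set c1 := circ x y (l / 2); set c2 := circ (x + l / 2) y _.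
set c3 := circ x (y + l / 2) _; set c4 := circ (x + l / 2) (y + l / 2) _ => E.
have h : `|circ x y l| <= `|c1| + `|c2| + `|c3| + `|c4|.
  rewrite E; do 2 (apply: (le_trans (ler_normD _ _)); rewrite lerD2r).
  exact: ler_normD.
have [h1|h1] := lerP (`|circ x y l| / 4) `|c1|; first by exists (x, y); split; [left|left|].
have [h2|h2] := lerP (`|circ x y l| / 4) `|c2|; first by exists (x + l / 2, y); split; [right|left|].
have [h3|h3] := lerP (`|circ x y l| / 4) `|c3|; first by exists (x, y + l / 2); split; [left|right|].
exists (x + l / 2, y + l / 2); split; [by right|by right|].
rewrite -/c4; lra.
Qed.

(** Goursat's bisection for a form P dx + Q dy closed at each point: quarters carrying at least a
    fourth of the circulation are chosen repeatedly, and [circ_le] at their common point is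
    contradicted. *)
Lemma goursat_square x y l : 0 < l ->
  seg_int (fun t => P t y - P t (y + l)) x (x + l) +
  seg_int (fun t => Q (x + l) t - Q x t) y (y + l) = 0.
Proof.
move=> l0; rewrite -/(circ x y l); apply/eqP; apply: contraT => /eqP/eqP cn0.
have {cn0} cn0 : 0 < `|circ x y l| by rewrite normr_gt0.
pose ln n : R := l / 2 ^+ n.
have ln0 n : 0 < ln n by rewrite divr_gt0// exprn_gt0.
have lnS n : ln n.+1 = ln n / 2 by rewrite /ln exprSr invfM mulrA.
(* The default (0, 0) is never taken: [circ_quarter] provides a candidate at every stage. *)
pose next n (p : R * R) : R * R := xget (0, 0) [set q | [/\ q.1 = p.1 \/ q.1 = p.1 + ln n / 2,
   q.2 = p.2 \/ q.2 = p.2 + ln n / 2 &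
   `|circ p.1 p.2 (ln n)| / 4 <= `|circ q.1 q.2 (ln n / 2)|]].
have nextP n p : [/\ (next n p).1 = p.1 \/ (next n p).1 = p.1 + ln n / 2,
   (next n p).2 = p.2 \/ (next n p).2 = p.2 + ln n / 2 &
   `|circ p.1 p.2 (ln n)| / 4 <= `|circ (next n p).1 (next n p).2 (ln n / 2)|].
  exact: (xgetPex (0, 0) (circ_quarter p.1 p.2 (ltW (ln0 n)))).
pose s := fix s n := if n is n'.+1 then next n' (s n') else (x, y).
(* One argument for both coordinates: the lower ends increase, the upper ends decrease, and the
   limit of the lower ends lies in all the intervals. *)
have nested (c : R * R -> R) : (forall n p, c (next n p) = c p \/ c (next n p) = c p + ln n / 2) ->
    exists x0, forall n, c (s n) <= x0 <= c (s n) + ln n.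
  move=> cn.
  have up : nondecreasing_seq (fun n => c (s n)).
    apply/nondecreasing_seqP => n /=; have := ln0 n.
    by case: (cn n (s n)) => ->; lra.
  have down : nonincreasing_seq (fun n => c (s n) + ln n).
    apply/nonincreasing_seqP => n /=; have := ln0 n; rewrite lnS.
    by case: (cn n (s n)) => ->; lra.
  have le m n : c (s m) <= c (s n) + ln n.
    apply: (@le_trans _ _ (c (s (maxn m n)))); first by apply: up; exact: leq_maxl.
    apply: (@le_trans _ _ (c (s (maxn m n)) + ln (maxn m n))).
      by rewrite lerDl ltW.
    by apply: down; exact: leq_maxr.
  have cv : cvgn (fun n => c (s n)).
    apply: nondecreasing_is_cvgn => //.
    by exists (c (s 0%N) + ln 0%N) => _ [n _ <-]; exact: le.
  exists (limn (fun n => c (s n))) => n; rewrite nondecreasing_cvgn_le//=.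
  by apply: limr_le => //; apply: nearW => m; exact: le.
have [x0 hx0] : exists x0, forall n, (s n).1 <= x0 <= (s n).1 + ln n.
  by apply: (nested fst) => n p; have [] := nextP n p.
have [y0 hy0] : exists y0, forall n, (s n).2 <= y0 <= (s n).2 + ln n.
  by apply: (nested snd) => n p; have [] := nextP n p.
have large n : `|circ x y l| / 4 ^+ n <= `|circ (s n).1 (s n).2 (ln n)|.
  elim: n => [|n IH]; first by rewrite /= /ln !expr0 !divr1.
  have [_ _] := nextP n (s n); rewrite -lnS; apply: le_trans.
  by rewrite exprSr invfM mulrA ler_pM2r ?invr_gt0.
(* Half the circulation over the area. The area shrinks by 4 at each stage and the circulation by at
   most 4, so a single small square gives the contradiction. *)
pose e := `|circ x y l| / 2 / l ^+ 2.
have e0 : 0 < e by rewrite !divr_gt0// exprn_gt0.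
have [d d0 hd] := circ_le x0 y0 e0.
have [n nd] : exists n, ln n <= d.
  have : (fun n => l / 2 ^+ n) @ \oo --> (0 : R).
    rewrite -(mulr0 l); apply: cvgM; first exact: cvg_cst.
    under eq_fun do rewrite -exprVn.
    by apply: cvg_expr; rewrite ger0_norm ?invr_ge0// invf_lt1// ltr1n.
  move=> /cvgr_dist_le/(_ _ d0)[n _ /(_ n (leqnn n))/=].
  by rewrite sub0r normrN gtr0_norm ?ln0// => h; exists n.
have := hd _ _ _ (ltW (ln0 n)) nd (hx0 n) (hy0 n).
move=> /(le_trans (large n)).
rewrite /ln exprMn exprVn -exprM mulnC exprM (_ : 2 ^+ 2 = 4); last by ring.
rewrite mulrA ler_pM2r ?invr_gt0 ?exprn_gt0// /e divfK ?gt_eqF ?exprn_gt0//.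
lra.
Qed.

End closed_form.
End goursat.

(** * Entire functions *)

Section entire_uniqueness.
Variable R : realType.
Local Notation Re := complex.Re.
Local Notation Im := complex.Im.

(* The kernels [(1 - t^2 / 4L^2)^n] concentrate at the origin. *)
Lemma concentration (g : R -> R) L : continuous g -> 0 < L ->
  (forall n, seg_int (fun t => g t * (1 - t ^+ 2 / (4 * L ^+ 2)) ^+ n) (- L) L = 0) ->
  g 0 <= 0.
Proof.
move=> cg L0 g_int; rewrite leNgt; apply/negP => g0.
(* The 4 keeps the kernel at least 3/4, hence positive, on [-L, L]. *)
pose k t : R := 1 - t ^+ 2 / (4 * L ^+ 2).
have L2 : 0 < 4 * L ^+ 2 by rewrite mulr_gt0// exprn_gt0.
have ck : continuous k.
  move=> t; apply: cvgB; first exact: cvg_cst.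
  by apply: cvgM; [exact: exprn_continuous|exact: cvg_cst].
have cgk n : continuous (fun t => g t * k t ^+ n).
  move=> t; apply: cvgM; first exact: cg.
  by apply: (@cvg_comp _ _ _ k (fun x => x ^+ n)); [exact: ck|exact: exprn_continuous].
have kE s t : 0 <= s -> s <= `|t| -> k t <= k s.
  move=> s0 st; rewrite /k lerD2l lerN2 ler_pM2r ?invr_gt0//.
  by rewrite -(real_normK (num_real t)) lerXn2r ?nnegrE.
have kE' s t : `|t| <= s -> k s <= k t.
  move=> st; rewrite /k lerD2l lerN2 ler_pM2r ?invr_gt0//.
  by rewrite -(real_normK (num_real t)) lerXn2r ?nnegrE ?(le_trans _ st).
have kpos t : `|t| <= L -> 0 < k t.
  move=> /kE'; apply: lt_le_trans; rewrite /k invfM mulrCA mulfV ?expf_neq0 ?gt_eqF//; lra.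
have [d [d0 dL gd]] : exists d, [/\ 0 < d, d <= L & forall t, `|t| <= d -> g 0 / 2 <= g t].
  have g2 : 0 < g 0 / 2 by rewrite divr_gt0.
  have /cvgrPdist_le/(_ _ g2)[r /= r0 rg] := cg 0.
  exists (Num.min L (r / 2)); split; first by rewrite lt_min L0 divr_gt0.
    by rewrite ge_min lexx.
  move=> t; rewrite le_min => /andP[_ tr].
  have /rg : ball_ Num.norm 0 r t by rewrite /= sub0r normrN; lra.
  by rewrite ler_norml; lra.
have [M M0 gM] : exists2 M, 0 < M & forall t, - L <= t <= L -> - M <= g t.
  have [||c cL gc] := @EVT_min R g (- L) L; first by lra.
    exact: continuous_subspaceT.
  exists (1 + `|g c|) => [|t tL]; first by rewrite ltr_wpDr.
  have : g c <= g t by apply: gc; rewrite in_itv.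
  by have := ler_norm (- g c); rewrite normrN; lra.
(* The interval |t| <= d/2 contributes at least a multiple of a^n. Elsewhere the loss is at most a
   multiple of b^n, since g is positive up to |t| = d and the kernel is at most b beyond. *)
pose a := k (d / 2); pose b := k d.
have b0 : 0 < b by apply: kpos; rewrite gtr0_norm.
have ab : b < a.
  rewrite /b /a /k ltrD2l ltrN2 ltr_pM2r ?invr_gt0// ltrXn2r// ?nnegrE; lra.
have key n : g 0 / 2 * d * a ^+ n <= 2 * L * M * b ^+ n.
  have h0 : 0 = seg_int (fun t => g t * k t ^+ n) (- L) L by rewrite g_int.
  move: h0; rewrite (@seg_int_split _ _ _ (- (d / 2)))//; [|lra..].
  rewrite (@seg_int_split _ _ (- (d / 2)) (d / 2))//; [|lra..].
  have outer t : - L <= t <= L -> d / 2 <= `|t| -> - M * b ^+ n <= g t * k t ^+ n.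
    move=> tL dt.
    have kt : 0 <= k t ^+ n by rewrite exprn_ge0// ltW// kpos// ler_norml.
    have [td|dt'] := lerP `|t| d.
      apply: (@le_trans _ _ 0); first by rewrite mulNr oppr_le0 mulr_ge0 ?exprn_ge0 ?ltW.
      by rewrite mulr_ge0//; have := gd _ td; lra.
    apply: (@le_trans _ _ (- M * k t ^+ n)).
      rewrite !mulNr lerN2 ler_pM2l// lerXn2r ?nnegrE ?(ltW b0)//.
        by rewrite ltW// kpos// ler_norml.
      by apply: kE; [exact: ltW|exact: ltW].
    by rewrite ler_wpM2r// gM.
  have h1 : - M * b ^+ n * (- (d / 2) - - L) <= seg_int (fun t => g t * k t ^+ n) (- L) (- (d / 2)).
    apply: seg_int_ge => // [|t tL]; first lra.
    by apply: outer; [lra|rewrite ler0_norm; lra].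
  have h3 : - M * b ^+ n * (L - d / 2) <= seg_int (fun t => g t * k t ^+ n) (d / 2) L.
    apply: seg_int_ge => // [|t tL]; first lra.
    by apply: outer; [lra|rewrite ger0_norm; lra].
  have h2 : g 0 / 2 * a ^+ n * (d / 2 - - (d / 2)) <=
      seg_int (fun t => g t * k t ^+ n) (- (d / 2)) (d / 2).
    apply: seg_int_ge => // [|t tL]; first lra.
    have td : `|t| <= d / 2 by rewrite ler_norml.
    have a0 : 0 < a by exact: lt_trans ab.
    apply: ler_pM; rewrite ?exprn_ge0 ?(ltW a0)//; first by lra.
      by apply: gd; lra.
    by rewrite lerXn2r ?nnegrE ?(ltW a0)// ?kE'// ltW// kpos//; lra.
  have Mb : 0 <= M * b ^+ n by rewrite mulr_ge0 ?exprn_ge0 ?ltW.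
  nra.
have a0 : 0 < a by exact: lt_trans ab.
have : (fun n => 2 * L * M * (b / a) ^+ n) @ \oo --> (0 : R).
  rewrite -(mulr0 (2 * L * M)); apply: cvgM; first exact: cvg_cst.
  by apply: cvg_expr; rewrite gtr0_norm ?divr_gt0// ltr_pdivrMr// mul1r.
move=> /cvgrPdist_lt/(_ (g 0 / 2 * d)); rewrite mulr_gt0 ?divr_gt0// => /(_ isT)[n _ /(_ n (leqnn n))/=].
rewrite sub0r normrN => /(le_lt_trans (ler_norm _)).
rewrite expr_div_n mulrA ltr_pdivrMr ?exprn_gt0//.
by rewrite ltNge key.
Qed.

Lemma normc_ge0 (z : R[i]) : 0 <= normc z.
Proof. by case: z => x y; exact: sqrtr_ge0. Qed.

Lemma normc_opp (z : R[i]) : normc (- z) = normc z.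
Proof. by case: z => x y /=; rewrite !sqrrN. Qed.

Lemma normc_le_ReIm (z : R[i]) : normc z <= `|Re z| + `|Im z|.
Proof.
case: z => x y /=; rewrite -[leRHS]ger0_norm ?addr_ge0// -sqrtr_sqr.
rewrite ler_wsqrtr// sqrrD !real_normK ?num_real//.
by rewrite -addrA lerD2l lerDr mulrn_wge0// mulr_ge0.
Qed.

Lemma normc_ge_Re (z : R[i]) : `|Re z| <= normc z.
Proof. by case: z => x y /=; rewrite -sqrtr_sqr ler_wsqrtr// lerDl sqr_ge0. Qed.

Lemma normc_ge_Im (z : R[i]) : `|Im z| <= normc z.
Proof. by case: z => x y /=; rewrite -sqrtr_sqr ler_wsqrtr// lerDr sqr_ge0. Qed.

Lemma normCE (z : R[i]) : `|z| = (normc z)%:C.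
Proof. by []. Qed.

(** The norm of [R[i]] takes its values in [R[i]]; the limit is restated with the real modulus
    [normc] and real tolerances, for use with [diff2_at]. *)
Lemma derivable_complex (g : R[i] -> R[i]) (z : R[i]) :
  derivable (g : R[i]^o -> R[i]^o) z 1 -> exists l : R[i],
  forall e : R, 0 < e -> exists2 d : R, 0 < d &
    forall h, normc h <= d -> normc (g (h + z) - g z - h * l) <= e * normc h.
Proof.
move=> /cvg_ex[/= l /cvgrPdist_le gl]; exists l => e e0.
have e0' : 0 < e%:C :> R[i] by rewrite ltcR.
have [[d di] /=] := gl _ e0'.
rewrite ltcE/= => /andP[/eqP di0 d0] gd; rewrite di0 in gd.
(* Halving passes from an open ball to a closed condition; h = 0, outside the punctured
   neighbourhood, is checked apart. *)
exists (d / 2) => [|h hd]; first by rewrite divr_gt0.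
have [->|h0] := eqVneq h 0.
  by rewrite add0r subrr mul0r subr0 normc0 mulr0.
have := gd h; rewrite /ball_/= sub0r normrN normCE ltcR => /(_ _ h0).
have hd' : normc h < d by lra.
move=> /(_ hd'); rewrite [(_ *: 1 : R[i])]mulr1 normCE lecR => H.
have nh : 0 < normc h.
  by rewrite lt_neqAle eq_sym normc_ge0 andbT; apply: contra h0 => /eqP/eq0_normc ->.
rewrite -ler_pdivrMr// -normcV -normcM.
by rewrite (_ : _ / h = - (l - h^-1 * (g (h + z) - g z))) ?normc_opp//; field.
Qed.

Lemma derivable_complexP (g : R[i] -> R[i]) (z l : R[i]) :
  (forall e : R, 0 < e -> exists2 d : R, 0 < d &
    forall h, normc h <= d -> normc (g (h + z) - g z - h * l) <= e * normc h) ->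
  derivable (g : R[i]^o -> R[i]^o) z 1.
Proof.
move=> gl; apply/cvg_ex; exists l; apply/cvgrPdist_le => -[e ei].
rewrite ltcE/= => /andP[/eqP -> e0]; have [d d0 gd] := gl e e0.
exists d%:C; first by rewrite /= ltcR.
move=> h; rewrite /ball_/= sub0r normrN normCE ltcR => /ltW/gd H h0.
have nh : 0 < normc h.
  by rewrite lt_neqAle eq_sym normc_ge0 andbT; apply: contra h0 => /eqP/eq0_normc ->.
rewrite [(_ *: 1 : R[i])]mulr1 normCE lecR.
move: H; rewrite -ler_pdivrMr// -normcV -normcM.
by rewrite (_ : _ / h = - (l - h^-1 * (g (h + z) - g z))) ?normc_opp//; field.
Qed.

(** If the derivative is a + ib, then d(Re g) = a dx - b dy and d(- Im g) = - b dx - a dy. The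
    common - b is a Cauchy-Riemann equation: the form Re(g dz) is closed. *)
Lemma diff2_Re_Im (g : R[i] -> R[i]) : entire g -> forall x y, exists a b c,
  diff2_at (fun x y => Re (g (x +i* y))) x y a b /\
  diff2_at (fun x y => - Im (g (x +i* y))) x y b c.
Proof.
move=> eg x y; have [[a b] gl] := derivable_complex (eg (x +i* y)).
exists a, (- b), (- a).
have key e : 0 < e -> exists2 d, 0 < d & forall x' y', `|x' - x| <= d -> `|y' - y| <= d ->
    normc (g (x' +i* y') - g (x +i* y) - ((x' - x) +i* (y' - y)) * (a +i* b)) <=
      e * (`|x' - x| + `|y' - y|).
  move=> e0; have [d d0 gd] := gl e e0; exists (d / 2); first by rewrite divr_gt0.
  move=> x' y' xd yd; have nh := normc_le_ReIm ((x' - x) +i* (y' - y)).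
  have hd : normc ((x' - x) +i* (y' - y)) <= d by apply: le_trans nh _; rewrite /=; lra.
  have := gd _ hd; rewrite (_ : (x' - x) +i* (y' - y) + (x +i* y) = x' +i* y'); last first.
    by simpc; rewrite !subrK.
  move=> H; apply: le_trans H _.
  by rewrite ler_pM2l.
split=> e e0; have [d d0 gd] := key e e0; exists d => // x' y' xd yd;
  apply: le_trans (gd x' y' xd yd).
- apply: le_trans (normc_ge_Re _); rewrite le_eqVlt; apply/orP; left; apply/eqP; congr (`|_|).
  by case: (g (x' +i* y')) => u v; case: (g (x +i* y)) => u' v' /=; ring.
- apply: le_trans (normc_ge_Im _); rewrite -normrN le_eqVlt; apply/orP; left; apply/eqP; congr (`|_|).
  by case: (g (x' +i* y')) => u v; case: (g (x +i* y)) => u' v' /=; ring.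
Qed.

Lemma entire_id : entire (id : R[i] -> R[i]).
Proof. by move=> z; exact: derivable_id. Qed.

Lemma entire_cst (c : R[i]) : entire (fun=> c).
Proof. by move=> z; exact: derivable_cst. Qed.

Lemma entireM (g h : R[i] -> R[i]) : entire g -> entire h -> entire (fun z => g z * h z).
Proof. by move=> eg eh z; exact: (@derivableM R[i] R[i]^o g h z 1 (eg z) (eh z)). Qed.

Lemma entireB (g h : R[i] -> R[i]) : entire g -> entire h -> entire (fun z => g z - h z).
Proof. by move=> eg eh z; exact: (@derivableB R[i] R[i]^o R[i]^o g h z 1 (eg z) (eh z)). Qed.

Lemma entireX (g : R[i] -> R[i]) n : entire g -> entire (fun z => g z ^+ n).
Proof.
move=> eg; elim: n => [|n IH]; first by under eq_fun do rewrite expr0; exact: entire_cst.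
by under eq_fun do rewrite exprS; exact: entireM.
Qed.

Lemma entire_affine (g : R[i] -> R[i]) (c w : R[i]) : entire g -> entire (fun z => g (c + w * z)).
Proof.
move=> eg z; have [l gl] := derivable_complex (eg (c + w * z)).
apply: (@derivable_complexP _ _ (w * l)) => e e0.
pose k := 1 + normc w; have k0 : 0 < k by rewrite ltr_wpDr ?normc_ge0.
have [|d d0 gd] := gl (e / k); first by rewrite divr_gt0.
exists (d / k) => [|h hd]; first by rewrite divr_gt0.
have wh : normc (w * h) <= k * normc h.
  by rewrite normcM ler_wpM2r ?normc_ge0// /k lerDr.
have := gd (w * h); rewrite mulrDr addrCA (addrC (w * h)) => H.
rewrite (_ : h * (w * l) = w * h * l); last by ring.
apply: le_trans (H _) _.
  by apply: le_trans wh _; rewrite mulrC -ler_pdivlMr.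
apply: (@le_trans _ _ (e / k * (k * normc h))); first by rewrite ler_pM2l ?divr_gt0.
by rewrite mulrA divfK ?gt_eqF.
Qed.

Lemma entire_compact_support (g : R[i] -> R[i]) L : 0 < L -> entire g ->
  (forall z, L <= `|Re z| \/ L <= `|Im z| -> g z = 0) -> g 0 = 0.
Proof.
move=> L0 eg g0.
(* This factor makes the value at the origin |g 0|^2, so that the one-sided bound of [concentration]
   is enough. *)
pose w := conjc (g 0).
pose q n z : R[i] := g z * w * (1 - z ^+ 2 * ((4 * L ^+ 2)^-1)%:C) ^+ n.
have eq_ n : entire (q n).
  have e1 := @entireM _ _ eg (@entire_cst w).
  have e2 := @entireM _ _ (@entireX _ 2 entire_id) (@entire_cst ((4 * L ^+ 2)^-1)%:C).
  have e3 := @entireX _ n (@entireB _ _ (@entire_cst 1) e2).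
  exact: (@entireM _ _ e1 e3).
have q0 n z : L <= `|Re z| \/ L <= `|Im z| -> q n z = 0.
  by move=> /g0; rewrite /q => ->; rewrite !mul0r.
have L20 : 0 < L + L by rewrite addr_gt0.
have L1 : 0 < 4 * L ^+ 2 by rewrite mulr_gt0// exprn_gt0.
have int0 n : seg_int (fun t => Re (q n (t +i* 0))) (- L) L = 0.
  (* The lower side of the square is [-L, L] on the real axis; the other three lie where g
     vanishes. *)
  have := goursat_square (diff2_Re_Im (eq_ n)) (- L) 0 L20.
  rewrite addKr add0r.
  rewrite (_ : (fun t => - Im _ - - Im _) = (fun=> 0)); last first.
    apply/funext => t; rewrite !q0//= ?subrr//; left => /=.
      by rewrite normrN gtr0_norm.
    by rewrite gtr0_norm.
  rewrite seg_int_cst ?(ltW L20)// mul0r addr0.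
  rewrite (_ : (fun t => Re _ - Re _) = (fun t => Re (q n (t +i* 0))))//.
  apply/funext => t; rewrite [X in _ - Re X]q0 ?subr0//.
  by right => /=; rewrite gtr0_norm//; lra.
have cg : continuous (fun t => Re (g (t +i* 0) * w)).
  have e2 := entireM eg (@entire_cst w).
  move=> t; have [a [b [c [+ _]]]] := diff2_Re_Im e2 t 0.
  exact: diff2_at_continuous1.
have := concentration cg L0 _.
have -> : Re (g (0 +i* 0) * w) = Re (g 0) ^+ 2 + Im (g 0) ^+ 2.
  by rewrite -[0 +i* 0]/(0 : R[i]) /w; case: (g 0) => u v /=; ring.
move=> H; have {}H : Re (g 0) ^+ 2 + Im (g 0) ^+ 2 <= 0.
  apply: H => n; rewrite -[RHS](int0 n); congr seg_int; apply/funext => t.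
  rewrite /q; set u := g _ * w.
  rewrite (_ : 1 - _ = (1 - t ^+ 2 / (4 * L ^+ 2))%:C); last first.
    by rewrite expr2; simpc; congr (_ +i* _); rewrite ?expr2; ring.
  by rewrite -rmorphXn; case: (u) => u1 u2 /=; ring.
have /eqP : Re (g 0) ^+ 2 + Im (g 0) ^+ 2 = 0.
  by apply/eqP; rewrite eq_le H addr_ge0 ?sqr_ge0.
rewrite paddr_eq0 ?sqr_ge0// !sqrf_eq0 => /andP[/eqP h1 /eqP h2].
by case: (g 0) h1 h2 => u v /= -> ->.
Qed.

(** When |Re z| or |Im z| is large, one of c + z, c - z, c + iz, c - iz lies in the half-plane, so
    the product of the four values vanishes; at z = 0 it is g(c)^4. *)
Lemma entire_half_plane_eq0 (g : R[i] -> R[i]) : entire g ->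
  (forall z, 1 < Re z -> g z = 0) -> forall c, g c = 0.
Proof.
move=> eg g0 c.
pose h z := g (c + 1 * z) * g (c + - 1 * z) * (g (c + (0 +i* 1) * z) * g (c + (0 -i* 1) * z)).
have eh : entire h := entireM (entireM (@entire_affine g c 1 eg) (@entire_affine g c (- 1) eg))
  (entireM (@entire_affine g c (0 +i* 1) eg) (@entire_affine g c (0 -i* 1) eg)).
pose L := 2 + `|Re c|.
have L0 : 0 < L by rewrite /L ltr_wpDr.
have cL r : L <= r -> 1 < Re c + r.
  by rewrite /L; have := ler_norm (- Re c); rewrite normrN; lra.
have h0 z : L <= `|Re z| \/ L <= `|Im z| -> h z = 0.
  rewrite /h; case: z => x y /= [].
    case: (ger0P x) => x0 /cL xL.
      rewrite (g0 (c + 1 * _)) ?mul0r//; case: (c) xL => u v /= xL; simpc => /=; lra.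
    rewrite (g0 (c + - 1 * _)) ?mulr0 ?mul0r//; case: (c) xL => u v /= xL; simpc => /=; lra.
  case: (ger0P y) => y0 /cL yL.
    rewrite (g0 (c + (0 -i* 1) * _)) ?mulr0//; case: (c) yL => u v /= yL; simpc => /=; lra.
  rewrite (g0 (c + (0 +i* 1) * _)) ?mul0r ?mulr0//; case: (c) yL => u v /= yL; simpc => /=; lra.
have := entire_compact_support L0 eh h0; rewrite /h !mulr0 addr0.
by move=> /eqP; rewrite !mulf_eq0 !orbb => /eqP.
Qed.

Lemma is_complete_zeta_unique (g h : R[i] -> R[i]) :
  is_complete_zeta g -> is_complete_zeta h -> g = h.
Proof.
move=> [eg gE] [eh hE]; apply/funext => z; apply/eqP; rewrite -subr_eq0; apply/eqP.
apply: (entire_half_plane_eq0 (entireB eg eh)) => s s1.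
by rewrite gE// hE// subrr.
Qed.

End entire_uniqueness.

(** * Integrals over the real line *)

Section line_integrals.
Variable R : realType.
Let mu := @lebesgue_measure R.

Lemma is_derive_expR_scale (a y : R) : is_derive y 1 (fun z => expR (a * z)) (a * expR (a * y)).
Proof.
have d : is_derive y 1 (a \*: (id : R -> R)) (a *: (1 : R)) by exact: is_deriveZ.
have := is_derive1_comp (is_derive_expR (a * y)) d.
by rewrite [(_ *: 1 : R)]mulr1 mulrC.
Qed.

Lemma continuous_derivable (w dw : R -> R) :
  (forall y : R, is_derive y 1 w (dw y)) -> continuous w.
Proof.
move=> d y; apply: differentiable_continuous; apply/derivable1_diffP.
exact: (@ex_derive _ _ _ _ _ _ _ (d y)).
Qed.

Lemma cvg_expRN_nat (a : R) : 0 < a -> expR (- (a * n%:R)) @[n --> \oo] --> (0:R).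
Proof.
move=> a0; under eq_fun do rewrite -mulNr expRM_natr.
by apply: cvg_expr; rewrite ger0_norm ?expR_ge0// expR_lt1 oppr_lt0.
Qed.

Lemma cvg_expRNy (a : R) : 0 < a -> expR (- (a * x)) @[x --> +oo%R] --> (0:R).
Proof.
move=> a0; apply: (@cvg_comp _ _ _ (fun x : R => a * x) (fun x => expR (- x)) _ +oo%R).
  exact: (gt0_cvgMry a0 cvg_id).
exact: cvgr_expR.
Qed.

Lemma integrable_expRN_norm (a : R) : 0 < a ->
  mu.-integrable setT (fun y => (expR (- (a * `|y|)))%:E).
Proof.
move=> a0.
have c : continuous (fun y : R => expR (- (a * `|y|))).
  move=> y; apply: continuous_comp; last exact: continuous_expR.
  by apply: cvgN; apply: cvgM; [exact: cvg_cst|exact: norm_continuous].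
apply/integrableP; split.
  by apply/measurable_EFinP; exact: continuous_measurable_fun.
under eq_integral do rewrite gee0_abs ?lee_fin ?expR_ge0//.
have ev : (fun y : R => expR (- (a * `|y|))) =1 (fun y : R => expR (- (a * `|y|))) \o -%R.
  by move=> y /=; rewrite normrN.
rewrite (ge0_symfun_integralT (fun y => expR_ge0 _) c ev).
rewrite -set_itvcy.
have -> : (\int[mu]_(x in `[0%R, +oo[) (expR (- (a * `|x|)))%:E =
    \int[mu]_(x in `[0%R, +oo[) (expR (- a * x))%:E)%E.
  apply: eq_integral => y; rewrite inE/= in_itv/= andbT => y0; by rewrite ger0_norm// mulNr.
have dF (y : R) : is_derive y 1 (fun z => - a^-1 * expR (- a * z)) (expR (- a * y)).
  have := is_deriveZ (- a^-1) (is_derive_expR_scale (- a) y).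
  by rewrite [_ *: (_ : R)]mulrA mulrNN mulVf ?mul1r// gt_eqF.
rewrite (@ge0_continuous_FTC2y _ _ (fun z => - a^-1 * expR (- a * z)) 0 0).
- by rewrite -EFinB -EFinM ltry.
- by move=> x _; exact: expR_ge0.
- apply: continuous_subspaceT; apply: continuous_derivable => y; exact: is_derive_expR_scale.
- rewrite -(mulr0 (- a^-1)); apply: cvgM; first exact: cvg_cst.
  by under eq_fun do rewrite mulNr; exact: cvg_expRNy.
- by move=> x _; exact: (@ex_derive _ _ _ _ _ _ _ (dF x)).
- by apply: cvg_at_right_filter; exact: (continuous_derivable dF).
- by move=> x _; rewrite derive1E (@derive_val _ _ _ _ _ _ _ (dF x)).
Qed.

Lemma integrable_expRN_norm_le (w : R -> R) (a C : R) : 0 < a ->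
  measurable_fun setT w -> (forall y, `|w y| <= C * expR (- (a * `|y|))) ->
  mu.-integrable setT (EFin \o w).
Proof.
move=> a0 mw wC.
have := integrableZl measurableT C (integrable_expRN_norm a0).
apply: le_integrable => //; first exact/measurable_EFinP.
move=> y _ /=; rewrite lee_fin; apply: le_trans (wC y) _.
by rewrite ler_norm.
Qed.

Lemma Rintegral_dominated (w_ : nat -> R -> R) (w g : R -> R) :
  (forall n, measurable_fun setT (w_ n)) -> (forall y, w_ n y @[n --> \oo] --> w y) ->
  mu.-integrable setT (EFin \o g) -> (forall n y, `|w_ n y| <= g y) ->
  mu.-integrable setT (EFin \o w) /\
  \int[mu]_y w_ n y @[n --> \oo] --> \int[mu]_y w y.
Proof.
move=> mw ww ig wg.
have mw' : measurable_fun setT w by apply: measurable_fun_cvg => // y _; exact: ww.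
have [|||||iw _ cw] := @dominated_convergence _ _ _ mu setT measurableT
  (fun n y => (w_ n y)%:E) (EFin \o w) (EFin \o g).
- by move=> n; apply/measurable_EFinP; exact: mw.
- exact/measurable_EFinP.
- by apply/aeW => y _; apply: cvg_EFin => //; [exact: nearW|exact: ww].
- exact: ig.
- by apply/aeW => y n _; rewrite lee_fin.
split=> //; apply: fine_cvg; rewrite fineK; first exact: cw.
exact: integrable_fin_num.
Qed.

(** The form in which integration by parts is used on the line. On [-n-1, n+1] the integral is
    h(n+1) - h(-n-1), which tends to 0, and domination passes to the whole line. *)
Lemma Rintegral_derivative_eq0 (h dh : R -> R) (a C : R) : 0 < a ->
  (forall y : R, is_derive y 1 h (dh y)) -> continuous dh ->
  (forall y, `|dh y| <= C * expR (- (a * `|y|))) ->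
  (forall y, `|h y| <= C * expR (- (a * `|y|))) ->
  \int[mu]_y dh y = 0.
Proof.
move=> a0 hd cdh dhC hC.
have mdh : measurable_fun setT dh by exact: continuous_measurable_fun.
have ch := continuous_derivable hd.
pose w_ n : R -> R := dh \_ `[- n.+1%:R, n.+1%:R].
have [_] : mu.-integrable setT (EFin \o dh) /\
    \int[mu]_y w_ n y @[n --> \oo] --> \int[mu]_y dh y.
  apply: (@Rintegral_dominated _ _ (fun y => C * expR (- (a * `|y|)))).
  - move=> n; apply/(measurable_restrictT _ _).1 => //; exact: measurable_funTS.
  - move=> y; apply: cvg_near_cst.
    near=> n; rewrite /w_ patchE ifT// inE/= in_itv/= -ler_norml.
    apply: (@le_trans _ _ n%:R); last by rewrite ler_nat.
    by near: n; exact: nbhs_infty_ger.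
  - exact: (integrableZl measurableT C (integrable_expRN_norm a0)).
  - move=> n y; rewrite /w_ patchE; case: ifPn => _ //.
    by rewrite normr0; exact: le_trans (normr_ge0 _) (hC y).
have -> : (fun n => \int[mu]_y w_ n y) = (fun n => h n.+1%:R - h (- n.+1%:R)).
  apply/funext => n; rewrite /w_ -Rintegral_mkcond /Rintegral.
  rewrite (@continuous_FTC2 _ dh h)//.
  - by rewrite (@lt_trans _ _ 0)// oppr_lt0.
  - exact: continuous_subspaceT.
  - split.
    + by move=> y _; exact: (@ex_derive _ _ _ _ _ _ _ (hd y)).
    + by apply: cvg_at_right_filter; exact: ch.
    + by apply: cvg_at_left_filter; exact: ch.
  - by move=> y _; rewrite derive1E (@derive_val _ _ _ _ _ _ _ (hd y)).
move=> cv.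
have c0 : h n.+1%:R - h (- n.+1%:R) @[n --> \oo] --> (0:R).
  have hl : 2 * C * expR (- (a * n.+1%:R)) @[n --> \oo] --> (0:R).
    rewrite -(mulr0 (2 * C)); apply: cvgM; first exact: cvg_cst.
    by rewrite (cvg_shiftS (fun n => expR (- (a * n%:R)))); exact: cvg_expRN_nat.
  apply: norm_cvg0; apply: (squeeze_cvgr _ (cvg_cst 0) hl); apply: nearW => n.
  rewrite normr_ge0/=; apply: le_trans (ler_normB _ _) _.
  have := hC n.+1%:R; have := hC (- n.+1%:R).
  by rewrite normrN (ger0_norm (ler0n R n.+1)); lra.
by apply: cvg_unique cv c0; exact: Rhausdorff.
Unshelve. all: end_near. Qed.

End line_integrals.

(** * Complex-valued integrals *)

Section complex_integrals.
Variable R : realType.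
Let mu := @lebesgue_measure R.
Local Notation Re := complex.Re.
Local Notation Im := complex.Im.
Local Notation CI g := (cintegral (@lebesgue_measure R) setT g).

Lemma Re_cexp (z : R[i]) : Re (cexp z) = expR (Re z) * cos (Im z).
Proof. by rewrite /cexp /=; ring. Qed.

Lemma Im_cexp (z : R[i]) : Im (cexp z) = expR (Re z) * sin (Im z).
Proof. by rewrite /cexp /=; ring. Qed.

Lemma complex_ext (z w : R[i]) : Re z = Re w -> Im z = Im w -> z = w.
Proof. by case: z => a b; case: w => c d /= -> ->. Qed.

Lemma ReD (z w : R[i]) : Re (z + w) = Re z + Re w.
Proof. by case: z => a b; case: w. Qed.

Lemma ImD (z w : R[i]) : Im (z + w) = Im z + Im w.
Proof. by case: z => a b; case: w. Qed.

Lemma ReM (z w : R[i]) : Re (z * w) = Re z * Re w - Im z * Im w.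
Proof. by case: z => a b; case: w. Qed.

Lemma ImM (z w : R[i]) : Im (z * w) = Re z * Im w + Im z * Re w.
Proof. by case: z => a b; case: w. Qed.

Lemma ReN (z : R[i]) : Re (- z) = - Re z. Proof. by case: z. Qed.

Lemma ImN (z : R[i]) : Im (- z) = - Im z. Proof. by case: z. Qed.

Lemma cexpD (z w : R[i]) : cexp (z + w) = cexp z * cexp w.
Proof.
apply: complex_ext.
  by rewrite [RHS]ReM !Re_cexp !Im_cexp ReD ImD expRD cosD; ring.
by rewrite [RHS]ImM !Re_cexp !Im_cexp ReD ImD expRD sinD; ring.
Qed.

Lemma cexpr (x : R) : cexp x%:C = (expR x)%:C.
Proof. by apply: complex_ext; rewrite ?Re_cexp ?Im_cexp /= ?cos0 ?sin0; ring. Qed.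

Definition cintegrable (g : R -> R[i]) :=
  mu.-integrable setT (fun y => (Re (g y))%:E) /\ mu.-integrable setT (fun y => (Im (g y))%:E).

Lemma eq_cintegral (g h : R -> R[i]) : g =1 h -> CI g = CI h.
Proof. by move=> /funext ->. Qed.

Lemma cintegralD (g h : R -> R[i]) : cintegrable g -> cintegrable h ->
  CI (fun y => g y + h y) = CI g + CI h.
Proof.
move=> [g1 g2] [h1 h2]; apply: complex_ext; rewrite ?ReD ?ImD /cintegral/=.
  by rewrite -RintegralD//; apply: eq_Rintegral => y _; rewrite ReD.
by rewrite -RintegralD//; apply: eq_Rintegral => y _; rewrite ImD.
Qed.

Lemma cintegrableD (g h : R -> R[i]) : cintegrable g -> cintegrable h ->
  cintegrable (fun y => g y + h y).
Proof.
move=> [g1 g2] [h1 h2]; split.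
  by under eq_fun do rewrite ReD EFinD; exact: integrableD.
by under eq_fun do rewrite ImD EFinD; exact: integrableD.
Qed.

Lemma integrable_scale (k : R) (w : R -> R) : mu.-integrable setT (fun y => (w y)%:E) ->
  mu.-integrable setT (fun y => (k * w y)%:E).
Proof. by move=> iw; under eq_fun do rewrite EFinM; exact: integrableZl. Qed.

Lemma cintegrableZ (c : R[i]) (g : R -> R[i]) : cintegrable g ->
  cintegrable (fun y => c * g y).
Proof.
move=> [g1 g2]; split.
  under eq_fun do rewrite ReM EFinB; apply: integrableB => //; exact: integrable_scale.
under eq_fun do rewrite ImM EFinD; apply: integrableD => //; exact: integrable_scale.
Qed.

Lemma cintegralZ (c : R[i]) (g : R -> R[i]) : cintegrable g ->
  CI (fun y => c * g y) = c * CI g.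
Proof.
move=> [g1 g2]; apply: complex_ext; rewrite ?ReM ?ImM /cintegral/=.
  rewrite -!RintegralZl// -RintegralB//; try exact: integrable_scale.
  by apply: eq_Rintegral => y _; rewrite ReM.
rewrite -!RintegralZl// -RintegralD//; try exact: integrable_scale.
by apply: eq_Rintegral => y _; rewrite ImM.
Qed.

Lemma cintegralB (g h : R -> R[i]) : cintegrable g -> cintegrable h ->
  CI (fun y => g y - h y) = CI g - CI h.
Proof.
move=> ig ih.
rewrite (eq_cintegral (h := fun y => g y + -1 * h y)); last by move=> y; rewrite mulN1r.
by rewrite cintegralD ?cintegralZ ?mulN1r//; exact: cintegrableZ.
Qed.

Lemma cintegrableB (g h : R -> R[i]) : cintegrable g -> cintegrable h ->
  cintegrable (fun y => g y - h y).
Proof.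
move=> ig ih; rewrite (_ : (fun y => _) = fun y => g y + -1 * h y).
  by apply: cintegrableD => //; exact: cintegrableZ.
by apply/funext => y; rewrite mulN1r.
Qed.

Lemma normc_cintegral_le (g : R -> R[i]) (b : R -> R) : cintegrable g ->
  mu.-integrable setT (fun y => (b y)%:E) ->
  (forall y, `|Re (g y)| <= b y) -> (forall y, `|Im (g y)| <= b y) ->
  normc (CI g) <= 2 * \int[mu]_y b y.
Proof.
move=> [g1 g2] ib gb1 gb2; apply: le_trans (normc_le_ReIm _) _.
have h (w : R -> R) : mu.-integrable setT (fun y => (w y)%:E) -> (forall y, `|w y| <= b y) ->
    `|\int[mu]_y w y| <= \int[mu]_y b y.
  move=> iw wb; apply: le_trans (le_normr_Rintegral _ _) _ => //.
  by apply: le_Rintegral => //; exact: (integrable_norm iw).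
rewrite /cintegral/=.
have h1 := h _ g1 gb1; have h2 := h _ g2 gb2.
by apply: le_trans (lerD h1 h2) _; rewrite mulr_natl mulr2n.
Qed.

Lemma cintegral_derivative_eq0 (g dg : R -> R[i]) (a C : R) : 0 < a ->
  (forall y : R, is_derive y 1 (fun y => Re (g y)) (Re (dg y))) ->
  (forall y : R, is_derive y 1 (fun y => Im (g y)) (Im (dg y))) ->
  continuous (fun y => Re (dg y)) -> continuous (fun y => Im (dg y)) ->
  (forall y, normc (dg y) <= C * expR (- (a * `|y|))) ->
  (forall y, normc (g y) <= C * expR (- (a * `|y|))) ->
  CI dg = 0.
Proof.
move=> a0 d1 d2 c1 c2 dgC gC; apply: complex_ext; rewrite /cintegral/=.
  apply: (Rintegral_derivative_eq0 a0 d1 c1) => y.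
    exact: le_trans (normc_ge_Re _) (dgC y).
  exact: le_trans (normc_ge_Re _) (gC y).
apply: (Rintegral_derivative_eq0 a0 d2 c2) => y.
  exact: le_trans (normc_ge_Im _) (dgC y).
exact: le_trans (normc_ge_Im _) (gC y).
Qed.

(** This is x^s at x = e^(-y), so [laplace] is the Mellin transform on ]0, +oo[ in logarithmic
    variable. *)
Definition laplace_ker (s : R[i]) (y : R) : R[i] := cexp (- (s * y%:C)).

Lemma Re_laplace_ker s y : Re (laplace_ker s y) = expR (- (Re s * y)) * cos (Im s * y).
Proof. by rewrite Re_cexp; case: s => a b /=; rewrite !mulr0 subr0 add0r cosN. Qed.

Lemma Im_laplace_ker s y : Im (laplace_ker s y) = - (expR (- (Re s * y)) * sin (Im s * y)).
Proof. by rewrite Im_cexp; case: s => a b /=; rewrite !mulr0 subr0 add0r sinN mulrN. Qed.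

Lemma normc_laplace_ker s y : normc (laplace_ker s y) = expR (- (Re s * y)).
Proof.
have h (z : R[i]) : normc (cexp z) = expR (Re z).
  have -> : normc (cexp z) = Num.sqrt (Re (cexp z) ^+ 2 + Im (cexp z) ^+ 2).
    by case: (cexp z).
  rewrite Re_cexp Im_cexp !exprMn -mulrDr cos2Dsin2 mulr1 sqrtr_sqr ger0_norm ?expR_ge0//.
by rewrite h; case: s => a b /=; rewrite mulr0 subr0.
Qed.

Lemma is_derive_Re_laplace_ker s (y : R) : is_derive y 1 (fun y => Re (laplace_ker s y)) (Re (- s * laplace_ker s y)).
Proof.
under eq_fun do rewrite Re_laplace_ker.
have d1 := is_derive_expR_scale (- Re s) y.
have d : is_derive y 1 (Im s \*: (id : R -> R)) (Im s *: (1 : R)) by exact: is_deriveZ.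
have d2 := is_derive1_comp (is_derive_cos (Im s * y)) d.
have := is_deriveM d1 d2.
rewrite (_ : (fun z => expR (- Re s * z)) * _ = fun z => expR (- (Re s * z)) * cos (Im s * z)); last first.
  by apply/funext => z; rewrite !fctE mulNr.
move=> H; apply: (is_derive_eq H).
by rewrite ReM ReN ImN Re_laplace_ker Im_laplace_ker /GRing.scale/= !mulNr; ring.
Qed.

Lemma is_derive_Im_laplace_ker s (y : R) : is_derive y 1 (fun y => Im (laplace_ker s y)) (Im (- s * laplace_ker s y)).
Proof.
under eq_fun do rewrite Im_laplace_ker.
have d1 := is_derive_expR_scale (- Re s) y.
have d : is_derive y 1 (Im s \*: (id : R -> R)) (Im s *: (1 : R)) by exact: is_deriveZ.
have d2 := is_derive1_comp (is_derive_sin (Im s * y)) d.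
have := is_deriveN (is_deriveM d1 d2).
rewrite (_ : - ((fun z => expR (- Re s * z)) * _) = fun z => - (expR (- (Re s * z)) * sin (Im s * z))); last first.
  by apply/funext => z; rewrite !fctE mulNr.
move=> H; apply: (is_derive_eq H).
by rewrite ImM ReN ImN Re_laplace_ker Im_laplace_ker /GRing.scale/= !mulNr; ring.
Qed.

Definition laplace (w : R -> R) (s : R[i]) : R[i] := CI (fun y => (w y)%:C * laplace_ker s y).

Lemma Re_real_mul (x : R) (z : R[i]) : Re (x%:C * z) = x * Re z.
Proof. by case: z => a b /=; ring. Qed.

Lemma Im_real_mul (x : R) (z : R[i]) : Im (x%:C * z) = x * Im z.
Proof. by case: z => a b /=; ring. Qed.

Lemma normc_real_mul (x : R) (z : R[i]) : normc (x%:C * z) = `|x| * normc z.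
Proof. by rewrite normcM /= expr0n/= addr0 sqrtr_sqr. Qed.

Lemma continuous_Re_laplace_ker s : continuous (fun y => Re (laplace_ker s y)).
Proof. by apply: continuous_derivable => y; exact: is_derive_Re_laplace_ker. Qed.

Lemma continuous_Im_laplace_ker s : continuous (fun y => Im (laplace_ker s y)).
Proof. by apply: continuous_derivable => y; exact: is_derive_Im_laplace_ker. Qed.

Lemma cintegrable_laplace_ker (w : R -> R) s (a C : R) : 0 < a -> measurable_fun setT w ->
  (forall y, `|w y| * expR (- (Re s * y)) <= C * expR (- (a * `|y|))) ->
  cintegrable (fun y => (w y)%:C * laplace_ker s y).
Proof.
move=> a0 mw wC; split.
  under eq_fun do rewrite Re_real_mul.
  apply: (integrable_expRN_norm_le (C := C) a0).
    by apply: measurable_funM => //; apply: continuous_measurable_fun; exact: continuous_Re_laplace_ker.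
  move=> y; apply: le_trans (wC y); rewrite normrM -normc_laplace_ker.
  by rewrite ler_wpM2l// normc_ge_Re.
under eq_fun do rewrite Im_real_mul.
apply: (integrable_expRN_norm_le (C := C) a0).
  by apply: measurable_funM => //; apply: continuous_measurable_fun; exact: continuous_Im_laplace_ker.
move=> y; apply: le_trans (wC y); rewrite normrM -normc_laplace_ker.
by rewrite ler_wpM2l// normc_ge_Im.
Qed.

End complex_integrals.

(** * Exponential substitution and Mellin transforms *)

Section exponential_substitution.
Variable R : realType.
Let mu := @lebesgue_measure R.

(** At c = pi n^2 this is the Gaussian exponent pi n^2 x^2 with x = e^(-y). It is also the
    substitution carrying Euler's integral to the line; the factor 2 matches the argument s/2 of
    Gamma. *)
Definition scale_exp (c y : R) : R := c * expR (- 2 * y).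

Lemma scale_exp_gt0 c y : 0 < c -> 0 < scale_exp c y.
Proof. by move=> c0; rewrite mulr_gt0 ?expR_gt0. Qed.

Lemma is_derive_scale_exp c (y : R) : is_derive y 1 (scale_exp c) (- 2 * scale_exp c y).
Proof.
have := is_deriveZ c (is_derive_expR_scale (- 2) y).
by move=> H; apply: (is_derive_eq H); rewrite /scale_exp /GRing.scale/=; ring.
Qed.

Lemma continuous_scale_exp c : continuous (scale_exp c).
Proof. by apply: continuous_derivable => y; exact: is_derive_scale_exp. Qed.

Section substitution.
Variables (c : R) (g : R -> R).
Hypothesis c0 : 0 < c.
Hypothesis cg : {in `]0, +oo[, continuous g}.

Let scale_dec : {homo scale_exp c : x y /~ x < y}.
Proof. by move=> x y xy; rewrite /scale_exp ltr_pM2l// ltr_expR; lra. Qed.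

Let scale_le x y : x <= y -> scale_exp c y <= scale_exp c x.
Proof. by move=> xy; rewrite /scale_exp ler_pM2l// ler_expR; lra. Qed.

Let cg_pos x : 0 < x -> {for x, continuous g}.
Proof. by move=> x0; apply: cg; rewrite in_itv/= x0. Qed.

Let cgs : continuous (fun y => g (scale_exp c y) * (2 * scale_exp c y)).
Proof.
move=> y; apply: cvgM; last first.
  by apply: cvgM; [exact: cvg_cst|exact: continuous_scale_exp].
apply: continuous_comp; first exact: continuous_scale_exp.
by apply: cg_pos; exact: scale_exp_gt0.
Qed.

(** The substitution is made on the compact intervals [-n, n], whose images exhaust ]0, +oo[;
    monotone convergence handles both sides. *)
Lemma ge0_integral_scale_exp : (forall x, 0 < x -> 0 <= g x) ->
  (\int[mu]_(x in `]0%R, +oo[) (g x)%:E =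
   \int[mu]_y (g (scale_exp c y) * (2 * scale_exp c y))%:E)%E.
Proof.
move=> g0.
pose A (n : nat) : set R := `[scale_exp c n%:R, scale_exp c (- n%:R)]%classic.
pose B (n : nat) : set R := `[- n%:R, n%:R]%classic.
have Apos n x : A n x -> 0 < x.
  by rewrite /A/= in_itv/= => /andP[+ _]; apply: lt_le_trans; exact: scale_exp_gt0.
have EAB n : (\int[mu]_(x in A n) (g x)%:E =
    \int[mu]_(y in B n) (g (scale_exp c y) * (2 * scale_exp c y))%:E)%E.
  have dE : (scale_exp c)^`()%classic = (fun y => - 2 * scale_exp c y).
    by apply/funext => y; rewrite derive1E (@derive_val _ _ _ _ _ _ _ (is_derive_scale_exp c y)).
  have cd : continuous (fun y => - 2 * scale_exp c y).
    by move=> y; apply: cvgM; [exact: cvg_cst|exact: continuous_scale_exp].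
  rewrite /A (@integration_by_substitution_decreasing _ (scale_exp c) g (- n%:R) n%:R).
  - by apply: eq_integral => y _; rewrite dE !fctE mulNr opprK.
  - by rewrite (@le_trans _ _ 0)// oppr_le0.
  - by move=> x y _ _; exact: scale_dec.
  - by move=> y _; rewrite dE; exact: cd.
  - by rewrite dE; apply/cvg_ex; eexists; apply: cvg_at_right_filter; exact: cd.
  - by rewrite dE; apply/cvg_ex; eexists; apply: cvg_at_left_filter; exact: cd.
  - split.
    + by move=> y _; exact: (@ex_derive _ _ _ _ _ _ _ (is_derive_scale_exp c y)).
    + by apply: cvg_at_right_filter; exact: continuous_scale_exp.
    + by apply: cvg_at_left_filter; exact: continuous_scale_exp.
  - by apply: continuous_in_subspaceT => x; rewrite inE => /Apos; exact: cg_pos.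
have mgA n : measurable_fun (A n) (fun x => (g x)%:E).
  have mg : measurable_fun (`]0%R, +oo[%classic : set R) g.
    apply: open_continuous_measurable_fun; first exact: interval_open.
    by move=> x; rewrite inE/= in_itv/= andbT; exact: cg_pos.
  have sub : A n `<=` `]0%R, +oo[%classic.
    by move=> x /Apos x0; rewrite /= in_itv/= x0.
  by apply/measurable_EFinP; exact: (measurable_funS _ sub mg).
have cA : (\int[mu]_(x in A n) (g x)%:E @[n --> \oo] --> \int[mu]_(x in \bigcup_n A n) (g x)%:E)%E.
  apply: ge0_nondecreasing_set_cvg_integral => //.
  - move=> m n mn; apply/subsetPset; apply: subset_itv; rewrite bnd_simp;
      by apply: scale_le; rewrite ?lerN2 ler_nat.
  - by move=> n; exact: measurable_itv.
  - by move=> n x /Apos /g0; rewrite lee_fin.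
have cB : (\int[mu]_(y in B n) (g (scale_exp c y) * (2 * scale_exp c y))%:E @[n --> \oo] -->
    \int[mu]_(y in \bigcup_n B n) (g (scale_exp c y) * (2 * scale_exp c y))%:E)%E.
  apply: ge0_nondecreasing_set_cvg_integral => //.
  - move=> m n mn; apply/subsetPset; apply: subset_itv; rewrite bnd_simp;
      by rewrite ?lerN2 ler_nat.
  - by move=> n; exact: measurable_itv.
  - move=> n; apply/measurable_EFinP; apply: measurable_funTS.
    exact: continuous_measurable_fun.
  - move=> n y _; have s0 := scale_exp_gt0 y c0.
    by rewrite lee_fin mulr_ge0 ?g0// mulr_ge0// ltW.
have trunc_le (z : R) : `|z| <= (Num.truncn `|z|).+1%:R.
  by have /truncn_itv/andP[_ /ltW] := normr_ge0 z.
have UB : \bigcup_n B n = setT.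
  apply/seteqP; split; first by [].
  move=> z _; exists (Num.truncn `|z|).+1 => //.
  by rewrite /B/= in_itv/= -ler_norml.
have UA : \bigcup_n A n = `]0, +oo[%classic.
  apply/seteqP; split; first by move=> z [k _ zk]; rewrite /= in_itv/= (Apos k).
  move=> x; rewrite /= in_itv/= andbT => x0.
  pose y := - (ln (x / c) / 2).
  have xE : scale_exp c y = x.
    rewrite /scale_exp /y (_ : - 2 * _ = ln (x / c)); last by field.
    by rewrite lnK ?posrE ?divr_gt0// mulrC divfK// gt_eqF.
  exists (Num.truncn `|y|).+1 => //; rewrite /A/= in_itv/= -xE.
  have := trunc_le y.
  by rewrite ler_norml => /andP[h1 h2]; rewrite !scale_le.
rewrite -UA -[in RHS]UB.
have EA : (fun n => \int[mu]_(x in A n) (g x)%:E)%E =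
  (fun n => \int[mu]_(y in B n) (g (scale_exp c y) * (2 * scale_exp c y))%:E)%E by apply/funext.
by rewrite EA in cA; apply: cvg_unique cA cB; exact: ereal_hausdorff.
Qed.

End substitution.

(** Positive and negative parts are transformed separately: the weight is nonnegative and commutes
    with [Num.max]. *)
Lemma Rintegral_scale_exp c (g : R -> R) : 0 < c -> {in `]0, +oo[, continuous g} ->
  \int[mu]_(x in `]0, +oo[) g x =
  \int[mu]_y (g (scale_exp c y) * (2 * scale_exp c y)).
Proof.
move=> c0 cg; rewrite /Rintegral; congr fine.
have w0 y : 0 <= 2 * scale_exp c y by rewrite mulr_ge0// ltW// scale_exp_gt0.
have posE (h : R -> R) x : ((EFin \o h)^\+ x = (Num.max (h x) 0)%:E)%E.
  by rewrite funeposE/= EFin_max.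
have negE (h : R -> R) x : ((EFin \o h)^\- x = (Num.max (- h x) 0)%:E)%E.
  by rewrite funenegE/= EFin_max.
have cmax (h : R -> R) : {in `]0, +oo[, continuous h} ->
    {in `]0, +oo[, continuous (fun x => Num.max (h x) 0)}.
  by move=> ch x x0; apply: (@continuous_max _ _ h (cst 0)); [exact: ch|exact: cst_continuous].
have cgN : {in `]0, +oo[, continuous (fun x => - g x)}.
  by move=> x x0; apply: cvgN; exact: cg.
rewrite integralE [RHS]integralE; congr (_ - _)%E.
  under eq_integral do rewrite posE.
  under [RHS]eq_integral do rewrite posE.
  rewrite (ge0_integral_scale_exp c0 (cmax _ cg)); last by move=> x _; rewrite le_max lexx orbT.
  by apply: eq_integral => y _; rewrite maxr_pMl// mul0r.
under eq_integral do rewrite negE.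
under [RHS]eq_integral do rewrite negE.
rewrite (ge0_integral_scale_exp c0 (cmax _ cgN)); last by move=> x _; rewrite le_max lexx orbT.
by apply: eq_integral => y _; rewrite maxr_pMl// mul0r mulNr.
Qed.

End exponential_substitution.

(** * Mellin transforms of the Gaussian terms and of f(n x) *)

Section mellin.
Variable R : realType.
Let mu := @lebesgue_measure R.
Local Notation Re := complex.Re.
Local Notation Im := complex.Im.
Local Notation CI g := (cintegral (@lebesgue_measure R) setT g).

Lemma normcD (z w : R[i]) : normc (z + w) <= normc z + normc w.
Proof. by rewrite -lecR rmorphD; exact: (@ler_normD _ R[i] z w). Qed.

Lemma Re_nat n : Re (n%:R : R[i]) = n%:R.
Proof. by rewrite -(rmorph_nat (real_complex R)). Qed.

Lemma Im_nat n : Im (n%:R : R[i]) = 0.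
Proof. by rewrite -(rmorph_nat (real_complex R)). Qed.

Lemma continuous_ReZ (c : R[i]) (g : R -> R[i]) :
  continuous (fun y => Re (g y)) -> continuous (fun y => Im (g y)) ->
  continuous (fun y => Re (c * g y)).
Proof.
move=> c1 c2; under eq_fun do rewrite ReM.
move=> y; apply: cvgB; apply: cvgM; try exact: cvg_cst; [exact: c1|exact: c2].
Qed.

Lemma continuous_ImZ (c : R[i]) (g : R -> R[i]) :
  continuous (fun y => Re (g y)) -> continuous (fun y => Im (g y)) ->
  continuous (fun y => Im (c * g y)).
Proof.
move=> c1 c2; under eq_fun do rewrite ImM.
move=> y; apply: cvgD; apply: cvgM; try exact: cvg_cst; [exact: c2|exact: c1].
Qed.

Definition wexp (c : R) (j : nat) (y : R) : R :=
  scale_exp c y ^+ j * expR (- scale_exp c y).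

Lemma wexp_ge0 c j y : 0 < c -> 0 <= wexp c j y.
Proof. by move=> c0; rewrite mulr_ge0 ?expR_ge0 ?exprn_ge0// ltW ?scale_exp_gt0. Qed.

Lemma is_derive_wexp c j (y : R) :
  is_derive y 1 (wexp c j) (- (2 * j%:R) * wexp c j y + 2 * wexp c j.+1 y).
Proof. exact: is_derive_pow_expRN (is_derive_scale_exp c y). Qed.

Lemma continuous_wexp c j : continuous (wexp c j).
Proof. by apply: continuous_derivable => y; exact: is_derive_wexp. Qed.

(** With X the value of [scale_exp]: for y >= 0, X^j e^(-X) <= j! suffices. For y < 0 one has X >=
    e^(-2y), and k >= a extra powers of X supply the e^(2ky) that outweighs e^(-ay). *)
Lemma wexp_le (c : R) j (a : R) : 1 <= c -> 0 < a -> exists C,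
  forall y, `|wexp c j y| * expR (- (a * y)) <= C * expR (- (a * `|y|)).
Proof.
move=> c1 a0; have c0 : 0 < c by lra.
pose k := (Num.truncn a).+1.
have ak : a <= k%:R by have /truncn_itv/andP[_ /ltW] := ltW a0.
exists (j`!%:R + (j + k)`!%:R) => y.
rewrite ger0_norm ?wexp_ge0// mulrDl.
have X0 := scale_exp_gt0 y c0.
have e0 := expR_ge0 (- (a * `|y|)).
have [y0|y0] := ger0P y.
  apply: (@le_trans _ _ (j`!%:R * expR (- (a * y)))).
    by apply: ler_wpM2r; rewrite ?expR_ge0// exprn_expRN_le// ltW.
  by rewrite lerDl mulr_ge0 ?expR_ge0.
apply: (@le_trans _ _ ((j + k)`!%:R * expR (- (a * - y)))); last first.
  by rewrite lerDr mulr_ge0 ?expR_ge0.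
have h : wexp c j y <= (j + k)`!%:R * expR (2 * y * k%:R).
  apply: (@le_trans _ _ ((j + k)`!%:R / scale_exp c y ^+ k)).
    rewrite ler_pdivlMr ?exprn_gt0// /wexp mulrAC -exprD exprn_expRN_le//; exact: ltW.
  apply: ler_wpM2l => //; rewrite expRM_natr -exprVn lerXn2r ?nnegrE ?expR_ge0 ?invr_ge0 ?(ltW X0)//.
  rewrite -[leRHS]invrK lef_pV2 ?posrE ?invr_gt0 ?expR_gt0// -expRN /scale_exp mulNr.
  by rewrite ler_peMl ?expR_ge0.
apply: (@le_trans _ _ ((j + k)`!%:R * expR (2 * y * k%:R) * expR (- (a * y)))).
  by apply: ler_wpM2r; rewrite ?expR_ge0.
by rewrite -mulrA -expRD ler_wpM2l// ler_expR; nra.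
Qed.

Lemma cintegrable_wexp (c : R) j (s : R[i]) : 1 <= c -> 0 < Re s ->
  cintegrable (fun y => (wexp c j y)%:C * laplace_ker s y).
Proof.
move=> c1 s0; have [C wC] := wexp_le j c1 s0.
apply: (cintegrable_laplace_ker s0 _ wC).
by apply: continuous_measurable_fun; exact: continuous_wexp.
Qed.

(** With w_j for [wexp c j], the derivative of w_j e^(-sy) is 2 w_(j+1) e^(-sy) - (s + 2j) w_j
    e^(-sy), and its integral over the line is 0. *)
Lemma laplace_wexpS (c : R) j (s : R[i]) : 1 <= c -> 0 < Re s ->
  2 * laplace (wexp c j.+1) s = (s + (2 * j)%:R) * laplace (wexp c j) s.
Proof.
move=> c1 s0; apply/eqP; rewrite -subr_eq0; apply/eqP.
have i1 := cintegrable_wexp j.+1 c1 s0; have i0 := cintegrable_wexp j c1 s0.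
rewrite /laplace -!cintegralZ// -cintegralB; [|exact: cintegrableZ..].
have [C1 wC1] := wexp_le j.+1 c1 s0; have [C0 wC0] := wexp_le j c1 s0.
have e0 y := expR_ge0 (- (Re s * `|y|)).
(* A common constant for the function and its derivative; the + 1 accounts for the function. *)
pose M := 2 * `|C1| + (normc (s + (2 * j)%:R) + 1) * `|C0|.
have nw i y : normc ((wexp c i y)%:C * laplace_ker s y) = `|wexp c i y| * expR (- (Re s * y)).
  by rewrite normc_real_mul normc_laplace_ker.
have up (C' x y : R) : x <= C' * expR (- (Re s * `|y|)) -> x <= `|C'| * expR (- (Re s * `|y|)).
  by move=> h; apply: (le_trans h); rewrite ler_wpM2r// ler_norm.
have cR i : continuous (fun y => Re ((wexp c i y)%:C * laplace_ker s y)).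
  move=> y; under eq_fun do rewrite Re_real_mul.
  by apply: cvgM; [exact: continuous_wexp|exact: continuous_Re_laplace_ker].
have cI i : continuous (fun y => Im ((wexp c i y)%:C * laplace_ker s y)).
  move=> y; under eq_fun do rewrite Im_real_mul.
  by apply: cvgM; [exact: continuous_wexp|exact: continuous_Im_laplace_ker].
apply: (@cintegral_derivative_eq0 _ (fun y => (wexp c j y)%:C * laplace_ker s y) _ (Re s) M s0).
- move=> y; have := is_deriveM (is_derive_wexp c j y) (is_derive_Re_laplace_ker s y).
  rewrite (_ : wexp c j * _ = fun z => Re ((wexp c j z)%:C * laplace_ker s z)); last first.
    by apply/funext => z; rewrite Re_real_mul.
  move=> H; apply: (is_derive_eq H).
  rewrite ReD ReN [Re (2 * _)]ReM [Re ((s + _) * _)]ReM [Re (- s * _)]ReM !Re_real_mul !Im_real_mul.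
  rewrite (Re_nat 2) (Im_nat 2) [Re (s + _)]ReD [Im (s + _)]ImD Re_nat Im_nat ReN ImN /GRing.scale/=.
  by rewrite natrM; ring.
- move=> y; have := is_deriveM (is_derive_wexp c j y) (is_derive_Im_laplace_ker s y).
  rewrite (_ : wexp c j * _ = fun z => Im ((wexp c j z)%:C * laplace_ker s z)); last first.
    by apply/funext => z; rewrite Im_real_mul.
  move=> H; apply: (is_derive_eq H).
  rewrite ImD ImN [Im (2 * _)]ImM [Im ((s + _) * _)]ImM [Im (- s * _)]ImM !Re_real_mul !Im_real_mul.
  rewrite (Re_nat 2) (Im_nat 2) [Re (s + _)]ReD [Im (s + _)]ImD Re_nat Im_nat ReN ImN /GRing.scale/=.
  by rewrite natrM; ring.
- under eq_fun do rewrite ReD ReN; move=> y; apply: cvgB; exact: continuous_ReZ.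
- under eq_fun do rewrite ImD ImN; move=> y; apply: cvgB; exact: continuous_ImZ.
- move=> y; apply: le_trans (normcD _ _) _; rewrite normc_opp [normc (2 * _)]normcM [normc ((s + _) * _)]normcM.
  have n2 : normc (2 : R[i]) = 2.
    by rewrite -(rmorph_nat (real_complex R)) /= expr0n/= addr0 sqrtr_sqr ger0_norm.
  have h1 : normc ((wexp c j.+1 y)%:C * laplace_ker s y) <= `|C1| * expR (- (Re s * `|y|)).
    by rewrite nw; exact: up (wC1 y).
  have h0 : normc ((wexp c j y)%:C * laplace_ker s y) <= `|C0| * expR (- (Re s * `|y|)).
    by rewrite nw; exact: up (wC0 y).
  rewrite n2 /M [leRHS]mulrDl; apply: lerD; rewrite -[leRHS]mulrA.
    by rewrite ler_wpM2l.
  apply: ler_pM => //; rewrite ?normc_ge0 ?mulr_ge0 ?normc_ge0//.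
  by rewrite lerDl.
- move=> y; rewrite nw; apply: (le_trans (up _ _ _ (wC0 y))).
  rewrite ler_wpM2r// /M -[leLHS]mul1r -[leLHS]add0r.
  by rewrite lerD ?mulr_ge0// ler_wpM2r// lerDr normc_ge0.
Qed.

Definition gauss_scale (n : nat) : R := pi * n.+1%:R ^+ 2.

Lemma gauss_scale_ge1 n : 1 <= gauss_scale n.
Proof.
rewrite /gauss_scale -[leLHS](mulr1 1); apply: ler_pM => //; first exact: pi_ge1.
by rewrite exprn_ege1// ler1n.
Qed.

Lemma f_wexp n y : f (n.+1%:R * expR (- y)) = 4 * wexp (gauss_scale n) 2 y - 6 * wexp (gauss_scale n) 1 y.
Proof.
rewrite /f /wexp (_ : scale_exp (gauss_scale n) y = pi * (n.+1%:R * expR (- y)) ^+ 2); first by ring.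
rewrite /scale_exp /gauss_scale exprMn -expRM_natr (_ : - y * 2 = - 2 * y); last by ring.
ring.
Qed.

Lemma cintegrable_f n (s : R[i]) : 0 < Re s ->
  cintegrable (fun y => (f (n.+1%:R * expR (- y)))%:C * laplace_ker s y).
Proof.
move=> s0; have c1 := gauss_scale_ge1 n.
rewrite (_ : (fun y => _) = fun y => 4 * ((wexp (gauss_scale n) 2 y)%:C * laplace_ker s y) -
    6 * ((wexp (gauss_scale n) 1 y)%:C * laplace_ker s y)).
  by apply: cintegrableB; apply: cintegrableZ; exact: cintegrable_wexp.
apply/funext => y; rewrite f_wexp rmorphB !rmorphM /= !rmorph_nat; ring.
Qed.

(** With L_j the transform of [wexp] of order j: 4 L_2 - 6 L_1 = (2(s + 2) - 6) L_1 = 2(s - 1) L_1 =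
    s(s - 1) L_0. The coefficients of f are those that produce s(s - 1). *)
Lemma laplace_f n (s : R[i]) : 0 < Re s ->
  laplace (fun y => f (n.+1%:R * expR (- y))) s = s * (s - 1) * laplace (wexp (gauss_scale n) 0) s.
Proof.
move=> s0; have c1 := gauss_scale_ge1 n.
have E : laplace (fun y => f (n.+1%:R * expR (- y))) s =
    4 * laplace (wexp (gauss_scale n) 2) s - 6 * laplace (wexp (gauss_scale n) 1) s.
  rewrite /laplace -!cintegralZ; [|exact: cintegrable_wexp..].
  rewrite -cintegralB; [|apply: cintegrableZ; exact: cintegrable_wexp..].
  apply: eq_cintegral => y; rewrite f_wexp rmorphB !rmorphM /= !rmorph_nat; ring.
have E1 := laplace_wexpS 1 c1 s0; have E0 := laplace_wexpS 0 c1 s0.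
rewrite muln0 addr0 in E0; rewrite muln1 in E1.
rewrite E (_ : 4 * _ = 2 * (2 * laplace (wexp (gauss_scale n) 2) s)); last by ring.
rewrite E1 (_ : _ - _ = (s - 1) * (2 * laplace (wexp (gauss_scale n) 1) s)); last by ring.
by rewrite E0; ring.
Qed.

(** Under x = c e^(-2y) the measure dx/x becomes 2 dy and x^(s/2) becomes c^(s/2) e^(-sy). The scale
    c is free, so that each term of the zeta series can take its own. *)
Lemma Gamma_laplace (c : R) (s : R[i]) : 1 <= c -> 0 < Re s ->
  Gamma_half_plane (s / 2) = 2 * cexp (s / 2 * (ln c)%:C) * laplace (wexp c 0) s.
Proof.
move=> c1 s0; have c0 : 0 < c by lra.
have lnR x (z : R[i]) : Re (z * (ln x)%:C) = Re z * ln x.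
  by rewrite ReM /= mulr0 subr0.
have lnI x (z : R[i]) : Im (z * (ln x)%:C) = Im z * ln x.
  by rewrite ImM /= mulr0 add0r.
pose g x := cpowR x (s / 2 - 1) * (expR (- x))%:C.
have ReE x : Re (g x) = expR (Re (s / 2 - 1) * ln x) * cos (Im (s / 2 - 1) * ln x) * expR (- x).
  by rewrite /g mulrC Re_real_mul Re_cexp lnR lnI mulrC.
have ImE x : Im (g x) = expR (Re (s / 2 - 1) * ln x) * sin (Im (s / 2 - 1) * ln x) * expR (- x).
  by rewrite /g mulrC Im_real_mul Im_cexp lnR lnI mulrC.
have cln (k x : R) : 0 < x -> (k * ln y @[y --> x] --> k * ln x).
  by move=> x0; apply: cvgM; [exact: cvg_cst|exact: continuous_ln].
have cexpN (x : R) : expR (- y) @[y --> x] --> expR (- x).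
  apply: (@continuous_comp _ _ _ (fun z : R => - z) expR x); last exact: continuous_expR.
  exact: opp_continuous.
have cR : {in `]0, +oo[, continuous (fun x => Re (g x))}.
  move=> x; rewrite in_itv/= andbT => x0; rewrite (funext ReE).
  rewrite /prop_for /continuous_at; apply: cvgM; last exact: cexpN.
  apply: cvgM.
    by apply: continuous_cvg; [exact: continuous_expR|exact: cln].
  by apply: continuous_cvg; [exact: continuous_cos|exact: cln].
have cI : {in `]0, +oo[, continuous (fun x => Im (g x))}.
  move=> x; rewrite in_itv/= andbT => x0; rewrite (funext ImE).
  rewrite /prop_for /continuous_at; apply: cvgM; last exact: cexpN.
  apply: cvgM.
    by apply: continuous_cvg; [exact: continuous_expR|exact: cln].
  by apply: continuous_cvg; [exact: continuous_sin|exact: cln].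
have key y : (2 * scale_exp c y)%:C * g (scale_exp c y) =
    2 * cexp (s / 2 * (ln c)%:C) * ((wexp c 0 y)%:C * laplace_ker s y).
  have X0 := scale_exp_gt0 y c0.
  have lnX : ln (scale_exp c y) = ln c - 2 * y.
    by rewrite /scale_exp lnM ?posrE ?expR_gt0// expRK mulNr.
  rewrite /g /wexp expr0 mul1r /laplace_ker /cpowR.
  rewrite [in (2 * _)%:C](_ : scale_exp c y = expR (ln (scale_exp c y))); last by rewrite lnK.
  rewrite rmorphM rmorph_nat/= -cexpr.
  rewrite (_ : 2 * cexp (ln (scale_exp c y))%:C * _ =
     2 * (cexp (ln (scale_exp c y))%:C * cexp ((s / 2 - 1) * (ln (scale_exp c y))%:C)) *
     (expR (- scale_exp c y))%:C); last by ring.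
  rewrite -cexpD [RHS]mulrCA [RHS]mulrC -[X in _ = X * _]mulrA -cexpD; congr (2 * cexp _ * _).
  by rewrite lnX rmorphB rmorphM rmorph_nat/=; field.
have i0 := cintegrable_wexp 0 c1 s0.
transitivity (CI (fun y => (2 * scale_exp c y)%:C * g (scale_exp c y))); last first.
  by rewrite (eq_cintegral key); exact: cintegralZ.
rewrite /Gamma_half_plane /cintegral; congr (_ +i* _).
  rewrite (Rintegral_scale_exp c0 cR); apply: eq_Rintegral => y _.
  by rewrite [RHS]Re_real_mul mulrC.
rewrite (Rintegral_scale_exp c0 cI); apply: eq_Rintegral => y _.
by rewrite [RHS]Im_real_mul mulrC.
Qed.

(** At c = pi n^2, n counted from 1, the powers cancel: pi^(-s/2) c^(s/2) n^(-s) = 1. *)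
Lemma xi_term n (s : R[i]) : 0 < Re s ->
  s * (s - 1) * cpowR pi (- (s / 2)) * Gamma_half_plane (s / 2) * cpowR n.+1%:R (- s) =
  2 * laplace (fun y => f (n.+1%:R * expR (- y))) s.
Proof.
move=> s0; rewrite laplace_f// (Gamma_laplace (gauss_scale_ge1 n) s0).
have E : cpowR pi (- (s / 2)) * cexp (s / 2 * (ln (gauss_scale n))%:C) * cpowR n.+1%:R (- s) = 1.
  rewrite /cpowR -!cexpD (_ : _ + _ = (0 : R)%:C) ?cexpr ?expR0//.
  rewrite /gauss_scale lnM ?posrE ?pi_gt0 ?exprn_gt0// lnXn// rmorphD rmorphMn/=.
  by rewrite mulr2n; field.
rewrite -[RHS]mulr1 -[X in _ = _ * X]E; ring.
Qed.

End mellin.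

(** * Entire Laplace transforms *)

Section entire_laplace.
Variable R : realType.
Let mu := @lebesgue_measure R.
Local Notation Re := complex.Re.
Local Notation Im := complex.Im.
Local Notation CI g := (cintegral (@lebesgue_measure R) setT g).

Lemma norm_expRB1 (a : R) : `|expR a - 1| <= `|a| * expR `|a|.
Proof.
have h1 := expR_ge1Dx a; have h2 := expR_ge1Dx (- a).
have E : expR a * expR (- a) = 1 by rewrite -expRD subrr expR0.
have e0 := expR_gt0 a.
have [a0|a0] := ger0P a.
  by rewrite ger0_norm; nra.
have e1 : 1 <= expR (- a) by lra.
by rewrite ltr0_norm ?subr_lt0 ?expR_lt1//; nra.
Qed.

Lemma norm_expRB1B (a : R) : `|expR a - 1 - a| <= a ^+ 2 * expR `|a|.
Proof.
have h1 := expR_ge1Dx a; have h2 := expR_ge1Dx (- a).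
have E : expR a * expR (- a) = 1 by rewrite -expRD subrr expR0.
have e0 := expR_gt0 a.
rewrite ger0_norm; last lra.
apply: (@le_trans _ _ (a * (expR a - 1))); first by nra.
apply: (le_trans (ler_norm _)); rewrite normrM -real_normK ?num_real// expr2 -mulrA.
by rewrite ler_wpM2l// norm_expRB1.
Qed.

Lemma norm_sin_le (b : R) : `|sin b| <= `|b|.
Proof.
have pos (x : R) : 0 <= x -> `|sin x| <= x.
  move=> x0; have [xpi|xpi] := lerP x pi.
    by rewrite ger0_norm ?sin_le// sin_ge0_pi// x0.
  by rewrite (le_trans (sin_max _))//; have := pi_ge1 R; lra.
have [b0|b0] := ger0P b; first exact: pos.
by rewrite -normrN -sinN pos//; lra.
Qed.

Lemma norm_1Bcos (b : R) : 0 <= 1 - cos b <= b ^+ 2 /\ 1 - cos b <= `|b|.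
Proof.
have E : 1 - cos b = 2 * sin (b / 2) ^+ 2.
  by rewrite {1}(_ : b = (b / 2) *+ 2) ?cos_mulr2n ?cos2sin2; lra.
have h := norm_sin_le (b / 2); have h1 := sin_max (b / 2).
rewrite normrM (@ger0_norm _ 2^-1) ?invr_ge0// in h.
rewrite E -(real_normK (num_real (sin _))) -(real_normK (num_real b)).
have s0 := normr_ge0 (sin (b / 2)); have b0 := normr_ge0 b.
by split; [apply/andP; split|]; nra.
Qed.

Lemma norm_sinB (b : R) : `|sin b - b| <= b ^+ 2.
Proof.
have pos (x : R) : 0 <= x -> `|sin x - x| <= x ^+ 2.
  move=> x0; have [|c] := @MVT_segment _ (@sin R) (@cos R) 0 x x0.
    by apply: continuous_subspaceT; exact: continuous_sin.
  rewrite in_itv/= sin0 !subr0 => /andP[c0 cx] ->.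
  have [/andP[h1 _] h3] := norm_1Bcos c; rewrite ger0_norm// in h3.
  by rewrite ler0_norm; nra.
have [b0|b0] := ger0P b; first exact: pos.
have := pos (- b); rewrite sinN -opprD normrN sqrrN; apply; lra.
Qed.

Lemma normc_cexpB1B (z : R[i]) : normc (cexp z - 1 - z) <= 4 * normc z ^+ 2 * expR (normc z).
Proof.
set r := normc z; have ra := normc_ge_Re z; have rb := normc_ge_Im z.
apply: le_trans (normc_le_ReIm _) _.
rewrite !(ReD, ReN, ImD, ImN) Re_cexp Im_cexp -/r in ra rb *.
move: (Re z) (Im z) ra rb => a b ra rb /=.
have er : expR `|a| <= expR r by rewrite ler_expR.
have ea : expR a <= expR r by rewrite ler_expR (le_trans _ ra)// ler_norm.
have e0 := expR_gt0 a; have e1 := expR_gt0 r.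
have a2 : a ^+ 2 <= r ^+ 2.
  by rewrite -(real_normK (num_real a)) lerXn2r ?nnegrE// (le_trans _ ra).
have b2 : b ^+ 2 <= r ^+ 2.
  by rewrite -(real_normK (num_real b)) lerXn2r ?nnegrE// (le_trans _ rb).
have h1 : `|expR a * cos b - 1 - a| <= 2 * r ^+ 2 * expR r.
  rewrite (_ : _ - _ = (expR a - 1 - a) - expR a * (1 - cos b)); last by ring.
  apply: le_trans (ler_normB _ _) _.
  have [/andP[c0 c1] _] := norm_1Bcos b.
  rewrite (ger0_norm (mulr_ge0 (ltW e0) c0)).
  have k1 : `|expR a - 1 - a| <= r ^+ 2 * expR r.
    by apply: le_trans (norm_expRB1B a) _; apply: ler_pM; rewrite ?sqr_ge0 ?expR_ge0.
  have k2 : expR a * (1 - cos b) <= expR r * r ^+ 2.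
    by apply: ler_pM; rewrite ?expR_ge0//; exact: le_trans c1 b2.
  by lra.
have h2 : `|expR a * sin b - b| <= 2 * r ^+ 2 * expR r.
  rewrite (_ : _ - _ = expR a * (sin b - b) + b * (expR a - 1)); last by ring.
  apply: le_trans (ler_normD _ _) _; rewrite !normrM (ger0_norm (ltW e0)).
  have k1 : expR a * `|sin b - b| <= expR r * r ^+ 2.
    by apply: ler_pM; rewrite ?expR_ge0//; exact: le_trans (norm_sinB b) b2.
  have k2 : `|b| * `|expR a - 1| <= r * (r * expR r).
    apply: ler_pM => //; apply: le_trans (norm_expRB1 a) _.
    by apply: ler_pM; rewrite ?expR_ge0.
  by rewrite expr2 in k1 *; lra.
by rewrite oppr0 !addr0; lra.
Qed.

(** Decay against every exponential makes the transform converge at each s. The class is stable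
    under multiplication by y, that is, under differentiation of the transform. *)
Definition superexp (w : R -> R) := measurable_fun setT w /\
  forall a : R, exists C, forall y, `|w y| <= C * expR (- (a * `|y|)).

Lemma superexp_bound w s : superexp w ->
  exists C, forall y, `|w y| * expR (- (Re s * y)) <= C * expR (- (1 * `|y|)).
Proof.
move=> [_ /(_ (`|Re s| + 1))[C wC]]; exists C => y.
apply: (@le_trans _ _ (C * expR (- ((`|Re s| + 1) * `|y|)) * expR (`|Re s| * `|y|))).
  apply: ler_pM => //; rewrite ?expR_ge0// ler_expR -normrM.
  by rewrite -normrN ler_norm.
by rewrite -mulrA -expRD; have -> : - ((`|Re s| + 1) * `|y|) + `|Re s| * `|y| = - (1 * `|y|) by ring.
Qed.

Lemma superexp_cintegrable w s : superexp w -> cintegrable (fun y => (w y)%:C * laplace_ker s y).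
Proof.
move=> sw; have [C wC] := superexp_bound s sw.
by apply: (cintegrable_laplace_ker ltr01 _ wC); case: sw.
Qed.

Lemma superexp_mul_id w : superexp w -> superexp (fun y => y * w y).
Proof.
move=> [mw wC]; split; first exact: measurable_funM.
move=> a; have [C hC] := wC (a + 1); exists C => y.
rewrite normrM; apply: (@le_trans _ _ (expR `|y| * (C * expR (- ((a + 1) * `|y|))))).
  by apply: ler_pM => //; have := expR_ge1Dx `|y|; lra.
by rewrite mulrCA -expRD; have -> : `|y| + - ((a + 1) * `|y|) = - (a * `|y|) by ring.
Qed.

Lemma laplace_kerD (s h : R[i]) y : laplace_ker (h + s) y = laplace_ker s y * laplace_ker h y.
Proof. by rewrite /laplace_ker -cexpD; congr cexp; ring. Qed.

Lemma entire_laplace w : superexp w -> entire (laplace w).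
Proof.
move=> sw s; have sw1 := superexp_mul_id sw.
have [C wC] := superexp_bound s (superexp_mul_id sw1).
(* The rate |Re s| + 3 pays for e^(|Re s| |y|), for y^2 <= 2 e^|y| and for e^(|h y|) with |h| <= 1,
   and leaves e^(-|y|). The 8 in [D] is this 2 times the 4 of [normc_cexpB1B]. *)
have [_ wdec] := sw; have [C1 hC1] := wdec (`|Re s| + 3).
pose D := 8 * `|C1|.
have D0 : 0 <= D by rewrite mulr_ge0.
pose I := 2 * \int[mu]_y (D * expR (- (1 * `|y|))).
have ib : mu.-integrable setT (fun y => (D * expR (- (1 * `|y|)))%:E).
  by apply: integrable_scale; exact: integrable_expRN_norm.
have key h : normc h <= 1 ->
    normc (laplace w (h + s) - laplace w s - h * - laplace (fun y => y * w y) s) <=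
    normc h ^+ 2 * I.
  move=> h1; have i1 := superexp_cintegrable (h + s) sw.
  have i2 := superexp_cintegrable s sw; have i3 := superexp_cintegrable s sw1.
  pose q y := (w y)%:C * laplace_ker (h + s) y - (w y)%:C * laplace_ker s y -
    - h * ((y * w y)%:C * laplace_ker s y).
  have iq : cintegrable q.
    by apply: cintegrableB; [exact: cintegrableB|exact: cintegrableZ].
  rewrite (_ : _ - _ - _ = CI q); last first.
    rewrite /q cintegralB; [|exact: cintegrableB|exact: cintegrableZ].
    by rewrite cintegralB// cintegralZ// mulrN mulNr.
  have qE y : q y = (w y)%:C * laplace_ker s y * (cexp (- (h * y%:C)) - 1 - (- (h * y%:C))).
    by rewrite /q laplace_kerD /laplace_ker rmorphM; ring.
  have qb y : normc (q y) <= normc h ^+ 2 * (D * expR (- (1 * `|y|))).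
    rewrite qE [normc (_ * _)]normcM normc_real_mul normc_laplace_ker.
    set z := - (h * y%:C).
    have nz : normc z = normc h * `|y|.
      by rewrite normc_opp mulrC normc_real_mul mulrC.
    apply: (@le_trans _ _ (`|C1| * expR (- ((`|Re s| + 3) * `|y|)) * expR (`|Re s| * `|y|) *
       (4 * (normc h ^+ 2 * (2 * expR `|y|)) * expR `|y|))).
      apply: ler_pM; rewrite ?mulr_ge0 ?expR_ge0 ?normc_ge0//.
        apply: ler_pM; rewrite ?expR_ge0//.
          by apply: le_trans (hC1 y) _; rewrite ler_wpM2r ?expR_ge0// ler_norm.
        by rewrite ler_expR -normrM -normrN ler_norm.
      apply: le_trans (normc_cexpB1B _) _; rewrite nz.
      apply: ler_pM; rewrite ?expR_ge0 ?mulr_ge0 ?sqr_ge0 ?normc_ge0//.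
        apply: ler_wpM2l => //; rewrite exprMn; apply: ler_wpM2l; first exact: sqr_ge0.
        exact: (@exprn_le_expR _ `|y| 2).
      by rewrite ler_expR ler_piMl.
    rewrite [leLHS](_ : _ = normc h ^+ 2 * (D * (expR (- ((`|Re s| + 3) * `|y|)) *
      expR (`|Re s| * `|y|) * expR `|y| * expR `|y|))); last by rewrite /D; ring.
    rewrite -!expRD.
    by have -> : - ((`|Re s| + 3) * `|y|) + `|Re s| * `|y| + `|y| + `|y| = - (1 * `|y|) by ring.
  have := normc_cintegral_le iq (integrable_scale (normc h ^+ 2) ib)
     (fun y => le_trans (normc_ge_Re _) (qb y)) (fun y => le_trans (normc_ge_Im _) (qb y)).
  by rewrite RintegralZl// mulrCA.
have I0 : 0 <= I.
  by rewrite mulr_ge0// Rintegral_ge0// => y _; rewrite mulr_ge0 ?expR_ge0.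
apply: (@derivable_complexP _ _ _ (- laplace (fun y => y * w y) s)) => e e0.
have I1 : 0 < I + 1 by lra.
exists (Num.min 1 (e / (I + 1))); first by rewrite lt_min ltr01 divr_gt0.
move=> h; rewrite le_min => /andP[h1 h2]; apply: le_trans (key h h1) _.
rewrite expr2 -mulrA mulrC ler_wpM2r ?normc_ge0//.
rewrite ler_pdivlMr// in h2; have := normc_ge0 h; nra.
Qed.

End entire_laplace.

(** * The complete zeta function as a Laplace transform *)

Section complete_zeta.
Variable R : realType.
Let mu := @lebesgue_measure R.
Local Notation Re := complex.Re.
Local Notation Im := complex.Im.

Lemma cvg_complex (u : nat -> R[i]) (l : R[i]) :
  Re (u n) @[n --> \oo] --> Re l -> Im (u n) @[n --> \oo] --> Im l ->
  (u : (R[i]^o)^nat) @ \oo --> (l : R[i]^o).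
Proof.
move=> uR uI; apply/cvgrPdist_le => -[e ei].
rewrite ltcE/= => /andP[/eqP -> e0]; have e2 : 0 < e / 2 by rewrite divr_gt0.
move/cvgrPdist_le : uR => /(_ _ e2) uR; move/cvgrPdist_le : uI => /(_ _ e2) uI.
near=> n; rewrite normCE lecR; apply: le_trans (normc_le_ReIm _) _.
rewrite ReD ImD ReN ImN.
have h1 : `|Re l - Re (u n)| <= e / 2 by near: n.
have h2 : `|Im l - Im (u n)| <= e / 2 by near: n.
lra.
Unshelve. all: end_near. Qed.

Lemma Re_series (u : nat -> R[i]) n : Re (series u n) = series (fun k => Re (u k)) n.
Proof. by rewrite /series/= (big_morph (@complex.Re R) (@ReD R) (erefl _)). Qed.

Lemma Im_series (u : nat -> R[i]) n : Im (series u n) = series (fun k => Im (u k)) n.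
Proof. by rewrite /series/= (big_morph (@complex.Im R) (@ImD R) (erefl _)). Qed.

(** Telescoping in place of the integral test: with b = s - 1 and t_n = (n+1)^(-b), one has
    (n+2)^(-s) <= (t_n - t_(n+1)) / b. *)
Lemma is_cvg_series_expRN_ln (s : R) : 1 < s ->
  cvgn (series (fun n => expR (- (s * ln n.+1%:R)))).
Proof.
move=> s1; pose b := s - 1; have b0 : 0 < b by rewrite subr_gt0.
pose t n : R := expR (- (b * ln n.+1%:R)).
have step n : expR (- (s * ln n.+2%:R)) <= b^-1 * (t n - t n.+1).
  rewrite -(ler_pM2l b0) mulrA mulfV ?gt_eqF// mul1r.
  have n1 : 0 < n.+1%:R :> R by [].
  have n2 : 0 < n.+2%:R :> R by [].
  have lnr : n.+2%:R^-1 <= ln n.+2%:R - ln n.+1%:R :> R.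
    have := expR_ge1Dx (ln n.+1%:R - ln n.+2%:R : R).
    rewrite expRB !lnK ?posrE// -(natr1 n.+1) in n2 * => h.
    have E : n.+1%:R / (n.+1%:R + 1) = 1 - (n.+1%:R + 1)^-1 :> R.
      by field; rewrite gt_eqF.
    by rewrite E in h; lra.
  have -> : expR (- (s * ln n.+2%:R)) = t n.+1 * n.+2%:R^-1.
    rewrite -{2}(@lnK _ n.+2%:R) ?posrE// -expRN -expRD; congr expR; rewrite /b; ring.
  have -> : t n = t n.+1 * expR (b * (ln n.+2%:R - ln n.+1%:R)).
    by rewrite -expRD; congr expR; ring.
  have h := expR_ge1Dx (b * (ln n.+2%:R - ln n.+1%:R)).
  have t0 : 0 <= t n.+1 := expR_ge0 _.
  apply: (@le_trans _ _ (t n.+1 * (b * (ln n.+2%:R - ln n.+1%:R)))).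
    rewrite mulrCA ler_wpM2l// ler_pM2l//.
  by rewrite -{3}(mulr1 (t n.+1)) -mulrBr ler_wpM2l//; lra.
apply: nondecreasing_is_cvgn.
  by apply: nondecreasing_series => k _ _; exact: expR_ge0.
exists (1 + b^-1) => _ [n _ <-].
suff h m : series (fun n => expR (- (s * ln n.+1%:R))) m.+1 <= 1 + b^-1 * (1 - t m).
  case: n => [|n].
    by rewrite /series/= big_geq// addr_ge0// invr_ge0 ltW.
  apply: (le_trans (h n)); rewrite lerD2l ler_piMr ?invr_ge0 ?(ltW b0)//.
  by rewrite gerBl expR_ge0.
elim: m => [|m IH].
  by rewrite /series/= big_nat1 ln1 mulr0 oppr0 expR0 /t ln1 mulr0 oppr0 expR0 subrr mulr0 addr0.
rewrite /series/= big_nat_recr//=.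
apply: le_trans (lerD IH (step m)) _.
by rewrite -addrA -mulrDr addrA subrK.
Qed.

Lemma cvg_zeta (s : R[i]) : 1 < Re s -> exists z : R[i],
  [/\ zeta_half_plane s = z,
    Re (series (fun n => cpowR n.+1%:R (- s)) n) @[n --> \oo] --> Re z &
    Im (series (fun n => cpowR n.+1%:R (- s)) n) @[n --> \oo] --> Im z].
Proof.
move=> s1; pose a n : R[i] := cpowR n.+1%:R (- s).
have na n : normc (a n) = expR (- (Re s * ln n.+1%:R)).
  by rewrite -(normc_laplace_ker s (ln n.+1%:R)) /laplace_ker -mulNr.
have cR : cvgn (series (fun n => Re (a n))).
  apply: is_cvg_series_le (is_cvg_series_expRN_ln s1) => k.
  by rewrite -na; exact: normc_ge_Re.
have cI : cvgn (series (fun n => Im (a n))).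
  apply: is_cvg_series_le (is_cvg_series_expRN_ln s1) => k.
  by rewrite -na; exact: normc_ge_Im.
pose z := limn (series (fun n => Re (a n))) +i* limn (series (fun n => Im (a n))); exists z.
have hR : Re (series a n) @[n --> \oo] --> limn (series (fun n => Re (a n))).
  by rewrite (funext (Re_series a)).
have hI : Im (series a n) @[n --> \oo] --> limn (series (fun n => Im (a n))).
  by rewrite (funext (Im_series a)).
split => //.
exact: (@cvg_lim (R[i]^o) (@norm_hausdorff _ (R[i]^o)) _ _ _ _ _ (@cvg_complex (series a) z hR hI)).
Qed.

Definition xi_density (y : R) : R := fsum (expR (- y)).

Lemma norm_fsum_le K : exists2 C : R, 0 <= C &
  forall x : R, 0 < x -> `|fsum x| <= C / x ^+ K.+1.
Proof.
have [C C0 hC] := sum_norm_f_le R K; exists C => // x x0.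
have cv := is_cvg_series_norm_f x0.
apply: (le_trans (lim_series_norm cv)).
by apply: limr_le => //; apply: nearW => n; exact: hC.
Qed.

(** For y < 0 the bound C / x^(K+1) at x = e^(-y) > 1 suffices. For y >= 0, [fsum_inv] moves the
    argument to e^y at the cost of a factor e^y, which uses up the extra power. *)
Lemma xi_density_bound K : exists2 C : R, 0 <= C &
  forall y, `|xi_density y| <= C * expR (- (K%:R * `|y|)).
Proof.
have [C C0 hC] := norm_fsum_le K; exists C => // y.
have inv_exp (z : R) : C / expR (- z) ^+ K.+1 = C * expR (K.+1%:R * z).
  by rewrite -expRM_natr -expRN; congr (_ * expR _); ring.
rewrite /xi_density; have [y0|y0] := ger0P y.
  have -> : fsum (expR (- y)) = expR y * fsum (expR y).
    by rewrite (fsum_inv y) mulrA -expRD subrr expR0 mul1r.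
  rewrite normrM (ger0_norm (expR_ge0 _)).
  apply: (@le_trans _ _ (expR y * (C / expR y ^+ K.+1))).
    by rewrite ler_wpM2l ?expR_ge0// hC ?expR_gt0.
  rewrite -{2}(opprK y) inv_exp mulrCA -expRD ler_wpM2l// ler_expR -natr1; nra.
apply: (le_trans (hC _ (expR_gt0 _))); rewrite inv_exp ler_wpM2l// ler_expR -natr1; nra.
Qed.

Lemma continuous_f_expR k : continuous (fun y : R => f (k.+1%:R * expR (- y))).
Proof.
have -> : (fun y : R => f (k.+1%:R * expR (- y))) =
    (fun y => 4 * wexp (gauss_scale R k) 2 y - 6 * wexp (gauss_scale R k) 1 y).
  by apply/funext => y; exact: f_wexp.
by move=> y; apply: cvgB; apply: cvgM; [exact: cvg_cst|exact: continuous_wexp|exact: cvg_cst|exact: continuous_wexp].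
Qed.

Lemma measurable_partial_f n :
  measurable_fun setT (fun y : R => series (fun k => f (k.+1%:R * expR (- y))) n).
Proof.
elim: n => [|n IH].
  rewrite (_ : (fun y => _) = fun=> 0); first exact: measurable_cst.
  by apply/funext => y; rewrite /series/= big_geq.
rewrite (_ : (fun y => _) = fun y => series (fun k => f (k.+1%:R * expR (- y))) n +
    f (n.+1%:R * expR (- y))).
  apply: measurable_funD => //; apply: continuous_measurable_fun.
  exact: continuous_f_expR.
by apply/funext => y; rewrite /series/= big_nat_recr.
Qed.

Lemma cvg_partial_f (y : R) :
  series (fun k => f (k.+1%:R * expR (- y))) n @[n --> \oo] --> xi_density y.
Proof. by apply: is_cvg_series_f; exact: expR_gt0. Qed.

Lemma measurable_xi_density : measurable_fun setT xi_density.
Proof.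
apply: (measurable_fun_cvg measurable_partial_f) => y _; exact: cvg_partial_f.
Qed.

Lemma superexp_xi_density : superexp xi_density.
Proof.
split; first exact: measurable_xi_density.
move=> a; pose k := (Num.truncn `|a|).+1.
have ak : a <= k%:R.
  have /truncn_itv/andP[_ /ltW] := normr_ge0 a; apply: le_trans; exact: ler_norm.
have [C C0 hC] := xi_density_bound k; exists C => y; apply: (le_trans (hC y)).
by rewrite ler_wpM2l// ler_expR lerN2 ler_wpM2r.
Qed.

(** The functional equation concerns the full sum. For partial sums the bound used as y tends to +oo
    is C/x = C e^y, integrable against e^(-(Re s) y) because Re s > 1. *)
Lemma cvg_laplace_partial (s : R[i]) : 1 < Re s ->
  let L n := laplace (fun y => series (fun k => f (k.+1%:R * expR (- y))) n) s in
  Re (L n) @[n --> \oo] --> Re (laplace xi_density s) /\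
  Im (L n) @[n --> \oo] --> Im (laplace xi_density s).
Proof.
move=> s1 L.
pose a := Re s - 1; have a0 : 0 < a by rewrite subr_gt0.
(* For y < 0 this power outweighs e^(-(Re s) y) and still leaves e^(a y). *)
pose k := (Num.truncn (2 * Re s)).+1.
have sk : 2 * Re s <= k%:R.
  have h : 0 <= 2 * Re s by lra.
  by have /truncn_itv/andP[_ /ltW] := h.
have [C0 C00 hC0] := sum_norm_f_le R 0; have [C1 C10 hC1] := sum_norm_f_le R k.
pose F n y : R := series (fun k => f (k.+1%:R * expR (- y))) n.
have inv_exp j (z : R) : (expR (- z) ^+ j)^-1 = expR (j%:R * z).
  by rewrite -expRM_natr -expRN; congr expR; ring.
have FC n y : `|F n y| * expR (- (Re s * y)) <= (C0 + C1) * expR (- (a * `|y|)).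
  have h0 : `|F n y| <= C0 * expR (1 * y).
    rewrite -(inv_exp 1%N); apply: le_trans (hC0 _ n (expR_gt0 (- y))).
    exact: ler_norm_sum.
  have h1 : `|F n y| <= C1 * expR (k.+1%:R * y).
    rewrite -inv_exp; apply: le_trans (hC1 _ n (expR_gt0 (- y))).
    exact: ler_norm_sum.
  have e0 := expR_ge0 (- (a * `|y|)).
  rewrite mulrDl; have [y0|y0] := ger0P y.
    apply: (@le_trans _ _ (C0 * expR (1 * y) * expR (- (Re s * y)))).
      by rewrite ler_wpM2r ?expR_ge0.
    rewrite -mulrA -expRD (_ : 1 * y + _ = - (a * y)); last by rewrite /a; ring.
    by rewrite lerDl mulr_ge0 ?expR_ge0.
  apply: (@le_trans _ _ (C1 * expR (k.+1%:R * y) * expR (- (Re s * y)))).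
    by rewrite ler_wpM2r ?expR_ge0.
  apply: (@le_trans _ _ (C1 * expR (- (a * - y)))); last first.
    by rewrite lerDr mulr_ge0 ?expR_ge0.
  by rewrite -mulrA -expRD ler_wpM2l// ler_expR /a -natr1; nra.
have ig : mu.-integrable setT (fun y => ((C0 + C1) * expR (- (a * `|y|)))%:E).
  by apply: integrable_scale; exact: integrable_expRN_norm.
have main (k' : R -> R) : continuous k' -> (forall y, `|k' y| <= expR (- (Re s * y))) ->
    \int[mu]_y (F n y * k' y) @[n --> \oo] --> \int[mu]_y (xi_density y * k' y).
  move=> ck kb; apply: (@Rintegral_dominated _ (fun n y => F n y * k' y) _ _ _ _ ig _).2.
  - move=> n; apply: measurable_funM; first exact: measurable_partial_f.
    exact: continuous_measurable_fun.
  - by move=> y; apply: cvgM; [exact: cvg_partial_f|exact: cvg_cst].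
  - by move=> n y; rewrite normrM; apply: le_trans (FC n y); rewrite ler_wpM2l.
have LR w : Re (laplace w s) = \int[mu]_y (w y * Re (laplace_ker s y)).
  by apply: eq_Rintegral => y _; rewrite Re_real_mul.
have LI w : Im (laplace w s) = \int[mu]_y (w y * Im (laplace_ker s y)).
  by apply: eq_Rintegral => y _; rewrite Im_real_mul.
split.
  rewrite LR (funext (fun n => LR (F n))).
  apply: main; first exact: continuous_Re_laplace_ker.
  by move=> y; rewrite -normc_laplace_ker normc_ge_Re.
rewrite LI (funext (fun n => LI (F n))).
apply: main; first exact: continuous_Im_laplace_ker.
by move=> y; rewrite -normc_laplace_ker normc_ge_Im.
Qed.

Lemma laplace_partial (s : R[i]) n : 0 < Re s ->
  cintegrable (fun y => (series (fun k => f (k.+1%:R * expR (- y))) n)%:C * laplace_ker s y) /\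
  laplace (fun y => series (fun k => f (k.+1%:R * expR (- y))) n) s =
  series (fun k => laplace (fun y => f (k.+1%:R * expR (- y))) s) n.
Proof.
move=> s0; elim: n => [|n [IH1 IH2]].
  have E : (fun y : R => (series (fun k => f (k.+1%:R * expR (- y))) 0)%:C * laplace_ker s y) = fun=> 0.
    by apply/funext => y; rewrite /series/= big_geq// mul0r.
  rewrite /laplace E [RHS]/series/= big_geq//; split.
    by split; exact: integrable0.
  by apply: complex_ext; rewrite /cintegral/= Rintegral_cst//= mul0r.
have E : (fun y : R => (series (fun k => f (k.+1%:R * expR (- y))) n.+1)%:C * laplace_ker s y) =
    fun y => (series (fun k => f (k.+1%:R * expR (- y))) n)%:C * laplace_ker s y +
      (f (n.+1%:R * expR (- y)))%:C * laplace_ker s y.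
  by apply/funext => y; rewrite {1}/series/= big_nat_recr//= rmorphD mulrDl.
rewrite /laplace E; split; first by apply: cintegrableD => //; exact: cintegrable_f.
rewrite cintegralD//; last exact: cintegrable_f.
by rewrite [RHS]/series/= big_nat_recr//=; congr (_ + _); exact: IH2.
Qed.

Lemma laplace_xi_density (s : R[i]) : 1 < Re s ->
  s * (s - 1) * cpowR pi (- (s / 2)) * Gamma_half_plane (s / 2) * zeta_half_plane s =
  2 * laplace xi_density s.
Proof.
move=> s1; have s0 : 0 < Re s by lra.
have [z [-> zR zI]] := cvg_zeta s1.
have [LR LI] := cvg_laplace_partial s1.
set K := s * (s - 1) * cpowR pi (- (s / 2)) * Gamma_half_plane (s / 2).
have key n : K * series (fun n => cpowR n.+1%:R (- s)) n =
    2 * laplace (fun y => series (fun k => f (k.+1%:R * expR (- y))) n) s.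
  rewrite (laplace_partial n s0).2 /series/= !mulr_sumr; apply: eq_bigr => k _.
  exact: xi_term.
have hD (u v : nat -> R) (a b l m : R) : u n @[n --> \oo] --> l -> v n @[n --> \oo] --> m ->
    a * u n + b * v n @[n --> \oo] --> a * l + b * m.
  by move=> ul vm; apply: cvgD; apply: cvgM => //; exact: cvg_cst.
apply: complex_ext.
  have h1 := hD _ _ (Re K) (- Im K) _ _ zR zI; have h2 := hD _ _ 2 0 _ _ LR LI.
  rewrite [LHS]ReM [RHS]ReM (Re_nat R 2) (Im_nat R 2).
  have E : (fun n => Re K * Re (series (fun n => cpowR n.+1%:R (- s)) n) +
      - Im K * Im (series (fun n => cpowR n.+1%:R (- s)) n)) =
    (fun n => 2 * Re (laplace (fun y => series (fun k => f (k.+1%:R * expR (- y))) n) s) +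
      0 * Im (laplace (fun y => series (fun k => f (k.+1%:R * expR (- y))) n) s)).
    apply/funext => n; have := congr1 (@complex.Re R) (key n).
    rewrite [Re (K * _)]ReM [Re (2 * _)]ReM (Re_nat R 2) (Im_nat R 2) => H.
    by rewrite mulNr H mul0r subr0 addr0.
  rewrite E in h1; have := @cvg_unique _ (@Rhausdorff R) _ _ _ _ h1 h2.
  by rewrite mulNr => ->; rewrite !mul0r addr0 subr0.
have h1 := hD _ _ (Im K) (Re K) _ _ zR zI; have h2 := hD _ _ 0 2 _ _ LR LI.
rewrite [LHS]ImM [RHS]ImM (Re_nat R 2) (Im_nat R 2).
have E : (fun n => Im K * Re (series (fun n => cpowR n.+1%:R (- s)) n) +
    Re K * Im (series (fun n => cpowR n.+1%:R (- s)) n)) =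
  (fun n => 0 * Re (laplace (fun y => series (fun k => f (k.+1%:R * expR (- y))) n) s) +
    2 * Im (laplace (fun y => series (fun k => f (k.+1%:R * expR (- y))) n) s)).
  apply/funext => n; have := congr1 (@complex.Im R) (key n).
  rewrite [Im (K * _)]ImM [Im (2 * _)]ImM (Re_nat R 2) (Im_nat R 2) => H.
  by rewrite addrC H mul0r addr0 add0r.
rewrite E in h1; have := @cvg_unique _ (@Rhausdorff R) _ _ _ _ h1 h2.
by rewrite addrC => ->; rewrite addrC.
Qed.

(** The transform satisfies [is_complete_zeta], so [xget] returns a function with that property, and
    uniqueness identifies the two at every s. *)
Lemma xiE (s : R[i]) : xi s = 2 * laplace xi_density s.
Proof.
have h : is_complete_zeta (fun s : R[i] => 2 * laplace xi_density s).
  split; first exact: (@entireM _ _ _ (@entire_cst _ 2) (entire_laplace superexp_xi_density)).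
  by move=> z z1; rewrite -laplace_xi_density.
have hxi : is_complete_zeta (@xi R) := xgetPex (fun=> 0) (ex_intro _ _ h).
by rewrite (is_complete_zeta_unique hxi h).
Qed.

(** For y > 0 the branch sums to fsum(e^y) e^((1 - sigma) y), which [fsum_inv] turns into F(e^(-y))
    e^(-sigma y). *)
Lemma cvg_P_term (sigma y : R) : cvgn (series (P_term sigma y)) /\
  limn (series (P_term sigma y)) = xi_density y * expR (- (sigma * y)).
Proof.
have scale (u : nat -> R) (k l : R) : series u n @[n --> \oo] --> l ->
    series (fun n => u n * k) n @[n --> \oo] --> l * k.
  move=> ul; rewrite (_ : series _ = fun n => series u n * k).
    by apply: cvgM => //; exact: cvg_cst.
  by apply/funext => n; rewrite /series/= mulr_suml.
suff h : series (P_term sigma y) n @[n --> \oo] --> xi_density y * expR (- (sigma * y)).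
  by split; [exact: cvgP h|exact: cvg_lim h].
rewrite /P_term; have [y0|y0] := lerP y 0; first by apply: scale; exact: cvg_partial_f.
have -> : xi_density y * expR (- (sigma * y)) = fsum (expR y) * expR ((1 - sigma) * y).
  by rewrite (fsum_inv y) mulrAC -expRD [RHS]mulrC; congr (_ * expR _); ring.
by apply: scale; apply: is_cvg_series_f; exact: expR_gt0.
Qed.

(** Both branches evaluate f at some n e^|y| >= 1, where 2 pi x^2 >= 4 > 3. Near 0 f is negative, so
    for y > 0 the positivity of F(e^(-y)) is visible only on the reflected series. *)
Lemma P_term_gt0 (sigma y : R) n : 0 < P_term sigma y n.
Proof.
have fpos (x : R) : 1 <= x -> 0 < f x.
  move=> x1; rewrite /f mulr_gt0 ?expR_gt0// mulr_gt0 ?mulr_gt0 ?pi_gt0//.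
  have p2 := pi_ge2 R; have x2 : 1 <= x ^+ 2 by rewrite exprn_ege1.
  rewrite (_ : _ - _ = x ^+ 2 * (2 * pi * x ^+ 2 - 3)); last by ring.
  have h : 2 * 1 <= pi * x ^+ 2 by rewrite ler_pM.
  by rewrite mulr_gt0//; lra.
have n1 : 1 <= n.+1%:R :> R by rewrite ler1n.
rewrite /P_term; case: ifPn => y0; rewrite mulr_gt0 ?expR_gt0//; apply: fpos.
  by rewrite -[leLHS](mulr1 1) ler_pM// leNgt expR_lt1 oppr_lt0 -leNgt.
rewrite -ltNge in y0.
by rewrite -[leLHS](mulr1 1) ler_pM// leNgt expR_lt1 -leNgt ltW.
Qed.

End complete_zeta.

(** * Measures with a density *)

Section density_measure.
Variables (R : realType) (p : R -> R).
Let leb := @lebesgue_measure R.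
Hypothesis mp : measurable_fun setT p.
Hypothesis p0 : forall y, 0 <= p y.
Hypothesis p1 : (\int[leb]_y (p y)%:E = 1)%E.

Definition density_prob (A : set (measurableTypeR R)) : \bar R :=
  (\int[leb]_(y in A) (p y)%:E)%E.

Let integrable_p : leb.-integrable setT (EFin \o p).
Proof.
apply/integrableP; split; first exact/measurable_EFinP.
by under eq_integral do rewrite /= ger0_norm//; rewrite p1 ltry.
Qed.

Let density0 : density_prob set0 = 0%E.
Proof. exact: integral_set0. Qed.

Let density_ge0 A : (0 <= density_prob A)%E.
Proof. by apply: integral_ge0 => y _; rewrite lee_fin. Qed.

Let density_sigma_additive : semi_sigma_additive density_prob.
Proof.
move=> /= A mA tA mUA; rewrite /density_prob integral_bigcup//; last first.
  exact: (integrableS _ _ (@subsetT _ _) integrable_p).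
by apply: is_cvg_ereal_nneg_natsum_cond => n _ _; exact: density_ge0.
Qed.

HB.instance Definition _ := isMeasure.Build _ _ _
  density_prob density0 density_ge0 density_sigma_additive.

Let density_setT : density_prob setT = 1%E.
Proof. exact: p1. Qed.

HB.instance Definition _ :=
  @Measure_isProbability.Build _ _ R density_prob density_setT.

Definition density_probability : probability (measurableTypeR R) R := density_prob.

(** The Radon-Nikodym derivative has the same integral as p over every measurable set, hence equals
    p almost everywhere. *)
Lemma Rintegral_density (g : R -> R) : measurable_fun setT g ->
  (forall y, `|g y| <= 1) ->
  \int[density_probability]_y g y = \int[leb]_y (g y * p y).
Proof.
move=> mg g1; rewrite /Rintegral; congr fine.
pose nu : {finite_measure set (measurableTypeR R) -> \bar R} := density_probability.
have dom : nu `<< leb.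
  apply/null_content_dominatesP => A mA lA; apply: null_set_integral => //.
  by apply: measurable_funTS; exact/measurable_EFinP.
have ig : nu.-integrable setT (EFin \o g).
  apply: (@le_integrable _ _ _ _ _ measurableT _ (EFin \o cst 1)).
  - exact/measurable_EFinP.
  - by move=> y _; rewrite /= normr1 lee_fin.
  - exact: finite_measure_integrable_cst.
rewrite -[LHS](@Radon_Nikodym_change_of_variables _ _ _ nu leb dom _ _ measurableT ig).
have iRN := @Radon_Nikodym_integrable _ _ _ (charge_of_finite_measure nu) leb dom.
apply: ae_eq_integral => //.
- apply: emeasurable_funM; first exact/measurable_EFinP.
  exact: measurable_int iRN.
- by apply/measurable_EFinP; exact: measurable_funM.
have H : ae_eq leb setT (Radon_Nikodym (charge_of_finite_measure nu) leb) (EFin \o p).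
  apply: integral_ae_eq => //; first exact/measurable_EFinP.
  by move=> A _ mA; rewrite -Radon_Nikodym_integral.
by apply: filterS H => y /= /[apply] ->; rewrite EFinM.
Qed.

End density_measure.

Theorem theorem1p1 (R : realType) (sigma : R) :
  exists mu : probability (measurableTypeR R) R,
    (forall t : R, Xi sigma t = char_fun mu t) /\
    exists p : R -> R, is_density mu p /\
      forall y : R, cvgn (series (P_term sigma y)) /\ (p y)%:C = P_density sigma y.
Proof.
(* This is P_sigma before normalization; its integral [I] turns out to be xi(sigma) / 2. *)
pose w (y : R) := xi_density y * expR (- (sigma * y)).
have w0 y : 0 < w y.
  have [cP lP] := cvg_P_term sigma y; rewrite /w -lP.
  apply: (@lt_le_trans _ _ (series (P_term sigma y) 1)).
    by rewrite /series/= big_nat1 P_term_gt0.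
  by apply: series_le_limn => // n; exact/ltW/P_term_gt0.
have cker : continuous (fun y : R => expR (- (sigma * y))).
  have -> : (fun y : R => expR (- (sigma * y))) = (fun y => expR (- sigma * y)).
    by apply/funext => y; rewrite mulNr.
  apply: continuous_derivable => y; exact: is_derive_expR_scale.
have mw : measurable_fun setT w.
  by apply: measurable_funM; [exact: measurable_xi_density|exact: continuous_measurable_fun].
have [C wC] := superexp_bound sigma%:C (superexp_xi_density R).
have iw : lebesgue_measure.-integrable setT (EFin \o w).
  apply: (integrable_expRN_norm_le ltr01 mw (C := C)) => y.
  by rewrite normrM (ger0_norm (expR_ge0 _)); exact: wC.
pose I := \int[lebesgue_measure]_y w y.
have IE : (\int[lebesgue_measure]_y (w y)%:E = I%:E)%E.
  by rewrite /I /Rintegral fineK// integrable_fin_num.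
have I0 : 0 < I.
  rewrite lt_neqAle Rintegral_ge0 ?andbT => [|y _]; last exact: ltW.
  (* A zero integral would make w vanish almost everywhere; as w is positive, the exceptional set
     would be the whole line, of infinite measure. *)
  apply/eqP => I0.
  have mEw : measurable_fun setT (EFin \o w) by exact/measurable_EFinP.
  have : (\int[lebesgue_measure]_y `|(EFin \o w) y| = 0)%E.
    by under eq_integral do rewrite gee0_abs ?lee_fin ?(ltW (w0 _))//; rewrite IE -I0.
  have [aux _] := ae_eq_integral_abs (@lebesgue_measure R) measurableT mEw.
  move=> /aux[A [mA A0 sub]].
  have AT : A = setT.
    apply/seteqP; split=> // y _.
    by apply: sub => /= /(_ Logic.I) [] /eqP; rewrite gt_eqF.
  have lT : lebesgue_measure (`]-oo, +oo[%classic : set R) = +oo%E.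
    by rewrite lebesgue_measure_itv.
  rewrite set_itvNyy in lT; rewrite AT in A0.
  by have := etrans (esym A0) lT.
(* At a real point the kernel is e^(-sigma y). Hence xi(sigma) = 2 I is positive for every sigma,
   and the quotient defining [Xi] is a genuine one. *)
have xi_sigma : xi sigma%:C = (2 * I)%:C.
  rewrite xiE rmorphM rmorph_nat/=; congr (_ * _).
  apply: complex_ext.
    by apply: eq_Rintegral => y _; rewrite Re_real_mul Re_laplace_ker /= mul0r cos0 mulr1.
  transitivity (\int[@lebesgue_measure R]_y (0 : R)); last by rewrite Rintegral_cst// mul0r.
  by apply: eq_Rintegral => y _; rewrite Im_real_mul Im_laplace_ker /= mul0r sin0 mulr0 oppr0 mulr0.
pose p y := w y / I.
have mp : measurable_fun setT p by exact: measurable_funM.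
have p0 y : 0 <= p y by rewrite divr_ge0 ?ltW.
have p1 : (\int[lebesgue_measure]_y (p y)%:E = 1)%E.
  under eq_integral do rewrite /p EFinM.
  by rewrite integralZr//= IE -EFinM mulfV ?gt_eqF.
exists (density_probability mp p0 p1); split=> [t|].
  have mcomp (g : R -> R) : continuous g -> continuous (fun y => g (t * y)).
    move=> cg y; apply: continuous_comp; last exact: cg.
    by apply: cvgM; [exact: cvg_cst|exact: cvg_id].
  have mcos : measurable_fun setT (fun y => cos (t * y)).
    by apply: continuous_measurable_fun; apply: mcomp; exact: continuous_cos.
  have msin : measurable_fun setT (fun y => sin (t * y)).
    by apply: continuous_measurable_fun; apply: mcomp; exact: continuous_sin.
  have E : char_fun (density_probability mp p0 p1) t =
      \int[lebesgue_measure]_y (cos (t * y) * p y) +i*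
      \int[lebesgue_measure]_y (sin (t * y) * p y).
    rewrite /char_fun /cintegral; congr (_ +i* _).
      rewrite -Rintegral_density => [|//|y]; last exact: cos_max.
      by apply: eq_Rintegral => y _; rewrite Re_cexp /= expR0 mul1r.
    rewrite -Rintegral_density => [|//|y]; last exact: sin_max.
    by apply: eq_Rintegral => y _; rewrite Im_cexp /= expR0 mul1r.
  (* At s = sigma - i t the kernel is e^(-sigma y) e^(i t y), so the transform of [xi_density] at s
     is the Fourier integral of w at t. *)
  have [iR iI] := superexp_cintegrable (sigma -i* t) (superexp_xi_density R).
  have ER : \int[lebesgue_measure]_y (cos (t * y) * p y) =
      I^-1 * complex.Re (laplace (@xi_density R) (sigma -i* t)).
    rewrite -RintegralZl//; apply: eq_Rintegral => y _.
    by rewrite Re_real_mul Re_laplace_ker /= mulNr cosN /p /w; ring.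
  have EI : \int[lebesgue_measure]_y (sin (t * y) * p y) =
      I^-1 * complex.Im (laplace (@xi_density R) (sigma -i* t)).
    rewrite -RintegralZl//; apply: eq_Rintegral => y _.
    by rewrite Im_real_mul Im_laplace_ker /= mulNr sinN /p /w; ring.
  rewrite E ER EI /Xi xi_sigma xiE rmorphM rmorph_nat/=.
  rewrite -mulf_div divff ?mul1r; last by rewrite pnatr_eq0.
  rewrite -fmorphV mulrC; apply: complex_ext; first by rewrite Re_real_mul.
  by rewrite Im_real_mul.
exists p; split; first by split.
move=> y; have [cP lP] := cvg_P_term sigma y; split=> //.
rewrite /P_density lP xi_sigma -/(w y) /p.
rewrite (_ : 2 = (2 : R)%:C); last by rewrite rmorph_nat.
rewrite -fmorphV -!rmorphM; congr (_%:C); field.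
by rewrite gt_eqF.
Qed.
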